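(* Let $b$ be a positive integer, let $K$ be an $n\times n\times n$ linear tripartite simplicial complex, and suppose that $K$ contains at least $\epsilon n^5$ octahedra. Then $K$ contains a subcomplex $L$ with at least $\epsilon^{b^{25b}}n^2$ faces such that $L$ does not contain a copy of any tripartite disc with area less than $b$ and boundary of length $2$ in which the two boundary edges are mapped to distinct edges of $L$.
   Context: A tripartite simplicial complex is a $2$-dimensional complex (multiple edges allowed) with vertex classes $U,V,W$, edges directed $U\to V$, $V\to W$ or $U\to W$, and triangular faces bounded by one edge of each type. An $n\times n\times n$ linear one has one vertex in each class, $n$ edges of each type, and no two edges in more than one common face; a subcomplex is given by a subset of its faces. Identifying a face with its triple of edges $(x,y,z)$, an octahedron is an $8$-tuple of faces $(t_\omega)_{\omega\in\{0,1\}^3}$ with $x_\omega$ depending only on $(\omega_2,\omega_3)$, $y_\omega$ only on $(\omega_1,\omega_3)$, $z_\omega$ only on $(\omega_1,\omega_2)$ (degeneracies allowed; counted as tuples). A homomorphism between tripartite complexes maps vertices, edges and faces respecting classes, directions and incidences; a copy of $D$ in $L$ is the image of a homomorphism $D\to L$. A tripartite disc is a tripartite complex homeomorphic to a closed disc with each edge in at most two faces; its boundary edges are those in exactly one face, its boundary length is their number, and its area is its number of faces. *)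

(* Defs.v *)
From HB Require Import structures.
From mathcomp Require Import all_boot all_order all_algebra.
From mathcomp Require Import all_classical all_reals all_analysis.
Import Order.TTheory GRing.Theory Num.Theory.
Import numFieldNormedType.Exports.

Set Implicit Arguments.
Unset Strict Implicit.
Unset Printing Implicit Defensive.

(* Edges carry their own types, so parallel edges are allowed. A face is       *)
(* identified with its triple of edges, one from each of U -> V, V -> W and    *)
(* U -> W.                                                                     *)
Record tricomplex := Tricomplex {
  tcU : finType; tcV : finType; tcW : finType;
  tcX : finType; tcY : finType; tcZ : finType;
  srcX : tcX -> tcU; tgtX : tcX -> tcV;
  srcY : tcY -> tcV; tgtY : tcY -> tcW;
  srcZ : tcZ -> tcU; tgtZ : tcZ -> tcW;
  faces : {set tcX * tcY * tcZ};
  facesP : forall x y z, (x, y, z) \in faces ->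
    [/\ srcX x = srcZ z, tgtX x = srcY y & tgtY y = tgtZ z]
}.

Definition vertex (D : tricomplex) : finType := (tcU D + tcV D + tcW D)%type.

Definition edge (D : tricomplex) : finType := (tcX D + tcY D + tcZ D)%type.

Definition incident (D : tricomplex) (e : edge D)
    (f : tcX D * tcY D * tcZ D) : bool :=
  match e with
  | inl (inl x) => f.1.1 == x
  | inl (inr y) => f.1.2 == y
  | inr z => f.2 == z
  end.

Definition face_degree (D : tricomplex) (e : edge D) : nat :=
  #|[set f in faces D | incident e f]|.

Definition area (D : tricomplex) : nat := #|faces D|.

Definition boundary (D : tricomplex) : {set edge D} :=
  [set e | face_degree e == 1%N].

Definition linear_tricomplex (n : nat) (K : tricomplex) : Prop :=
  [/\ #|tcU K| = 1%N, #|tcV K| = 1%N & #|tcW K| = 1%N] /\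
  [/\ #|tcX K| = n, #|tcY K| = n & #|tcZ K| = n] /\
  (forall e e' : edge K, e != e' ->
     (#|[set f in faces K | incident e f && incident e' f]| <= 1)%N).

Lemma subcomplex_facesP (K : tricomplex) (F : {set tcX K * tcY K * tcZ K})
    (sFK : F \subset faces K) x y z : (x, y, z) \in F ->
  [/\ srcX x = srcZ z, tgtX x = srcY y & tgtY y = tgtZ z].
Proof. by move=> /(fintype.subsetP sFK) /facesP. Qed.

Definition subcomplex (K : tricomplex) (F : {set tcX K * tcY K * tcZ K})
    (sFK : F \subset faces K) : tricomplex :=
  Tricomplex (subcomplex_facesP sFK).

(* The index (w1, w2, w3) : bool * bool * bool stands for a point of {0,1}^3. *)
Definition octahedron (K : tricomplex)
    (t : {ffun bool * bool * bool -> tcX K * tcY K * tcZ K}) : bool :=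
  [forall w, t w \in faces K] &&
  [forall w, forall w',
    [&& (w.1.2 == w'.1.2) && (w.2 == w'.2) ==> ((t w).1.1 == (t w').1.1),
        (w.1.1 == w'.1.1) && (w.2 == w'.2) ==> ((t w).1.2 == (t w').1.2)
      & (w.1.1 == w'.1.1) && (w.1.2 == w'.1.2) ==> ((t w).2 == (t w').2)]].

Definition num_octahedra (K : tricomplex) : nat :=
  #|[set t | octahedron (K := K) t]|.

Record tri_hom (D L : tricomplex) := TriHom {
  homU : tcU D -> tcU L; homV : tcV D -> tcV L; homW : tcW D -> tcW L;
  homX : tcX D -> tcX L; homY : tcY D -> tcY L; homZ : tcZ D -> tcZ L;
  hom_srcX : forall x, srcX (homX x) = homU (srcX x);
  hom_tgtX : forall x, tgtX (homX x) = homV (tgtX x);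
  hom_srcY : forall y, srcY (homY y) = homV (srcY y);
  hom_tgtY : forall y, tgtY (homY y) = homW (tgtY y);
  hom_srcZ : forall z, srcZ (homZ z) = homU (srcZ z);
  hom_tgtZ : forall z, tgtZ (homZ z) = homW (tgtZ z);
  hom_faces : forall x y z, (x, y, z) \in faces D ->
    (homX x, homY y, homZ z) \in faces L
}.

Definition tri_hom_edge (D L : tricomplex) (h : tri_hom D L)
    (e : edge D) : edge L :=
  match e with
  | inl (inl x) => inl (inl (homX h x))
  | inl (inr y) => inl (inr (homY h y))
  | inr z => inr (homZ h z)
  end.

Local Open Scope classical_set_scope.
Local Open Scope ring_scope.

Section Realization.
Variables (R : realType) (D : tricomplex).

Definition cell : finType := (vertex D + edge D + {f | f \in faces D})%type.

Definition vertex_cell (v : vertex D) : cell := inl (inl v).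
Definition edge_cell (e : edge D) : cell := inl (inr e).

(* A simplex has at most one vertex in each class, so barycentric coordinates *)
(* are triples (a, b, c) of weights on its U-, V- and W-vertex, with weight 0 *)
(* on a missing class.                                                        *)
Definition std_triangle : set (R * R * R) :=
  [set p | [/\ 0 <= p.1.1, 0 <= p.1.2 & 0 <= p.2] /\
           p.1.1 + p.1.2 + p.2 = 1].

Definition simplex (s : cell) : set (R * R * R) :=
  std_triangle `&`
  match s with
  | inl (inl (inl (inl _))) => [set p | p.1.2 = 0 /\ p.2 = 0]
  | inl (inl (inl (inr _))) => [set p | p.1.1 = 0 /\ p.2 = 0]
  | inl (inl (inr _)) => [set p | p.1.1 = 0 /\ p.1.2 = 0]
  | inl (inr (inl (inl _))) => [set p | p.2 = 0]
  | inl (inr (inl (inr _))) => [set p | p.1.1 = 0]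
  | inl (inr (inr _)) => [set p | p.1.2 = 0]
  | inr _ => setT
  end.

(* The cell whose relative interior contains the point p of a closed cell. *)
Definition edge_carrier (e : edge D) (p : R * R * R) : cell :=
  match e with
  | inl (inl x) =>
      if p.1.1 == 0 then vertex_cell (inl (inr (tgtX x)))
      else if p.1.2 == 0 then vertex_cell (inl (inl (srcX x)))
      else edge_cell e
  | inl (inr y) =>
      if p.1.2 == 0 then vertex_cell (inr (tgtY y))
      else if p.2 == 0 then vertex_cell (inl (inr (srcY y)))
      else edge_cell e
  | inr z =>
      if p.1.1 == 0 then vertex_cell (inr (tgtZ z))
      else if p.2 == 0 then vertex_cell (inl (inl (srcZ z)))
      else edge_cell e
  end.

Definition carrier (s : cell) (p : R * R * R) : cell :=
  match s with
  | inl (inl _) => s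
  | inl (inr e) => edge_carrier e p
  | inr f =>
      if p.1.1 == 0 then edge_carrier (inl (inr (val f).1.2)) p
      else if p.1.2 == 0 then edge_carrier (inr (val f).2) p
      else if p.2 == 0 then edge_carrier (inl (inl (val f).1.1)) p
      else s
  end.

Definition disjoint_simplices : topologicalType := {s : cell & simplex s}.

Definition point_data (q : disjoint_simplices) : cell * (R * R * R) :=
  (carrier (projT1 q) (set_val (projT2 q)), set_val (projT2 q)).

(* Glue along the face inclusions: two points are identified iff they lie in  *)
(* the same open cell with the same barycentric coordinates.                  *)
Definition glued (q q' : disjoint_simplices) : bool :=
  point_data q == point_data q'.

Lemma glued_refl : reflexive glued.
Proof. by move=> q; rewrite /glued. Qed.

Lemma glued_sym : symmetric glued.
Proof. by move=> q q'; rewrite /glued eq_sym. Qed.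

Lemma glued_trans : transitive glued.
Proof. by move=> q q1 q2; rewrite /glued => /eqP ->. Qed.

Definition glued_equiv : equiv_rel disjoint_simplices :=
  EquivRel glued glued_refl glued_sym glued_trans.

Definition realization : topologicalType :=
  quotient_topology {eq_quot glued_equiv}%qT.

End Realization.

Definition homeomorphic (A B : topologicalType) : Prop :=
  exists (f : A -> B) (g : B -> A),
    [/\ continuous f, continuous g, cancel f g & cancel g f].

Definition closed_disc (R : realType) : set (R * R) :=
  [set p | p.1 ^+ 2 + p.2 ^+ 2 <= 1].

Arguments closed_disc : clear implicits.

Definition tripartite_disc (R : realType) (D : tricomplex) : Prop :=
  homeomorphic (realization R D) (set_type (closed_disc R)) /\
  (forall e : edge D, (face_degree e <= 2)%N).

(* Main.v *)
(* Label the edges of K in each class by the same n symbols. A disc with       *)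
(* boundary of length 2 becomes a system of triangles with E edges and F faces *)
(* in which, since every F_2-cocycle on a disc is a coboundary, one finds F/2  *)
(* interior vertices with E = F + 1 + F/2. Eliminating an interior vertex p    *)
(* means replacing each face at p by the eight faces of a wheel whose rim is   *)
(* the far edge of the face, three copies of each spoke and a common new edge. *)
(* If the faces lie in a set L' that is star rich in L (nearly as many wheels  *)
(* in L as possible complete each star of faces in L'), a homomorphism into L' *)
(* yields almost the maximal number of homomorphisms of the new system into L. *)
(* Along a tower of F/2 star rich sets all interior vertices disappear, and    *)
(* the remaining system collapses onto its free edges, so that the number of   *)
(* homomorphisms is trivially bounded. Hence, once the label of one boundary   *)
(* edge is fixed, at most 1/Gam labels are possible for the other one.         *)
(*                                                                             *)
(* Star rich subsets keeping many octahedra are found as follows. If K is far  *)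
(* from complete, choose at random a change of apex h and keep the edges of    *)
(* the link that form an octahedron with h: most closed walks of length 8 in   *)
(* the surviving graph are moved by many h to walks with the same labels, and  *)
(* a Balog-Szemeredi-Gowers argument joins all remaining vertices by many      *)
(* paths of length 3. The conflicts between labels then have bounded degree,   *)
(* and a greedy colouring followed by the choice of the most popular triple of *)
(* colours destroys them all. If K is nearly complete, deleting the edges in   *)
(* too many broken walks gives Gam > 1/2; since a disc also folds onto a       *)
(* single face, the two boundary edges then have the same label.               *)

Require Import Defs.
From HB Require Import structures.
From mathcomp Require Import all_boot all_order all_algebra.
From mathcomp Require Import boolp.
From mathcomp Require Import zify ring lra.
Import Order.TTheory GRing.Theory Num.Theory.

Set Implicit Arguments.
Unset Strict Implicit.
Unset Printing Implicit Defensive.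

(** * Systems of labelled faces *)

(** With the n edges of each class named by labels, linearity says that two labels of a face
    determine the third. A disc with boundary length 2 gives a system with E edges, F faces and a
    set A of interior vertices, where E = F + 1 + |A| ([surface_system]; its topological input is
    [disc_cocycle_trivial]). Collapsing the faces one by one shows that at most n^(E-F-1) = n^|A|
    homomorphisms have a given label at [x0] ([card_hom_family]). This is too weak by the factor
    n^|A|.

    Each elimination of a vertex gains one factor n. If p has s spokes and f faces, the new system
    has 1 + 2s + 8f more edges and 7f more faces, so the trivial bound grows by n^(1+2s+f). But star
    richness turns every homomorphism into [gam] * n^(2+2s+f) homomorphisms of the new system
    ([card_lifts_rich]), and these determine the old one. After |A| eliminations along a [tower], at
    most 1/[Gam] labels are left for [x1] ([tower_bound], [card_copies]).

    Star rich sets come from octahedra: an octahedron is a change of apex h with an edge of the link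
    that h preserves. A closed walk preserved by many h has many partners, that is, walks with the
    same labels ([card_shift_walk]), and partners are what fills a wheel. For general density this
    yields [low_class], for density close to 1 [high_class].

    Two regimes arise because the answer is a pure power of [eps]. If some moderate power of [eps]
    is at most 1/2, absolute constants are absorbed into the exponent, and conflicting labels are
    separated by colouring ([sparse_case]). Otherwise [eps] is so close to 1 that [Gam] > 1/2, which
    leaves room for one label only, already taken by the folded copy [copy_diag] ([dense_case]). *)

Lemma card_bigcup_le (I J : finType) (P : pred I) (F : I -> {set J}) :
  #|\bigcup_(i | P i) F i| <= \sum_(i | P i) #|F i|.
Proof.
elim/big_ind2: _ => [|a1 b1 a2 b2 h1 h2|//]; first by rewrite cards0.
by apply: leq_trans (leq_add h1 h2); rewrite cardsU leq_subr.
Qed.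

Inductive cls := C0 | C1 | C2.
Definition cls_eqb (a b : cls) : bool :=
  match a, b with C0, C0 | C1, C1 | C2, C2 => true | _, _ => false end.
Lemma cls_eqP : Equality.axiom cls_eqb.
Proof. by case; case; constructor. Qed.
HB.instance Definition _ := hasDecEq.Build cls cls_eqP.

Definition nxt c := match c with C0 => C1 | C1 => C2 | C2 => C0 end.

Definition coord (T : Type) c (t : T * T * T) :=
  match c with C0 => t.1.1 | C1 => t.1.2 | C2 => t.2 end.

Section Relations.
Variable T : finType.
Implicit Types (A L : {set T * T * T}) (P : T -> T -> T -> bool).

(* The vertex of class [c] is opposite to the edges of class [c]; its link is   *)
(* the graph of pairs [(x, y)], edge-coloured by [z].                           *)
Definition view A c z x y :=
  match c with
  | C0 => (z, x, y) \in A
  | C1 => (y, z, x) \in A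
  | C2 => (x, y, z) \in A
  end.

(** Linearity of the complex in terms of labels: a partial latin square. [platin] is the same for a
    relation, with the label as first argument. *)
Definition latin A :=
  [/\ forall a b d d', (a, b, d) \in A -> (a, b, d') \in A -> d = d',
      forall a b b' d, (a, b, d) \in A -> (a, b', d) \in A -> b = b'
    & forall a a' b d, (a, b, d) \in A -> (a', b, d) \in A -> a = a'].

Definition platin P :=
  [/\ forall a b d d', P a b d -> P a b d' -> d = d',
      forall a b b' d, P a b d -> P a b' d -> b = b'
    & forall a a' b d, P a b d -> P a' b d -> a = a'].

Lemma view_latin A c : latin A -> platin (view A c).
Proof. by case=> h0 h1 h2; case: c; split => /= *; eauto. Qed.

Lemma latinS A L : L \subset A -> latin A -> latin L.
Proof.
by move=> /subsetP LA [h0 h1 h2]; split=> a b c d /LA ? /LA ?; eauto.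
Qed.

Lemma viewS A L c z x y : L \subset A -> view L c z x y -> view A c z x y.
Proof. by move=> /subsetP LA; case: c => /=; exact: LA. Qed.

Definition same P x y x' y' := [exists z, P z x y && P z x' y'].

(** Edge j of a closed walk joins the nodes j and j+1, cyclically. The link is bipartite, with even
    nodes on one side and odd ones on the other; [evn j] and [odn j] are the two ends of edge j
    sorted by side. *)
Definition evn k (j : 'I_k) : 'I_k := if odd j then ordS j else j.
Definition odn k (j : 'I_k) : 'I_k := if odd j then j else ordS j.

Definition partner P k (W W' : {ffun 'I_k -> T}) :=
  [forall j, same P (W (evn j)) (W (odn j)) (W' (evn j)) (W' (odn j))].

Definition partners P k (w : {ffun 'I_k -> T}) := [set w' | partner P w w'].

(* The closed walk x - y - x1' - y1' - x0 - y0 - x1 - y1 - x: [b] is the base  *)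
(* edge (x0, y0), and [p], [q] hold the inner vertices of the paths from x and *)
(* from y to the base.                                                         *)
Definition walk8 (x y : T) (b p q : T * T) : {ffun 'I_8 -> T} :=
  [ffun j : 'I_8 => nth x [:: x; y; q.1; q.2; b.1; b.2; p.1; p.2] j].

Lemma walk8_inj x y b p q x' y' b' p' q' : walk8 x y b p q = walk8 x' y' b' p' q' ->
  [/\ x = x', y = y', b = b', p = p' & q = q'].
Proof.
move=> /ffunP e; have v k (k8 : k < 8) := e (Ordinal k8).
have := v 7 isT; have := v 6 isT; have := v 5 isT; have := v 4 isT.
have := v 3 isT; have := v 2 isT; have := v 1 isT; have := v 0 isT.
rewrite !ffunE /= => -> -> q1 q2 b1 b2 p1 p2; split=> //.
- by rewrite [LHS]surjective_pairing b1 b2 -surjective_pairing.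
- by rewrite [LHS]surjective_pairing p1 p2 -surjective_pairing.
- by rewrite [LHS]surjective_pairing q1 q2 -surjective_pairing.
Qed.

(* A base edge, paths to it from the edges [S] at a vertex, and for each face   *)
(* of [Fp] at the vertex the nodes of a wheel over the resulting closed walk.   *)
Definition star_choice (E F : finType) P t0 (S : {set E}) (Fp : {set F})
    (sb sd : F -> E) (lab : E -> T)
    (w : (T * T) * {ffun E -> T * T} * {ffun F -> {ffun 'I_8 -> T}}) :=
  [&& w.1.2 \in pffun_on (t0, t0) (mem S) predT,
      w.2 \in pffun_on [ffun=> t0] (mem Fp) predT
    & [forall f in Fp,
        partner P (walk8 (lab (sb f)) (lab (sd f)) w.1.1 (w.1.2 (sb f)) (w.1.2 (sd f)))
          (w.2 f)]].

End Relations.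

Local Open Scope ring_scope.

(** The power of |T| is the trivial upper bound for a latin relation: two labels for the base, two
    for each spoke, and one for each face, since a partner of a walk is determined by one of its
    nodes. So [gam] is the proportion that is attained. [kind] makes the link bipartite, and [t0]
    fills the values outside [S] and [Fp]. *)
Definition star_rich (R : realFieldType) (T : finType) (P : T -> T -> T -> bool)
    (L : T -> T -> bool) (gam : R) (m : nat) :=
  forall (t0 : T) (E F : finType) (S : {set E}) (Fp : {set F}) (sb sd : F -> E)
    (kind : E -> bool) (lab : E -> T),
    (forall f, f \in Fp -> [/\ sb f \in S, sd f \in S, ~~ kind (sb f), kind (sd f)
                             & L (lab (sb f)) (lab (sd f))]) ->
    (#|Fp| <= m)%N -> (#|S| <= m.*2)%N ->
    gam * #|T|%:R ^+ (2 + #|S|.*2 + #|Fp|) <=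
      #|[set w | star_choice P t0 S Fp sb sd lab w]|%:R.

Local Close Scope ring_scope.

(* [lE] and [lF] are the live edges and faces, [ed c f] is the edge of [f] of   *)
(* class [c], and [inc e q] says that [e] ends at [q]. [mt] and [rk] encode a   *)
(* collapse of the faces, and the boundary edges are [x0] and [x1]. [tree q] is *)
(* an edge at [q] through which [q] is reached from the ends of [x1].           *)
Record sys (V : finType) := Sys {
  sE : finType; sF : finType;
  lE : {set sE}; lF : {set sF};
  ed : cls -> sF -> sE;
  ec : sE -> cls;
  inc : sE -> V -> bool;
  tree : V -> sE;
  mt : sF -> sE;
  rk : sF -> nat;
  x0 : sE; x1 : sE
}.

Section System.
Variables (V : finType) (vc : V -> cls) (d : V -> nat).
Implicit Types (S : sys V) (A : {set V}).

Definition in_face S (f : sF S) q := inc (ed (nxt (vc q)) f) q.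

(** [A] holds the vertices still to be eliminated. A vertex in a face lies on the two edges that do
    not have its class ([wf_opp], [wf_inc]). [wf_link] is connectedness of the link of q in the form
    of an induction principle starting at [tree q]. [wf_mt], [wf_mt0] and [wf_rk] say that the faces
    collapse one after the other, each through its own edge, never through [x0]. *)
Record wf S A : Prop := Wf {
  wf_live : forall f c, f \in lF S -> ed c f \in lE S;
  wf_cls : forall f c, f \in lF S -> ec (ed c f) = c;
  wf_opp : forall f q, f \in lF S -> q \in A -> inc (ed (vc q) f) q = false;
  wf_inc : forall f q, f \in lF S -> q \in A ->
    inc (ed (nxt (nxt (vc q))) f) q = inc (ed (nxt (vc q)) f) q;
  wf_uniq : forall f q q', f \in lF S -> q \in A -> q' \in A -> vc q = vc q' ->
    in_face f q -> in_face f q' -> q = q';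
  wf_link : forall q (Q : sE S -> Prop), q \in A -> Q (tree S q) ->
    (forall f c c', f \in lF S -> inc (ed c f) q -> inc (ed c' f) q ->
       Q (ed c f) -> Q (ed c' f)) ->
    forall e, e \in lE S -> inc e q -> Q e;
  wf_tree : forall q, q \in A -> tree S q \in lE S /\ inc (tree S q) q;
  wf_tree_face : forall q, q \in A ->
    exists f c, f \in lF S /\ tree S q = ed c f;
  wf_order : forall q q', q \in A -> q' \in A -> inc (tree S q) q' ->
    q' = q \/ d q' < d q;
  wf_mt : forall f, f \in lF S -> exists c, mt f = ed c f;
  wf_mt0 : forall f, f \in lF S -> mt f != x0 S;
  wf_rk : forall f g c, f \in lF S -> g \in lF S -> f <> g -> mt f = ed c g ->
    rk f < rk g;
  wf_x0 : x0 S \in lE S /\ forall q, q \in A -> ~~ inc (x0 S) q;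
  wf_x1 : x1 S \in lE S /\ forall q, q \in A -> ~~ inc (x1 S) q
}.

(** Eliminating a corner replaces a face by eight faces without that corner. The weight therefore
    bounds the number of faces at every later stage, and with it the sizes of all stars met on the
    way. *)
Definition weight S A := \sum_(f in lF S) 8 ^ #|[set q in A | in_face f q]|.

Variables (T : finType) (t0 : T).

Definition hom S (K : {set T * T * T}) (phi : {ffun sE S -> T}) :=
  (phi \in pffun_on t0 (mem (lE S)) predT) &&
  [forall f in lF S, (phi (ed C0 f), phi (ed C1 f), phi (ed C2 f)) \in K].

Lemma hom_view S K phi f c : @hom S K phi -> f \in lF S ->
  view K c (phi (ed c f)) (phi (ed (nxt c) f)) (phi (ed (nxt (nxt c)) f)).
Proof.
by case/andP=> _ /forall_inP h /h; case: c.
Qed.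

Lemma homP S K phi : phi \in pffun_on t0 (mem (lE S)) predT ->
  (forall f, f \in lF S -> exists c,
     view K c (phi (ed c f)) (phi (ed (nxt c) f)) (phi (ed (nxt (nxt c)) f))) ->
  @hom S K phi.
Proof.
move=> h1 h2; apply/andP; split=> //; apply/forall_inP => f /h2 [].
by case.
Qed.

Lemma hom_outside S K phi e : @hom S K phi -> e \notin lE S -> phi e = t0.
Proof.
case/andP=> /pffun_onP [/subsetP h _] _ he; apply: contraNeq he => he.
by apply: h; rewrite inE.
Qed.

(* The faces collapse in the order of [rk]: the value at [mt f] is determined  *)
(* by the values at the other two edges of [f].                                *)
Lemma hom_collapse S A K phi psi : wf S A -> latin K -> @hom S K phi -> hom K psi ->
  (forall e, e \in lE S -> e \notin [set mt f | f in lF S] -> phi e = psi e) ->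
  phi = psi.
Proof.
move=> W lK hp hq h; apply/ffunP => e.
have [le|nle] := boolP (e \in lE S); last by rewrite (hom_outside hp nle) (hom_outside hq nle).
have [|] := boolP (e \in [set mt f | f in lF S]); last exact: h.
case/imsetP => f lf ->.
have [k] := ubnP (rk f); elim: k f lf => // k IH f lf rf.
have [c mc] := wf_mt W lf.
have oth c' : c' != c -> phi (ed c' f) = psi (ed c' f).
  move=> cc'; have le' := wf_live W c' lf.
  have [/imsetP [g lg mg]|] := boolP (ed c' f \in [set mt f | f in lF S]); last exact: h.
  rewrite mg; apply: IH => //; suff : rk g < rk f by lia.
  apply: (@wf_rk _ _ W g f c') => // gf; move: cc'.
  by rewrite -(wf_cls W c' lf) mg gf mc (wf_cls W) // eqxx.
have := hom_view c hp lf; have := hom_view c hq lf; rewrite mc.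
rewrite (oth (nxt c)) ?(oth (nxt (nxt c))); try by case: (c).
by move=> h1 h2; case: (view_latin c lK) => _ _; apply; eassumption.
Qed.

Lemma mt_live S A f : wf S A -> f \in lF S -> mt f \in lE S.
Proof. by move=> W lf; have [c ->] := wf_mt W lf; exact: (wf_live W c lf). Qed.

(** Two faces with the same matched edge would each have smaller rank than the other. *)
Lemma mt_inj S A : wf S A -> {in lF S &, injective (@mt V S)}.
Proof.
move=> W f g lf lg fg; apply/eqP/negP => /negP /eqP nfg.
have [c mf] := wf_mt W lf; have [c' mg] := wf_mt W lg.
have := wf_rk W lf lg nfg (etrans fg mg).
by have := wf_rk W lg lf (nesym nfg) (etrans (esym fg) mf); lia.
Qed.

(** The [#|lF S|] matched edges and [x0] are distinct, and by [hom_collapse] the values on all other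
    edges determine the homomorphism. *)
Lemma card_hom_family S A K z (H : {set {ffun sE S -> T}}) : wf S A -> latin K ->
  (forall phi, phi \in H -> hom K phi /\ phi (x0 S) = z) ->
  #|H| * #|T| ^ (#|lF S| + 1) <= #|T| ^ #|lE S|.
Proof.
move=> W lK HP; pose M := x0 S |: [set mt f | f in lF S].
have cM : #|M| = #|lF S| + 1.
  rewrite cardsU1 card_in_imset; last exact: (mt_inj W).
  rewrite addnC; congr (_ + _); case: imsetP => // -[f lf e].
  by have := wf_mt0 W lf; rewrite -e eqxx.
have sM : M \subset lE S.
  apply/subsetP => e; rewrite !inE => /orP[/eqP ->|/imsetP [f lf ->]].
    by have [] := wf_x0 W.
  exact: (mt_live W lf).
have cD : #|lE S| = #|lE S :\: M| + (#|lF S| + 1).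
  by rewrite -cM -(cardsID M (lE S)) (setIidPr sM) addnC.
rewrite cD [X in _ <= X]expnD leq_mul2r; apply/orP; right.
pose r (phi : {ffun sE S -> T}) := [ffun e => if e \in lE S :\: M then phi e else t0].
rewrite -(card_in_imset (f := r)).
  have -> : #|T| ^ #|lE S :\: M| = #|pffun_on t0 (mem (lE S :\: M)) (@predT T)|.
    by rewrite card_pffun_on; congr (_ ^ _); apply: eq_card.
  apply: subset_leq_card; apply/subsetP => _ /imsetP [phi _ ->].
  apply/pffun_onP; split=> //; apply/subsetP => e; rewrite !inE ffunE.
  by case: ifP; rewrite ?inE ?eqxx.
move=> phi psi /HP [hp p0] /HP [hq q0] /ffunP e; apply: (hom_collapse W lK hp hq) => x lx nx.
have [->|x0x] := eqVneq x (x0 S); first by rewrite p0.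
by have := e x; rewrite !ffunE !inE lx (negPf x0x) (negPf nx).
Qed.
End System.

(** * Elimination of a vertex *)

Lemma card_set_sum (I J : finType) (P : pred I) (Q : pred J) :
  #|[set x : I + J | match x with inl i => P i | inr j => Q j end]| = #|P| + #|Q|.
Proof.
rewrite -!sum1_card big_mkcond big_sumType /= [\sum_(i in P) 1]big_mkcond.
rewrite [\sum_(i in Q) 1]big_mkcond /=.
by congr addn; apply: eq_bigr => i _; rewrite inE unfold_in.
Qed.

Lemma card_set_fst (I J : finType) (P : pred I) :
  #|[set x : I * J | P x.1]| = #|P| * #|J|.
Proof.
rewrite -cardX; apply: eq_card => -[i j]; rewrite !inE /= andbT.
by rewrite unfold_in.
Qed.

Lemma sum_set_sum (I J K : finType) (P : {set I}) (Q : {set J}) (g : I + J * K -> nat) :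
  \sum_(x in [set x | match x with inl i => i \in P | inr z => z.1 \in Q end]) g x =
  \sum_(i in P) g (inl i) + \sum_(j in Q) \sum_k g (inr (j, k)).
Proof.
rewrite big_mkcond big_sumType /=; congr addn.
  by rewrite [RHS]big_mkcond; apply: eq_bigr => f _; rewrite inE.
rewrite pair_big_dep [RHS]big_mkcond /=; apply: eq_bigr => -[f j] _.
by rewrite inE /= andbT.
Qed.

Section Elim.
Variables (V : finType) (vc : V -> cls) (d : V -> nat).
Variables (S : sys V) (p : V).
Let c := vc p.

Definition pfaces : {set sF S} := [set f in lF S | in_face vc f p].
Definition spokes : {set sE S} := [set e in lE S | inc e p].
Definition bspoke (f : sF S) := ed (nxt c) f.
Definition dspoke (f : sF S) := ed (nxt (nxt c)) f.
Definition far_edge (f : sF S) := ed c f.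

(* Each spoke [e] is tripled to [step_edge i e], all faces at [p] share         *)
(* [base_edge], and [node_edge f j] are the spokes of the wheel replacing [f].  *)
Definition elim_edge : finType := ((sE S + unit) + (sE S * 'I_3 + sF S * 'I_8))%type.
Definition elim_face : finType := (sF S + sF S * 'I_8)%type.

Definition old_edge e : elim_edge := inl (inl e).
Definition base_edge : elim_edge := inl (inr tt).
Definition step_edge (i : 'I_3) e : elim_edge := inr (inl (e, i)).
Definition node_edge f (j : 'I_8) : elim_edge := inr (inr (f, j)).

(** The rim follows [walk8]: rim edge j carries the common label of the pair of nodes j and j+1, so
    1, 2, 3 lead from the y end to the base and 7, 6, 5 from the x end. *)
Definition rim f (j : nat) : elim_edge :=
  match j with
  | 0 => old_edge (far_edge f)
  | 1 => step_edge (@Ordinal 3 0 isT) (dspoke f)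
  | 2 => step_edge (@Ordinal 3 1 isT) (dspoke f)
  | 3 => step_edge (@Ordinal 3 2 isT) (dspoke f)
  | 4 => base_edge
  | 5 => step_edge (@Ordinal 3 2 isT) (bspoke f)
  | 6 => step_edge (@Ordinal 3 1 isT) (bspoke f)
  | _ => step_edge (@Ordinal 3 0 isT) (bspoke f)
  end.

Definition elim_ed c' (x : elim_face) : elim_edge :=
  match x with
  | inl f => old_edge (ed c' f)
  | inr (f, j) => if c' == c then rim f j
                  else if c' == nxt c then node_edge f (evn j)
                  else node_edge f (odn j)
  end.

Definition elim_ec (x : elim_edge) : cls :=
  match x with
  | inl (inl e) => ec e
  | inr (inr (f, j)) => if odd j then nxt (nxt c) else nxt c
  | _ => c
  end.

(** A remaining vertex sits on a wheel only at an end of the far edge. It then lies on the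
    neighbouring rim edge, which is a first copy of a spoke, and on the wheel spoke in between,
    which is node 0 or 1. *)
Definition elim_inc (x : elim_edge) (q : V) : bool :=
  match x with
  | inl (inl e) => inc e q
  | inl (inr _) => false
  | inr (inl (e, i)) => [&& i == 0 :> nat, inc e q &
      vc q == if ec e == nxt c then nxt (nxt c) else nxt c]
  | inr (inr (f, j)) => inc (far_edge f) q &&
      ((j == 0 :> nat) && (vc q == nxt (nxt c)) ||
       (j == 1 :> nat) && (vc q == nxt c))
  end.

(** The rim position that inherits the matched edge of [f]: the far edge itself, or the first copy
    of one of its two spokes. *)
Definition gap f : nat :=
  if mt f == far_edge f then 0 else if mt f == dspoke f then 1 else 7.

Definition elim_mt (x : elim_face) : elim_edge :=
  match x with
  | inl f => old_edge (mt f)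
  | inr (f, j) => if j == gap f :> nat then rim f j else node_edge f (ordS j)
  end.

(** The factor 8 makes room for the faces of a wheel, which are ranked cyclically so that the one at
    the gap comes last. *)
Definition elim_rk (x : elim_face) : nat :=
  match x with
  | inl f => 8 * rk f
  | inr (f, j) => 8 * rk f + (j + 7 - gap f) %% 8
  end.

Definition elim_lE : {set elim_edge} :=
  [set x | match x with
    | inl y => match y with inl e => e \in lE S :\: spokes | inr _ => true end
    | inr y => match y with inl z => z.1 \in spokes | inr z => z.1 \in pfaces end
    end].

Definition elim_lF : {set elim_face} :=
  [set x | match x with inl f => f \in lF S :\: pfaces | inr z => z.1 \in pfaces end].

Definition elim : sys V :=
  @Sys V elim_edge elim_face elim_lE elim_lF elim_ed elim_ec elim_inc
    (fun q => old_edge (tree S q)) elim_mt elim_rk (old_edge (x0 S)) (old_edge (x1 S)).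

Lemma card_elim_lE : #|elim_lE| = #|lE S :\: spokes| + 1 + (#|spokes| * 3 + #|pfaces| * 8).
Proof.
rewrite card_set_sum; congr (_ + _).
  rewrite -(cardsE) (card_set_sum (fun e => e \in lE S :\: spokes) predT); congr (_ + _).
  by rewrite card_unit.
rewrite -(cardsE) (card_set_sum (fun z => z.1 \in spokes) (fun z => z.1 \in pfaces)).
by congr addn; rewrite -[LHS]cardsE card_set_fst card_ord.
Qed.

Lemma card_elim_lF : #|elim_lF| = #|lF S :\: pfaces| + #|pfaces| * 8.
Proof.
rewrite card_set_sum; congr (_ + _).
by rewrite -cardsE card_set_fst card_ord.
Qed.

Variable A : {set V}.
Hypothesis (W : wf vc d S A) (pA : p \in A).
Hypothesis dmax : forall q, q \in A -> d q <= d p.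

Lemma pfacesP f : f \in pfaces ->
  [/\ f \in lF S, bspoke f \in spokes, dspoke f \in spokes & far_edge f \in lE S :\: spokes].
Proof.
rewrite inE => /andP[lf pf]; split=> //; rewrite !inE.
- by rewrite (wf_live W _ lf).
- by rewrite (wf_live W _ lf) /= /dspoke (wf_inc W lf pA).
- by rewrite (wf_live W _ lf) /= /far_edge (wf_opp W lf pA).
Qed.

Lemma non_pface_edge f c' : f \in lF S -> f \notin pfaces -> ed c' f \in lE S :\: spokes.
Proof.
move=> lf; rewrite !inE lf /= (wf_live W _ lf) => npf; rewrite andbT.
have [->|nc] := eqVneq c' c; first by rewrite (wf_opp W lf pA).
have [->|nc'] := eqVneq c' (nxt c); first exact: npf.
have -> : c' = nxt (nxt c) by move: nc nc'; case: (c'); case: c.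
by rewrite (wf_inc W lf pA).
Qed.

(** If [tree q] ended at [p], then [d p] would be below [d q] by [wf_order], against the maximality
    of [d p]. *)
Lemma tree_nonspoke q : q \in A -> q != p -> tree S q \in lE S :\: spokes.
Proof.
move=> qA qp; have [lt tq] := wf_tree W qA; rewrite !inE lt /= andbT.
apply/negP => tp; case: (wf_order W qA pA tp) => [pq|]; first by rewrite pq eqxx in qp.
by have := dmax qA; lia.
Qed.

Lemma bdspoke f : f \in lF S -> bspoke f != dspoke f.
Proof.
move=> lf; apply/eqP => /(congr1 (@ec _ S)); rewrite !(wf_cls W)//.
by case: c.
Qed.

Lemma rim_inj f i j : f \in lF S -> i < 8 -> j < 8 -> rim f i = rim f j -> i = j.
Proof.
move=> /bdspoke bd.
pose key (x : elim_edge) := match x with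
  | inl (inl _) => inl 0 | inl (inr _) => inl 1
  | inr (inl (e, i)) => inr (e == bspoke f, nat_of_ord i) | _ => inl 2 end.
move=> i8 j8 /(congr1 key); move: i8 j8.
case: i => [|[|[|[|[|[|[|[|i]]]]]]]] // _; case: j => [|[|[|[|[|[|[|[|j]]]]]]]] // _ /=;
  by rewrite ?eqxx // [dspoke f == _]eq_sym (negPf bd).
Qed.

Lemma nxt3 a : nxt (nxt (nxt a)) = a. Proof. by case: a. Qed.
Lemma nxt_neq a :
  ((nxt a == a) = false) * ((a == nxt a) = false) *
  ((nxt (nxt a) == a) = false) * ((a == nxt (nxt a)) = false) *
  ((nxt (nxt a) == nxt a) = false) * ((nxt a == nxt (nxt a)) = false).
Proof. by case: a. Qed.

Lemma evn_odd (j : 'I_8) : odd (evn j) = false.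
Proof. by case: j => -[|[|[|[|[|[|[|[|j]]]]]]]]. Qed.
Lemma odn_odd (j : 'I_8) : odd (odn j).
Proof. by case: j => -[|[|[|[|[|[|[|[|j]]]]]]]]. Qed.
Lemma evn0 (j : 'I_8) : (evn j == 0 :> nat) = (j == 0 :> nat) || (j == 7 :> nat).
Proof. by case: j => -[|[|[|[|[|[|[|[|j]]]]]]]]. Qed.
Lemma evn1 (j : 'I_8) : (evn j == 1 :> nat) = false.
Proof. by case: j => -[|[|[|[|[|[|[|[|j]]]]]]]]. Qed.
Lemma odn0 (j : 'I_8) : (odn j == 0 :> nat) = false.
Proof. by case: j => -[|[|[|[|[|[|[|[|j]]]]]]]]. Qed.
Lemma odn1 (j : 'I_8) : (odn j == 1 :> nat) = (j == 0 :> nat) || (j == 1 :> nat).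
Proof. by case: j => -[|[|[|[|[|[|[|[|j]]]]]]]]. Qed.

Lemma elim_edE c' f j : elim_ed c' (inr (f, j)) =
  if c' == c then rim f j
  else if c' == nxt c then node_edge f (evn j) else node_edge f (odn j).
Proof. by []. Qed.

Lemma elim_edc f j : elim_ed c (inr (f, j)) = rim f j.
Proof. by rewrite elim_edE eqxx. Qed.
Lemma elim_edb f j : elim_ed (nxt c) (inr (f, j)) = node_edge f (evn j).
Proof. by rewrite elim_edE eqxx nxt_neq. Qed.
Lemma elim_edd f j : elim_ed (nxt (nxt c)) (inr (f, j)) = node_edge f (odn j).
Proof. by rewrite elim_edE !nxt_neq. Qed.

Lemma cls_cases c' : [\/ c' = c, c' = nxt c | c' = nxt (nxt c)].
Proof.
by case: c' c => [] []; (by apply: Or31) || (by apply: Or32) || (by apply: Or33).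
Qed.

Lemma rim_live f (j : 'I_8) : f \in pfaces -> rim f j \in elim_lE.
Proof.
move=> /pfacesP [lf bf df ff].
by case: j => -[|[|[|[|[|[|[|[|j]]]]]]]] //= _; rewrite inE.
Qed.

Lemma elim_inc_rim f (j : 'I_8) q : f \in pfaces -> q \in A ->
  elim_inc (rim f j) q = inc (far_edge f) q &&
    ((j == 0 :> nat) || (j == 1 :> nat) && (vc q == nxt c)
     || (j == 7 :> nat) && (vc q == nxt (nxt c))).
Proof.
move=> /pfacesP [lf _ _ _] qA.
have [[[[[n1 n2] n3] n4] n5] n6] := nxt_neq c.
have id : vc q = nxt c -> inc (dspoke f) q = inc (far_edge f) q.
  by move=> qc; have /esym := wf_inc W lf qA; rewrite qc nxt3.
have ib : vc q = nxt (nxt c) -> inc (bspoke f) q = inc (far_edge f) q.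
  by move=> qc; have := wf_inc W lf qA; rewrite qc !nxt3.
case: j => -[|[|[|[|[|[|[|[|j]]]]]]]] //= _; rewrite ?andbF ?andbT ?orbF //.
- rewrite /dspoke (wf_cls W) // n5.
  by have [/id -> //|] := eqVneq (vc q) (nxt c); rewrite ?andbF.
- rewrite /bspoke (wf_cls W) // eqxx.
  by have [/ib -> //|] := eqVneq (vc q) (nxt (nxt c)); rewrite ?andbF.
Qed.

Lemma elim_in_face x q : x \in elim_lF -> q \in A ->
  in_face (S := elim) vc x q ->
  match x with inl f => in_face vc f q | inr (f, _) => (q != p) && in_face vc f q end.
Proof.
case: x => [f|[f j]] //; rewrite inE /= => pf qA; rewrite /in_face /=.
have [lf _ _ _] := pfacesP pf.
have [[[[[n1 n2] n3] n4] n5] n6] := nxt_neq c.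
have qp : vc q != c -> q != p by apply: contraNneq => ->.
have [qc|qc|qc] := cls_cases (vc q); rewrite qc.
- by rewrite n1 eqxx /= qc n2 n4 !andbF.
- rewrite n3 n5 /= qc n6 eqxx andbF andbT /= => /andP[fq _].
  rewrite qp ?qc ?n1 //=; have := wf_inc W lf qA; rewrite qc nxt3 /in_face => <-.
  exact: fq.
- rewrite nxt3 eqxx elim_inc_rim // => /andP[fq _].
  by rewrite qp ?qc ?n3.
Qed.

Lemma gap_cases f : f \in lF S -> mt f = match gap f with
  | 0 => far_edge f | 1 => dspoke f | _ => bspoke f end.
Proof.
move=> lf; rewrite /gap; case: eqP => // nf; case: eqP => // nd.
have [c' mc] := wf_mt W lf; have [e|e|e] := cls_cases c'; rewrite e in mc => //.
Qed.

Lemma gap_lt f : gap f < 8.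
Proof. by rewrite /gap; do 2?case: ifP. Qed.

(** Within a wheel, a face away from the gap is matched with the spoke it shares with the next face,
    whose rank is larger by one. Only the face at the gap is matched with a rim edge, and a face of
    another origin contains that edge only if its original contained the old matched edge, so the
    old ranks decide. *)
Lemma wf_elim_rk x y c' : x \in elim_lF -> y \in elim_lF -> x <> y ->
  elim_mt x = elim_ed c' y -> elim_rk x < elim_rk y.
Proof.
have up f g k l : rk f < rk g -> k < 8 -> 8 * rk f + k < 8 * rk g + l by lia.
have mod8 k : k %% 8 < 8 by rewrite ltn_mod.
have rimx f g (i j : nat) : f \in lF S -> g \in lF S -> f <> g -> i < 8 -> i = gap f ->
    rim f i = rim g j -> rk f < rk g.
  move=> lf lg fg i8 ig e; have := gap_cases lf; rewrite -ig.
  have [k [kl kE]] : exists k, rim g j = rim g k /\ k < 8.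
    by case: j e => [|[|[|[|[|[|[|j]]]]]]] e; [exists 0|exists 1|exists 2|exists 3|exists 4|exists 5|exists 6|exists 7].
  rewrite kl in e; move: e; rewrite ig.
  have : gap f \in [:: 0; 1; 7] by rewrite /gap; do 2?case: ifP.
  rewrite !inE => /or3P[] /eqP ->; case: k kE {kl} => [|[|[|[|[|[|[|[|k]]]]]]]] // _ /= [].
  - by move=> e m; apply: (wf_rk W lf lg fg (c := c)); rewrite m e.
  - by move=> e m; apply: (wf_rk W lf lg fg (c := nxt (nxt c))); rewrite m e.
  - by move=> e m; apply: (wf_rk W lf lg fg (c := nxt c)); rewrite m e.
  - by move=> e m; apply: (wf_rk W lf lg fg (c := nxt (nxt c))); rewrite m e.
  - by move=> e m; apply: (wf_rk W lf lg fg (c := nxt c)); rewrite m e.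
case: x => [f|[f i]]; case: y => [g|[g j]]; rewrite ![_ \in elim_lF]inE.
- move=> /setDP[lf _] /setDP[lg _] fg [e] /=.
  have : rk f < rk g by apply: (wf_rk W lf lg _ e) => fg'; apply: fg; rewrite fg'.
  lia.
- move=> /setDP[lf pf] pg0 fg; have {pg0} pg : g \in pfaces := pg0.
  have [lg _ _ _] := pfacesP pg; rewrite elim_edE.
  case: eqP => _; last by case: eqP.
  case: j fg => -[|[|[|[|[|[|[|[|j]]]]]]]] //= ? _ [e].
  rewrite -[8 * rk f]addn0; apply: up => //; apply: (wf_rk W lf lg (c := c) _ e) => fg.
  by rewrite fg pg in pf.
- move=> pf0 /setDP[lg pg] fg; have {pf0} pf : f \in pfaces := pf0.
  have [lf _ _ _] := pfacesP pf; rewrite /=.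
  case: eqP => [ig e|//].
  rewrite -[8 * rk g]addn0; apply: up => //.
  move: e; have := gap_cases lf; rewrite -ig.
  case: i ig fg => -[|[|[|[|[|[|[|[|i]]]]]]]] //= ? _ _ m [e].
  apply: (wf_rk W lf lg (c := c') _ (etrans m e)) => fg.
  by rewrite fg (negPf pg) in pf.
- move=> pf0 pg0 fg; have {pf0} pf : f \in pfaces := pf0.
  have {pg0} pg : g \in pfaces := pg0.
  have [lf _ _ _] := pfacesP pf; have [lg _ _ _] := pfacesP pg.
  rewrite /= ; case: eqP => [ig|nig].
    case: (c' == c); last by case: (c' == nxt c);
      case: i ig fg => -[|[|[|[|[|[|[|[|i]]]]]]]] //=.
    have [gf|/eqP gf] := eqVneq f g; last by move=> e; apply: up => //; exact: rimx e.
    by subst g; move=> /(rim_inj lf (ltn_ord i) (ltn_ord j)) /val_inj ij; case: fg; rewrite ij.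
  case: (c' == c); first by case: j fg => -[|[|[|[|[|[|[|[|j]]]]]]]] //=.
  have key (k : 'I_8) : (k = evn j \/ k = odn j) -> node_edge f (ordS i) = node_edge g k ->
      8 * rk f + (i + 7 - gap f) %% 8 < 8 * rk g + (j + 7 - gap g) %% 8.
    move=> kj [efg ek]; subst g; rewrite ltn_add2l.
    have jS : j = ordS i.
      case: kj ek => ->; rewrite /evn /odn; case: ifP => // _ /(can_inj (@ordSK _)) ij.
        by case: fg; rewrite ij.
      by case: fg; rewrite ij.
    rewrite jS; have := gap_lt f; move: nig; rewrite /gap.
    by case: ifP => _; [|case: ifP => _]; case: (i) => -[|[|[|[|[|[|[|[|k']]]]]]]].
  by case: (c' == nxt c); apply: key; [left|right].
Qed.

Lemma live_old e : (old_edge e \in elim_lE) = (e \in lE S :\: spokes).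
Proof. by rewrite inE. Qed.

Lemma wf_elim_inc x q : x \in elim_lF -> q \in A :\ p ->
  elim_inc (elim_ed (vc q) x) q = false /\
  elim_inc (elim_ed (nxt (nxt (vc q))) x) q = elim_inc (elim_ed (nxt (vc q)) x) q.
Proof.
move=> lx /setD1P [qp qA]; case: x lx => [f|[f j]]; rewrite inE.
  by move=> /setDP[lf _]; split; [exact: (wf_opp W lf qA) | exact: (wf_inc W lf qA)].
move=> pf0; have {pf0} pf : f \in pfaces := pf0.
have [[[[[n1 n2] n3] n4] n5] n6] := nxt_neq c.
have [qc|qc|qc] := cls_cases (vc q); rewrite qc ?nxt3 ?elim_edc ?elim_edb ?elim_edd.
- have [lf _ _ _] := pfacesP pf.
  split; last by rewrite /= qc n2 n4 !andbF.
  by rewrite elim_inc_rim // /far_edge -qc (wf_opp W lf qA).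
- rewrite elim_inc_rim //= qc ?n5 ?n6 ?eqxx !andbT !andbF !orbF evn1 odn1 ?orbF.
  by rewrite !andbF.
- rewrite elim_inc_rim //= qc ?n5 ?n6 ?eqxx !andbT !andbF !orbF odn0 evn0.
  by rewrite !andbF.
Qed.

(** Reading every spoke of [p] as its first copy turns [Q] into a property of the old edges at q, to
    which the old [wf_link] applies: passing through a face at [p] becomes passing through two wheel
    faces around one node edge. *)
Lemma wf_elim_link q (Q : sE elim -> Prop) : q \in A :\ p -> Q (old_edge (tree S q)) ->
  (forall x a b, x \in elim_lF -> elim_inc (elim_ed a x) q -> elim_inc (elim_ed b x) q ->
     Q (elim_ed a x) -> Q (elim_ed b x)) ->
  forall e, e \in elim_lE -> elim_inc e q -> Q e.
Proof.
move=> /setD1P [qp qA] Qt QF.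
have [[[[[n1 n2] n3] n4] n5] n6] := nxt_neq c.
have lF1 f j : f \in pfaces -> inr (f, j) \in elim_lF by move=> pf; rewrite inE.
pose j0 := @Ordinal 8 0 isT; pose j1 := @Ordinal 8 1 isT; pose j7 := @Ordinal 8 7 isT.
pose s0 := step_edge (@Ordinal 3 0 isT).
have up f : f \in pfaces -> inc (far_edge f) q -> vc q = nxt (nxt c) ->
   (Q (old_edge (far_edge f)) <-> Q (s0 (bspoke f))) /\
   (Q (old_edge (far_edge f)) -> Q (node_edge f j0)).
  move=> pf fq qc.
  have i0 : elim_inc (elim_ed c (inr (f, j0))) q.
    by rewrite elim_edc elim_inc_rim // fq.
  have i0' : elim_inc (elim_ed (nxt c) (inr (f, j0))) q.
    by rewrite elim_edb /= fq qc eqxx.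
  have i7 : elim_inc (elim_ed c (inr (f, j7))) q.
    by rewrite elim_edc elim_inc_rim // fq qc eqxx orbT.
  have i7' : elim_inc (elim_ed (nxt c) (inr (f, j7))) q.
    by rewrite elim_edb /= fq qc eqxx.
  have e07 : node_edge f (evn j7) = node_edge f (evn j0).
    by congr (node_edge f _); apply: val_inj.
  have h1 := QF _ _ _ (lF1 f j0 pf) i0 i0'; have h2 := QF _ _ _ (lF1 f j0 pf) i0' i0.
  have h3 := QF _ _ _ (lF1 f j7 pf) i7 i7'; have h4 := QF _ _ _ (lF1 f j7 pf) i7' i7.
  rewrite !elim_edc !elim_edb e07 /= in h1 h2 h3 h4.
  have e0 : node_edge f (evn j0) = node_edge f j0.
    by congr (node_edge f _); apply: val_inj.
  by rewrite e0 in h1 h2 h3 h4; split; [split; auto|].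
have dn f : f \in pfaces -> inc (far_edge f) q -> vc q = nxt c ->
   (Q (old_edge (far_edge f)) <-> Q (s0 (dspoke f))) /\
   (Q (old_edge (far_edge f)) -> Q (node_edge f j1)).
  move=> pf fq qc.
  have i0 : elim_inc (elim_ed c (inr (f, j0))) q.
    by rewrite elim_edc elim_inc_rim // fq.
  have i0' : elim_inc (elim_ed (nxt (nxt c)) (inr (f, j0))) q.
    by rewrite elim_edd /= fq qc eqxx.
  have i7 : elim_inc (elim_ed c (inr (f, j1))) q.
    by rewrite elim_edc elim_inc_rim // fq qc eqxx.
  have i7' : elim_inc (elim_ed (nxt (nxt c)) (inr (f, j1))) q.
    by rewrite elim_edd /= fq qc eqxx.
  have e07 : node_edge f (odn j1) = node_edge f (odn j0).
    by congr (node_edge f _); apply: val_inj.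
  have h1 := QF _ _ _ (lF1 f j0 pf) i0 i0'; have h2 := QF _ _ _ (lF1 f j0 pf) i0' i0.
  have h3 := QF _ _ _ (lF1 f j1 pf) i7 i7'; have h4 := QF _ _ _ (lF1 f j1 pf) i7' i7.
  rewrite !elim_edc !elim_edd e07 /= in h1 h2 h3 h4.
  have e0 : node_edge f (odn j0) = node_edge f j1.
    by congr (node_edge f _); apply: val_inj.
  by rewrite e0 in h1 h2 h3 h4; split; [split; auto|].
pose Q' e := if inc e p then Q (s0 e) else Q (old_edge e).
have Q'all e : e \in lE S -> inc e q -> Q' e.
  apply: (wf_link W (Q := Q') qA).
    by rewrite /Q'; have /setDP[lt] := tree_nonspoke qA qp; rewrite inE lt /= => /negPf ->.
  move=> f a b lf fa fb.
  have [pf|npf] := boolP (f \in pfaces); last first.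
    have := non_pface_edge a lf npf; have := non_pface_edge b lf npf.
    rewrite !inE !(wf_live W _ lf) /= !andbT /Q' => /negPf -> /negPf ->.
    apply: (QF (inl f)) => //; by rewrite inE; apply/setDP.
  have [_] := pfacesP pf; rewrite !inE => /andP[_ ib] /andP[_ id] _.
  have ne x : inc (ed x f) q -> x <> vc q by move=> h xq; rewrite xq (wf_opp W lf qA) in h.
  have pfp : in_face vc f p by move: pf; rewrite inE => /andP[].
  have nf' : inc (far_edge f) p = false by rewrite /far_edge (wf_opp W lf pA).
  have ib' : inc (bspoke f) p = true := ib; have id' : inc (dspoke f) p = true := id.
  have [qc|qc|qc] := cls_cases (vc q).
  - have fq : in_face vc f q.
      rewrite /in_face; have := wf_inc W lf qA.
      have [ea|ea|ea] := cls_cases a; rewrite ea in fa.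
      + by case: (ne _ fa).
      + by rewrite qc fa.
      + by rewrite qc fa => <-.
    by move: qp; rewrite (wf_uniq W lf qA pA qc fq pfp) eqxx.
  - have fq : inc (far_edge f) q.
      have := wf_inc W lf qA; rewrite qc nxt3 => eI.
      have [ea|ea|ea] := cls_cases a; rewrite ea in fa; first exact: fa.
        by case: (ne _ fa).
      by rewrite /far_edge eI fa.
    have [h _] := dn f pf fq qc.
    have [ea|ea|ea] := cls_cases a; rewrite ea in fa *; last 2 first.
    + by case: (ne _ fa).
    + have [eb|eb|eb] := cls_cases b; rewrite eb in fb *; last 2 first.
      * by case: (ne _ fb).
      * by [].
      * by rewrite /Q' -/(dspoke f) -/(far_edge f) nf' id' => /h.
    + have [eb|eb|eb] := cls_cases b; rewrite eb in fb *; last 2 first.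
      * by case: (ne _ fb).
      * by rewrite /Q' -/(dspoke f) -/(far_edge f) nf' id' => /h.
      * by [].
  - have fq : inc (far_edge f) q.
      have := wf_inc W lf qA; rewrite qc !nxt3 => eI.
      have [ea|ea|ea] := cls_cases a; rewrite ea in fa; first exact: fa.
        by rewrite /far_edge -eI fa.
      by case: (ne _ fa).
    have [h _] := up f pf fq qc.
    have [ea|ea|ea] := cls_cases a; rewrite ea in fa *; last first.
    + by case: (ne _ fa).
    + have [eb|eb|eb] := cls_cases b; rewrite eb in fb *; last first.
      * by case: (ne _ fb).
      * by [].
      * by rewrite /Q' -/(bspoke f) -/(far_edge f) nf' ib' => /h.
    + have [eb|eb|eb] := cls_cases b; rewrite eb in fb *; last first.
      * by case: (ne _ fb).
      * by rewrite /Q' -/(bspoke f) -/(far_edge f) nf' ib' => /h.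
      * by [].
have Qold e : e \in lE S :\: spokes -> inc e q -> Q (old_edge e).
  move=> /setDP[le ne] eq; have := Q'all e le eq; rewrite /Q'.
  by move: ne; rewrite inE le /= => /negPf ->.
have Qstep e : e \in spokes -> inc e q -> Q (s0 e).
  by rewrite inE => /andP[le ep] eq; have := Q'all e le eq; rewrite /Q' ep.
case=> [[e|[]]|[[e i]|[f j]]] //; rewrite inE; first exact: Qold.
  move=> es /= /and3P[/eqP i0 eq _].
  have -> : i = @Ordinal 3 0 isT by apply: val_inj.
  exact: Qstep.
move=> pf0; have {pf0} pf : f \in pfaces := pf0.
have [_ _ _ lf] := pfacesP pf.
move=> /= /andP[fq /orP[]] /andP[/eqP j0E /eqP qc].
  have -> : j = j0 by apply: val_inj.
  by have [_ h] := up f pf fq qc; apply: h; exact: Qold.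
have -> : j = j1 by apply: val_inj.
by have [_ h] := dn f pf fq qc; apply: h; exact: Qold.
Qed.

Lemma wf_elim : wf vc d elim (A :\ p).
Proof.
have [[[[[n1 n2] n3] n4] n5] n6] := nxt_neq c.
have inA q : q \in A :\ p -> q \in A by case/setD1P.
split.
- move=> [f|[f j]] a; rewrite [_ \in lF _]inE.
    by move=> /setDP[lf pf]; rewrite live_old; exact: non_pface_edge.
  move=> pf0; have {pf0} pf : f \in pfaces := pf0.
  rewrite [ed _ _]elim_edE; case: ifP => _; first exact: rim_live.
  by case: ifP => _; rewrite inE.
- move=> [f|[f j]] a; rewrite [_ \in lF _]inE.
    by move=> /setDP[lf pf]; exact: (wf_cls W).
  move=> pf0; have {pf0} pf : f \in pfaces := pf0.
  have [lf _ _ _] := pfacesP pf.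
  have [->|->|->] := cls_cases a; rewrite [ed _ _](elim_edc, elim_edb, elim_edd).
  + case: j => -[|[|[|[|[|[|[|[|j]]]]]]]] //= _; exact: (wf_cls W).
  + by rewrite /= evn_odd.
  + by rewrite /= odn_odd.
- by move=> x q lx qA; have [] := wf_elim_inc lx qA.
- by move=> x q lx qA; have [] := wf_elim_inc lx qA.
- move=> x q q' lx /inA qA /inA q'A qq' /(elim_in_face lx qA) + /(elim_in_face lx q'A).
  case: x lx => [f|[f j]]; rewrite [_ \in lF _]inE.
    by move=> /setDP[lf _]; exact: (wf_uniq W lf).
  move=> pf0; have {pf0} pf : f \in pfaces := pf0.
  have [lf _ _ _] := pfacesP pf.
  by move=> /andP[_ h] /andP[_ h']; exact: (wf_uniq W lf qA q'A).
- move=> q Q qA Qt QF; exact: wf_elim_link.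
- move=> q /setD1P [qp qA]; split; first by rewrite live_old tree_nonspoke.
  by have [] := wf_tree W qA.
- move=> q /setD1P [qp qA]; have [f [a [lf ta]]] := wf_tree_face W qA.
  have [pf|npf] := boolP (f \in pfaces); last first.
    exists (inl f), a; rewrite inE; split; first exact/setDP.
    by rewrite /= ta.
  exists (inr (f, ord0)), c; split; first by rewrite inE.
  rewrite [ed _ _]elim_edc /= ta; congr old_edge; rewrite /far_edge; congr ed.
  have := tree_nonspoke qA qp; rewrite ta; have [_ bs ds _] := pfacesP pf.
  have [->|->|->] := cls_cases a => //.
    by rewrite inE bs.
  by rewrite inE ds.
- by move=> q q' /inA qA /inA q'A; exact: (wf_order W).
- move=> [f|[f j]]; rewrite [_ \in lF _]inE.
    by move=> /setDP[/(wf_mt W) [a ma] _]; exists a; rewrite /= ma.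
  move=> pf0; rewrite [mt _]/=; case: eqP => _; first by exists c; rewrite [ed _ _]elim_edc.
  have [oj|ej] := boolP (odd j).
    exists (nxt c); rewrite [ed _ _]elim_edb; congr node_edge.
    by rewrite /evn oj.
  exists (nxt (nxt c)); rewrite [ed _ _]elim_edd; congr node_edge.
  by rewrite /odn (negPf ej).
- move=> [f|[f j]]; rewrite [_ \in lF _]inE.
    by move=> /setDP[/(wf_mt0 W) m0 _]; apply: contra_neq m0 => -[].
  move=> pf0; have {pf0} pf : f \in pfaces := pf0.
  have [lf _ _ _] := pfacesP pf.
  apply/eqP; rewrite /=; case: eqP => [jg|] //.
  case: j jg => -[|[|[|[|[|[|[|[|j]]]]]]]] //= _ jg.
  have := gap_cases lf; rewrite -jg => m0 [x0E].
  by have := wf_mt0 W lf; rewrite m0 x0E eqxx.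
- exact: wf_elim_rk.
- have [l0 n0] := wf_x0 W; split; last by move=> q /inA; exact: n0.
  by rewrite live_old !inE l0 andbT /= n0.
- have [l0 n0] := wf_x1 W; split; last by move=> q /inA; exact: n0.
  by rewrite live_old !inE l0 andbT /= n0.
Qed.

(** Eight faces replace one, and each of them has lost the corner [p]: the factors 8 cancel. *)
Lemma weight_elim : weight vc elim (A :\ p) <= weight vc S A.
Proof.
rewrite /weight [X in _ <= X](big_setID pfaces) /= addnC.
have -> : \sum_(f in elim_lF) 8 ^ #|[set q in A :\ p | in_face (S := elim) vc f q]| =
  \sum_(f in lF S :\: pfaces) 8 ^ #|[set q in A :\ p | in_face (S := elim) vc (inl f) q]| +
  \sum_(f in pfaces) \sum_(j < 8) 8 ^ #|[set q in A :\ p | in_face (S := elim) vc (inr (f, j)) q]|.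
  exact: (sum_set_sum (lF S :\: pfaces) pfaces
            (fun x => 8 ^ #|[set q in A :\ p | in_face (S := elim) vc x q]|)).
have -> : lF S :&: pfaces = pfaces.
  by apply/setIidPr/subsetP => f; rewrite inE => /andP[].
apply: leq_add; apply: leq_sum => f.
  move=> _; rewrite leq_exp2l //; apply: subset_leq_card; apply/subsetP => q.
  by rewrite !inE => /andP[/andP[_ ->] h]; exact: h.
move=> pf.
have pin : p \in [set q in A | in_face vc f q].
  by move: pf; rewrite !inE pA => /andP[].
rewrite (cardsD1 p [set q in A | in_face vc f q]) pin expnD expn1.
rewrite -[X in X * _]card_ord -sum_nat_const; apply: leq_sum => j _.
rewrite leq_exp2l //; apply: subset_leq_card; apply/subsetP => q.
rewrite !inE => /andP[/andP[qp qA] /elim_in_face]; rewrite inE => /(_ pf qA) /andP[_ ->].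
by rewrite qp qA.
Qed.
End Elim.

(** * Lifting homomorphisms along an elimination *)

Section Lift.
Variables (V : finType) (vc : V -> cls) (d : V -> nat).
Variables (S : sys V) (p : V) (A : {set V}).
Hypothesis (W : wf vc d S A) (pA : p \in A).
Variables (T : finType) (t0 : T) (K L : {set T * T * T}).
Hypothesis (lK : latin K) (LK : L \subset K).
Let c := vc p.
Let P := view K c.
Notation spokes := (spokes S p).
Notation pfaces := (pfaces vc S p).
Notation bspoke := (bspoke vc p).
Notation dspoke := (dspoke vc p).
Notation far_edge := (far_edge vc p).
Notation elim := (elim vc S p).

Definition link_rel (M : {set T * T * T}) c x y := [exists z, view M c z x y].

Definition lbl x y := odflt t0 [pick z | P z x y].

Lemma lblP z x y : P z x y -> lbl x y = z.
Proof.
have [_ _ l2] := view_latin c lK.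
rewrite /lbl; case: pickP => [z' h1 h2|h1]; last by rewrite h1.
exact: l2 h1 h2.
Qed.

(** Lying in a live face is a property that [wf_link] spreads from [tree p] to all edges at [p]. *)
Lemma spoke_face e : e \in spokes ->
  exists2 f, f \in pfaces & e = bspoke f \/ e = dspoke f.
Proof.
rewrite inE => /andP[le ep].
have [f [a [lf ea]]] : exists f a, f \in lF S /\ e = ed a f.
  pose Q x := exists f a, f \in lF S /\ x = ed a f.
  apply: (wf_link W (Q := Q) pA) => //; first exact: (wf_tree_face W pA).
  by move=> f a b lf _ _ _; exists f, b.
have [ac|ac|ac] := cls_cases vc p a.
- by move: ep; rewrite ea ac (wf_opp W lf pA).
- exists f; last by left; rewrite ea ac.
  by rewrite inE lf /= /in_face -ac -ea.
- exists f; last by right; rewrite ea ac.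
  by rewrite inE lf /= /in_face -(wf_inc W lf pA) -ac -ea.
Qed.

Lemma card_spokes : #|spokes| <= #|pfaces|.*2.
Proof.
have : spokes \subset (bspoke @: pfaces) :|: (dspoke @: pfaces).
  apply/subsetP => e /spoke_face [f pf [->|->]]; rewrite inE imset_f ?orbT //.
move/subset_leq_card/leq_trans; apply.
rewrite cardsU; apply: leq_trans (leq_subr _ _) _; rewrite -addnn; apply: leq_add; exact: leq_imset_card.
Qed.

Lemma pfaces_nonempty : exists f, f \in pfaces.
Proof.
have [lt tp] := wf_tree W pA.
by have [|f pf _] := @spoke_face (tree S p); [rewrite inE lt | exists f].
Qed.

Variable phi : {ffun sE S -> T}.
Hypothesis hphi : hom t0 L phi.

Definition choice : finType :=
  ((T * T) * {ffun sE S -> T * T} * {ffun sF S -> {ffun 'I_8 -> T}})%type.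

(** Rim edges receive the labels of the consecutive pairs of the closed walk, and node edges the
    nodes of the partner chosen for the face. A partner has the same labels, so every wheel face is
    mapped to a face of [K]. *)
Definition lift (w : choice) : {ffun sE elim -> T} :=
  [ffun x : elim_edge S => match x with
   | inl (inl e) => if e \in lE S :\: spokes then phi e else t0
   | inl (inr _) => lbl w.1.1.1 w.1.1.2
   | inr (inl (e, i)) =>
     if e \notin spokes then t0 else
     if ec e == nxt c then
       nth t0 [:: lbl (phi e) (w.1.2 e).2; lbl (w.1.2 e).1 (w.1.2 e).2;
                  lbl (w.1.2 e).1 w.1.1.2] i
     else
       nth t0 [:: lbl (w.1.2 e).1 (phi e); lbl (w.1.2 e).1 (w.1.2 e).2;
                  lbl w.1.1.1 (w.1.2 e).2] i
   | inr (inr (f, j)) => w.2 f j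
   end].

Definition face_walk (w : choice) f :=
  walk8 (phi (bspoke f)) (phi (dspoke f)) w.1.1 (w.1.2 (bspoke f)) (w.1.2 (dspoke f)).

Definition choices := [set w : choice | star_choice P t0 spokes pfaces bspoke dspoke phi w].

Lemma lift_rim w f (j : 'I_8) : f \in pfaces ->
  lift w (rim vc p f j) = lbl (face_walk w f (evn j)) (face_walk w f (odn j)).
Proof.
move=> pf; have [lf bf df ff] := pfacesP W pA pf.
have eb : ec (bspoke f) == nxt c by rewrite (wf_cls W).
have ed' : (ec (dspoke f) == nxt c) = false by rewrite (wf_cls W) // nxt_neq.
case: j => -[|[|[|[|[|[|[|[|j]]]]]]]] //= j8;
  rewrite ffunE /= ?bf ?df ?eb ?ed' ?ff /face_walk /walk8 ?ffunE //=.
apply/esym/lblP.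
exact: viewS LK (hom_view c hphi lf).
Qed.

Lemma same_lbl x y x' y' : same P x y x' y' -> P (lbl x y) x y /\ P (lbl x y) x' y'.
Proof. by case/existsP => z /andP[h1 h2]; rewrite (lblP h1). Qed.

Lemma choice_edge w f j : w \in choices -> f \in pfaces ->
  P (lift w (rim vc p f (j : 'I_8))) (face_walk w f (evn j)) (face_walk w f (odn j)) /\
  P (lift w (rim vc p f j)) (w.2 f (evn j)) (w.2 f (odn j)).
Proof.
rewrite inE => /and3P[_ _ /forall_inP h] pf; rewrite lift_rim //.
by apply: same_lbl; have /forallP := h f pf; exact.
Qed.

Lemma lift_hom w : w \in choices -> hom t0 K (lift w).
Proof.
move=> wc; have := wc; rewrite inE => /and3P[w1 w2 _].
apply: homP.
  apply/pffun_onP; split=> //; apply/subsetP => x; rewrite inE; apply: contraR.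
  case: x => [[e|[]]|[[e i]|[f j]]]; rewrite inE ffunE /=.
  - by move=> /negPf ->.
  - by [].
  - by move=> ->.
  - have /pffun_onP [/subsetP sw _] := w2 => nf.
    have : f \notin ([ffun=> t0] : {ffun 'I_8 -> T}).-support w.2.
      by apply: contra nf => /sw.
    by rewrite inE negbK => /eqP ->; rewrite ffunE.
case=> [f|[f j]]; rewrite [_ \in lF _]inE.
  move=> /setDP[lf npf]; exists c => /=.
  rewrite !ffunE /= !(non_pface_edge W pA) //.
  exact: viewS LK (hom_view c hphi lf).
move=> pf0; have {pf0} pf : f \in pfaces := pf0.
exists c; rewrite [ed c _]elim_edc [ed (nxt c) _]elim_edb [ed (nxt (nxt c)) _]elim_edd.
have [_] := choice_edge j wc pf.
by rewrite [lift w (node_edge _ (evn j))]ffunE [lift w (node_edge _ (odn j))]ffunE.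
Qed.

(** The labels on the rim and the fixed nodes x, y recover the walk: from y along the rim edges 1,
    2, 3 one finds q and the first end of the base, from x along 7, 6, 5 one finds p and its second
    end. The partners are visible on the node edges. *)
Lemma lift_inj : {in choices &, injective lift}.
Proof.
move=> w w' wc w'c /ffunP e.
have [l0 l1 _] := view_latin c lK.
have rimE f (j : 'I_8) : f \in pfaces ->
   P (lift w (rim vc p f j)) (face_walk w f (evn j)) (face_walk w f (odn j)) /\
   P (lift w (rim vc p f j)) (face_walk w' f (evn j)) (face_walk w' f (odn j)).
  move=> pf; have [h _] := choice_edge j wc pf; have [h' _] := choice_edge j w'c pf.
  by rewrite -e in h'.
have key f : f \in pfaces -> [/\ w.1.1 = w'.1.1, w.1.2 (bspoke f) = w'.1.2 (bspoke f)
    & w.1.2 (dspoke f) = w'.1.2 (dspoke f)].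
  move=> pf; have R k (k8 : k < 8) := rimE f (Ordinal k8) pf.
  have := R 1 isT; rewrite /face_walk /walk8 !ffunE /= => -[a b].
  have q1 := l1 _ _ _ _ a b.
  have := R 2 isT; rewrite /face_walk /walk8 !ffunE /= -q1 => -[{}a {}b].
  have q2 := l0 _ _ _ _ a b.
  have := R 3 isT; rewrite /face_walk /walk8 !ffunE /= -q2 => -[{}a {}b].
  have b1 := l1 _ _ _ _ a b.
  have := R 7 isT; rewrite /face_walk /walk8 !ffunE /= => -[{}a {}b].
  have p2 := l0 _ _ _ _ a b.
  have := R 6 isT; rewrite /face_walk /walk8 !ffunE /= -p2 => -[{}a {}b].
  have p1 := l1 _ _ _ _ a b.
  have := R 5 isT; rewrite /face_walk /walk8 !ffunE /= -p1 => -[{}a {}b].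
  have b2 := l0 _ _ _ _ a b.
  split.
  - by rewrite (surjective_pairing w.1.1) b1 b2 -surjective_pairing.
  - by rewrite [LHS]surjective_pairing p1 p2 -surjective_pairing.
  - by rewrite [LHS]surjective_pairing q1 q2 -surjective_pairing.
have off (I : finType) (Z : eqType) (z : Z) (Q : {set I}) (g : {ffun I -> Z}) i :
    g \in pffun_on z (mem Q) predT -> i \notin Q -> g i = z.
  move=> /pffun_onP [/subsetP sg _] ni; apply/eqP; apply: contraR ni => gi.
  by apply: sg.
have := wc; rewrite inE => /and3P[w1 w2 _].
have := w'c; rewrite inE => /and3P[w1' w2' _].
have [f pf] := pfaces_nonempty; have [b0 _ _] := key f pf.
have nd : w.1.2 = w'.1.2.
  apply/ffunP => s; have [ss|ns] := boolP (s \in spokes).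
    by have [g pg [->|->]] := spoke_face ss; have [_ ? ?] := key g pg.
  by rewrite (off _ _ _ _ _ _ w1 ns) (off _ _ _ _ _ _ w1' ns).
have pa : w.2 = w'.2.
  apply/ffunP => g; have [pg|ng] := boolP (g \in pfaces).
    apply/ffunP => j; have := e (node_edge g j); by rewrite !ffunE.
  by rewrite (off _ _ _ _ _ _ w2 ng) (off _ _ _ _ _ _ w2' ng).
move: b0 nd pa; case: (w) => [[? ?] ?]; case: (w') => [[? ?] ?] /=.
by move=> -> -> ->.
Qed.

Definition lifts := [set psi : {ffun sE elim -> T} | hom t0 K psi &
  [forall e in lE S :\: spokes, psi (old_edge e) == phi e]].

Lemma card_lifts : #|choices| <= #|lifts|.
Proof.
rewrite -(card_in_imset lift_inj); apply: subset_leq_card.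
apply/subsetP => _ /imsetP [w wc ->]; rewrite inE lift_hom //=.
by apply/forall_inP => e le; rewrite ffunE /= le.
Qed.

Lemma card_lifts_rich (R : realFieldType) (gam : R) m :
  star_rich P (link_rel L c) gam m -> #|pfaces| <= m ->
  (gam * #|T|%:R ^+ (2 + #|spokes|.*2 + #|pfaces|) <= #|lifts|%:R :> R)%R.
Proof.
move=> rich pm; apply: (@le_trans _ _ (#|choices|%:R)%R); last by rewrite ler_nat card_lifts.
apply: (rich t0 _ _ _ _ _ _ (fun e => ec e != nxt c)) => //; last first.
  by apply: leq_trans card_spokes _; rewrite leq_double.
move=> f pf; have [lf bf df ff] := pfacesP W pA pf; split=> //.
- by rewrite negbK (wf_cls W).
- by rewrite (wf_cls W) // nxt_neq.
- by apply/existsP; exists (phi (far_edge f)); exact: (hom_view c hphi lf).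
Qed.
End Lift.

(** * Octahedra *)

Section Octahedra.
Variable T : finType.
Notation square := {ffun bool * bool -> T}.

(* The twelve edges of an octahedron: [a], [b], [d] list its edges of the three *)
(* classes, indexed by the two coordinates they depend on.                      *)
Definition octs (A : {set T * T * T}) : {set square * square * square} :=
  [set t : square * square * square |
    [forall i, forall j, forall k, (t.1.1 (j, k), t.1.2 (i, k), t.2 (i, j)) \in A]].

Definition rot (A : {set T * T * T}) : {set T * T * T} :=
  [set t | (t.2, t.1.1, t.1.2) \in A].

Lemma rot3 A : rot (rot (rot A)) = A.
Proof. by apply/setP => -[[x y] z]; rewrite !inE. Qed.

Lemma octsP (A : {set T * T * T}) (t : square * square * square) : reflect (forall i j k, (t.1.1 (j, k), t.1.2 (i, k), t.2 (i, j)) \in A)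
  (t \in octs A).
Proof.
rewrite inE; apply: (iffP idP) => [h i j k|h].
  by move/forallP: h => /(_ i)/forallP/(_ j)/forallP/(_ k).
by do 3 apply/forallP => ?; exact: h.
Qed.

Lemma card_octs_rot_le A : #|octs A| <= #|octs (rot A)|.
Proof.
pose sw (s : square) : square := [ffun p => s (p.2, p.1)].
pose g (t : square * square * square) := (sw t.1.2, sw t.2, t.1.1).
have ginj : injective g.
  have swK : injective sw.
    by move=> s s' /ffunP e; apply/ffunP => -[i j]; have := e (j, i); rewrite !ffunE.
  by move=> [[a b] d] [[a' b'] d'] /= [/swK -> /swK -> ->].
rewrite -(card_imset _ ginj); apply: subset_leq_card.
apply/subsetP => _ /imsetP [t /octsP h ->]; apply/octsP => i j k.
by rewrite inE /= !ffunE /=; exact: h.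
Qed.

Lemma card_octs_rot A : #|octs (rot A)| = #|octs A|.
Proof.
apply/eqP; rewrite eqn_leq card_octs_rot_le andbT.
by rewrite -[X in _ <= #|octs X|]rot3; apply: leq_trans (card_octs_rot_le _) (card_octs_rot_le _).
Qed.

Lemma view0 A c : exists2 A', #|octs A'| = #|octs A| & forall z x y, view A c z x y = ((z, x, y) \in A').
Proof.
case: c.
- by exists A.
- by exists (rot A); [exact: card_octs_rot | move=> z x y; rewrite inE].
- exists (rot (rot A)); first exact: etrans (card_octs_rot _) (card_octs_rot _).
  by move=> z x y; rewrite !inE.
Qed.

(* Octahedra with the apex pair of one class singled out, in terms of [same]. *)
Definition twins (P : T -> T -> T -> bool) : {set square * square} :=
  [set t : square * square | [forall u, forall w,
     same P (t.1 (u, false)) (t.2 (w, false)) (t.1 (u, true)) (t.2 (w, true))]].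

Lemma twinsP (P : T -> T -> T -> bool) (t : square * square) : reflect
  (forall u w, same P (t.1 (u, false)) (t.2 (w, false)) (t.1 (u, true)) (t.2 (w, true)))
  (t \in twins P).
Proof.
rewrite inE; apply: (iffP idP) => [h u w|h].
  by move/forallP: h => /(_ u)/forallP/(_ w).
by do 2 apply/forallP => ?; exact: h.
Qed.

Lemma card_twins (A : {set T * T * T}) c : latin A -> #|twins (view A c)| = #|octs A|.
Proof.
move=> lA; have pl := view_latin c lA; have [A' <- vE] := view0 A c.
pose P z x y := (z, x, y) \in A'.
have [l0 l1 l2] : platin P.
  rewrite /P; by move: pl => [h0 h1 h2]; split=> *; [apply: h0|apply: h1|apply: h2]; rewrite vE; eassumption.
have -> : twins (view A c) = twins P.
  apply/setP => t; apply/twinsP/twinsP => h u w; have /existsP [z] := h u w;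
  rewrite /P ?vE => /andP[h1 h2]; apply/existsP; exists z; rewrite ?vE; exact/andP.
apply/eqP; rewrite eqn_leq; apply/andP; split.
- pose l (x y : T) := odflt x [pick z | P z x y].
  have lP z x y : P z x y -> l x y = z.
    by rewrite /l; case: pickP => [z' h1 h2|-> //]; exact: l2 h1 h2.
  pose g (t : square * square) : square * square * square :=
    ([ffun p => l (t.1 (p.2, false)) (t.2 (p.1, false))],
     [ffun p => t.1 (p.2, p.1)], [ffun p => t.2 (p.2, p.1)]).
  have ginj : injective g.
    move=> [x y] [x' y'] [_ /ffunP ex /ffunP ey]; congr pair; apply/ffunP => -[i j].
      by have := ex (j, i); rewrite !ffunE.
    by have := ey (j, i); rewrite !ffunE.
  rewrite -(card_imset _ ginj); apply: subset_leq_card.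
  apply/subsetP => _ /imsetP [t /twinsP h ->]; apply/octsP => i j k.
  rewrite !ffunE /=; have /existsP [z /andP[h1 h2]] := h k j.
  by rewrite (lP _ _ _ h1); case: i.
- pose g (t : square * square * square) : square * square :=
    ([ffun p => t.1.2 (p.2, p.1)], [ffun p => t.2 (p.2, p.1)]).
  have ginj : {in octs A' &, injective g}.
    move=> [[a b] d] [[a' b'] d'] /octsP /= h /octsP /= h' [/ffunP eb /ffunP ed].
    have bE : b = b' by apply/ffunP => -[i j]; have := eb (j, i); rewrite !ffunE.
    have dE : d = d' by apply/ffunP => -[i j]; have := ed (j, i); rewrite !ffunE.
    congr (_, _, _) => //; apply/ffunP => -[j k].
    by apply: l2 (h true j k) _; rewrite /P bE dE; exact: h'.
  rewrite -(card_in_imset ginj); apply: subset_leq_card.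
  apply/subsetP => _ /imsetP [t /octsP h ->]; apply/twinsP => u w.
  by apply/existsP; exists (t.1.1 (w, u)); rewrite !ffunE /= /P !h.
Qed.

End Octahedra.

(** * Changes of apex and the closed walks they preserve *)

Section Shift.
Variables (T : finType) (P : T -> T -> T -> bool).
Hypothesis pl : platin P.

Lemma same_uniq_r x y x' y' y'' : same P x y x' y' -> same P x y x' y'' -> y' = y''.
Proof.
have [l0 l1 l2] := pl => /existsP [z /andP[h1 h2]] /existsP [z' /andP[h3 h4]].
by rewrite (l2 _ _ _ _ h3 h1) in h4; exact: l0 h2 h4.
Qed.

Lemma same_uniq_l x y x' x'' y' : same P x y x' y' -> same P x y x'' y' -> x' = x''.
Proof.
have [l0 l1 l2] := pl => /existsP [z /andP[h1 h2]] /existsP [z' /andP[h3 h4]].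
by rewrite (l2 _ _ _ _ h3 h1) in h4; exact: l1 h2 h4.
Qed.

(* [h] = (x, y, x') stands for the change of apex that moves x to x'; an edge  *)
(* (u, w) of the link survives if it spans an octahedron with h.               *)
Definition shift_ok (h : T * T * T) u w := [exists u', exists w', exists y',
  [&& same P u w u' w', same P u h.1.2 u' y', same P h.1.1 w h.2 w'
    & same P h.1.1 h.1.2 h.2 y']].

(** An octahedron is sent to three of its edges at one corner, forming h, and the opposite edge of
    the link; equality of labels recovers the remaining values. *)
Lemma card_twins_le :
  #|twins P| <= #|[set t : (T * T * T) * (T * T) | shift_ok t.1 t.2.1 t.2.2]|.
Proof.
pose g (t : {ffun bool * bool -> T} * {ffun bool * bool -> T}) :=
  ((t.1 (true, false), t.2 (true, false), t.1 (true, true)),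
   (t.1 (false, false), t.2 (false, false))).
have ginj : {in twins P &, injective g}.
  move=> [x y] [x' y'] /twinsP /= h /twinsP /= h' [e1 e2 e3 e4 e5].
  have f1 : y (true, true) = y' (true, true).
    by apply: same_uniq_r (h true true) _; rewrite e1 e2 e3; exact: h'.
  have f2 : x (false, true) = x' (false, true).
    by apply: same_uniq_l (h false true) _; rewrite e4 e2 f1; exact: h'.
  have f3 : y (false, true) = y' (false, true).
    by apply: same_uniq_r (h true false) _; rewrite e1 e5 e3; exact: h'.
  by congr pair; apply/ffunP => -[[] []].
rewrite -(card_in_imset ginj); apply: subset_leq_card.
apply/subsetP => _ /imsetP [t /twinsP h ->]; rewrite inE /=.
apply/existsP; exists (t.1 (false, true)); apply/existsP; exists (t.2 (false, true)).
by apply/existsP; exists (t.2 (true, true)); rewrite !h.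
Qed.

Definition shift_walk k (h : T * T * T) (w : {ffun 'I_k -> T}) :=
  [forall j, shift_ok h (w (evn j)) (w (odn j))].

(* [h] moves [w] to a partner, which together with [h.1] determines [h]. *)
Lemma card_shift_walk k (w : {ffun 'I_k -> T}) (j0 : 'I_k) :
  (forall j : 'I_k, ~~ odd (evn j) /\ odd (odn j)) ->
  #|[set h | shift_walk h w]| <= #|partners P w| * #|T| ^ 2.
Proof.
move=> par.
pose ys (h : T * T * T) := odflt h.2 [pick y' | same P h.1.1 h.1.2 h.2 y'].
pose px h u := odflt u [pick u' | same P u h.1.2 u' (ys h)].
pose py (h : T * T * T) v := odflt v [pick v' | same P h.1.1 v h.2 v'].
pose img h : {ffun 'I_k -> T} := [ffun j : 'I_k => if odd j then py h (w j) else px h (w j)].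
have okP h u v : shift_ok h u v -> [/\ same P u v (px h u) (py h v),
    same P u h.1.2 (px h u) (ys h) & same P h.1.1 h.1.2 h.2 (ys h)].
  case/existsP=> u' /existsP [v' /existsP [y' /and4P[s1 s2 s3 s4]]].
  have yE : ys h = y'.
    rewrite /ys; case: pickP => [y'' s|/(_ y')]; last by rewrite s4.
    exact: same_uniq_r s s4.
  have uE : px h u = u'.
    rewrite /px; case: pickP => [u'' s|/(_ u')]; last by rewrite yE s2.
    by apply: same_uniq_l s _; rewrite yE.
  have vE : py h v = v'.
    rewrite /py; case: pickP => [v'' s|/(_ v')]; last by rewrite s3.
    exact: same_uniq_r s s3.
  by rewrite yE uE vE.
pose g (h : T * T * T) := (img h, h.1).
have ginj : {in [set h | shift_walk h w] &, injective g}.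
  move=> [[x y] x'] [[x1 y1] x1']; rewrite !inE => /forallP/(_ j0)/okP /= [_ s2 s4].
  move=> /forallP/(_ j0)/okP /= [_ s2' s4'] [/ffunP/(_ (evn j0)) + ex ey]; subst x1 y1.
  rewrite !ffunE; have [/negPf -> _] := par j0 => e.
  rewrite -e in s2'; rewrite -(same_uniq_r s2 s2') in s4'.
  by rewrite (same_uniq_l s4 s4').
rewrite -(card_in_imset ginj).
have -> : #|partners P w| * #|T| ^ 2 = #|setX (partners P w) [set: T * T]|.
  by rewrite cardsX cardsT card_prod mulnn.
apply: subset_leq_card; apply/subsetP => _ /imsetP [h + ->]; rewrite inE => /forallP hw.
rewrite in_setX inE [_ \in setT]inE andbT; apply/forallP => j.
have [s _ _] := okP _ _ _ (hw j); rewrite !ffunE.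
by have [/negPf -> ->] := par j.
Qed.
End Shift.

(** * Surfaces with two boundary edges *)

Definition cls_code (c : cls) : option bool :=
  match c with C0 => None | C1 => Some false | C2 => Some true end.
Definition cls_decode (o : option bool) : cls :=
  match o with None => C0 | Some false => C1 | Some true => C2 end.
Lemma cls_codeK : cancel cls_code cls_decode. Proof. by case. Qed.
HB.instance Definition _ := CanHasChoice cls_codeK.
HB.instance Definition _ := CanIsCountable cls_codeK.
Lemma cls_enumP : Finite.axiom [:: C0; C1; C2]. Proof. by case. Qed.
HB.instance Definition _ := isFinite.Build cls cls_enumP.

Lemma big_cls (g : cls -> nat) : \sum_c g c = g C0 + g C1 + g C2.
Proof.
rewrite (bigD1 C0) //= (bigD1 C1) //= (bigD1 C2) //= big1 ?addn0 ?addnA //.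
by case.
Qed.

Lemma bfs (T : finType) (r : rel T) (a : T) :
  exists d : T -> nat, forall x, connect r a x -> x <> a ->
    exists y, [/\ connect r a y, r y x & d y < d x].
Proof.
pose P x k := [exists s : k.-tuple T, path r a s && (last a s == x)].
have PE x : connect r a x -> exists k, P x k.
  case/connectP => s ps ->; exists (size s); apply/existsP; exists (in_tuple s).
  by rewrite ps eqxx.
pose d x := if boolP (connect r a x) is AltTrue h then ex_minn (PE x h) else 0.
exists d => x ax xa.
have dmin y k : connect r a y -> P y k -> d y <= k.
  move=> ay Py; rewrite /d; case: {-}_ / boolP => [h|]; last by rewrite ay.
  by case: ex_minnP => m _; apply.
have : P x (d x).
  rewrite /d; case: {-}_ / boolP => [h|]; last by rewrite ax.
  by case: ex_minnP.
case/existsP => -[s /= /eqP ss] /andP[]; case/lastP: s ss => [|s y].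
  by move=> _ _ /= /eqP ax'; rewrite -ax' in xa.
rewrite size_rcons rcons_path last_rcons => sd /andP[ps ry] /eqP yx; subst y.
exists (last a s); split=> //; first by apply/connectP; exists s.
rewrite -sd ltnS; apply: dmin; first by apply/connectP; exists s.
by apply/existsP; exists (in_tuple s); rewrite ps /=.
Qed.

Lemma subset_of_card (T : finType) (B : {set T}) k : k <= #|B| ->
  exists2 A : {set T}, A \subset B & #|A| = k.
Proof.
move=> kB; exists [set x in take k (enum B)].
  by apply/subsetP => x; rewrite inE => /mem_take; rewrite mem_enum.
rewrite cardsE; have /card_uniqP -> : uniq (take k (enum B)) by rewrite take_uniq ?enum_uniq.
by rewrite size_takel // -cardE.
Qed.

(* Rank-nullity over F_2, by pigeonhole on the values. *)
Lemma card_kernel_ge (E F : finType) (lE : {set E}) (lF : {set F})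
    (delta : {ffun E -> bool} -> F -> bool) :
  (forall (w w' : {ffun E -> bool}) f, delta [ffun e => w e (+) w' e] f = delta w f (+) delta w' f) ->
  2 ^ #|lE| <= 2 ^ #|lF| *
    #|[set w : {ffun E -> bool} | (w \in pffun_on false (mem lE) predT) &&
                                   [forall f in lF, ~~ delta w f]]|.
Proof.
move=> dD.
set Z := [set w | _].
pose X := [set w : {ffun E -> bool} | w \in pffun_on false (mem lE) predT].
have cX : #|X| = 2 ^ #|lE|.
  by rewrite cardsE card_pffun_on card_bool; congr (_ ^ _); apply: eq_card.
pose v (w : {ffun E -> bool}) : {ffun F -> bool} := [ffun f => (f \in lF) && delta w f].
pose Y := [set y : {ffun F -> bool} | y \in pffun_on false (mem lF) predT].
have cY : #|Y| = 2 ^ #|lF|.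
  by rewrite cardsE card_pffun_on card_bool; congr (_ ^ _); apply: eq_card.
have vY w : v w \in Y.
  rewrite inE; apply/pffun_onP; split=> //; apply/subsetP => f; rewrite inE ffunE.
  by case: (f \in lF).
rewrite -cX -cY -sum1_card (partition_big v (mem Y)) /=; last by move=> w _; exact: vY.
rewrite -sum_nat_const; apply: leq_sum => y _.
have [w0 /andP[w0X /eqP w0y]|none] := pickP [pred w | (w \in X) && (v w == y)]; last first.
  by rewrite big_pred0.
pose t (w : {ffun E -> bool}) : {ffun E -> bool} := [ffun e => w e (+) w0 e].
have tinj : injective t.
  move=> w w' /ffunP e; apply/ffunP => x; have := e x; rewrite !ffunE.
  by move/(congr1 (addb^~ (w0 x))); rewrite -!addbA addbb !addbF.
rewrite sum1dep_card -(card_imset _ tinj); apply: subset_leq_card.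
apply/subsetP => _ /imsetP [w + ->]; rewrite inE => /andP[wX /eqP wy]; rewrite inE.
apply/andP; split.
  apply/pffun_onP; split=> //; apply/subsetP => e; rewrite inE ffunE.
  move: wX w0X; rewrite !inE => /pffun_onP [/subsetP h _] /pffun_onP [/subsetP h0 _].
  by apply: contraR => ne; have := contra (h e) ne; have := contra (h0 e) ne;
    rewrite !inE !negbK => /eqP -> /eqP ->.
apply/forall_inP => f lf; rewrite dD.
have := congr1 (fun u : {ffun F -> bool} => u f) (etrans wy (esym w0y)).
by rewrite !ffunE lf /= => ->; rewrite addbb.
Qed.

Section Surface.
Variable D : tricomplex.
Notation face := (tcX D * tcY D * tcZ D)%type.

Definition fedge (c : cls) (f : face) : edge D :=
  match c with C0 => inl (inl f.1.1) | C1 => inl (inr f.1.2) | C2 => inr f.2 end.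

Definition edge_cls (e : edge D) : cls :=
  match e with inl (inl _) => C0 | inl (inr _) => C1 | inr _ => C2 end.

(* The end of [e] of class [c], where W, U, V have the class of the edges that *)
(* avoid them; junk if [c] is the class of [e].                                *)
Definition edge_end (e : edge D) (c : cls) : vertex D :=
  match e, c with
  | inl (inl x), C1 => inl (inl (srcX x)) | inl (inl x), _ => inl (inr (tgtX x))
  | inl (inr y), C0 => inr (tgtY y) | inl (inr y), _ => inl (inr (srcY y))
  | inr z, C0 => inr (tgtZ z) | inr z, _ => inl (inl (srcZ z))
  end.

Lemma edge_cls_fedge c f : edge_cls (fedge c f) = c. Proof. by case: c. Qed.

Lemma incidentE e f : incident e f = (fedge (edge_cls e) f == e).
Proof. by case: e => [[x|y]|z]. Qed.

Lemma incident_fedge e c f : fedge c f = e -> incident e f.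
Proof. by move=> <-; rewrite incidentE edge_cls_fedge. Qed.

Lemma sum_incident f (g : edge D -> nat) :
  \sum_(e | incident e f) g e = \sum_c g (fedge c f).
Proof.
rewrite big_cls big_mkcond big_sumType big_sumType /=.
by congr (_ + _ + _); rewrite -big_mkcond /=; apply: big_pred1 => x; exact: eq_sym.
Qed.

Lemma edge_end_face f e e' c : f \in faces D -> incident e f -> incident e' f ->
  edge_cls e != c -> edge_cls e' != c -> edge_end e c = edge_end e' c.
Proof.
case: f => [[x y] z] /facesP [e1 e2 e3].
by case: e => [[?|?]|?] /eqP /= <-; case: e' => [[?|?]|?] /eqP /= <-; case: c => //= _ _;
  rewrite ?e1 ?e2 ?e3.
Qed.

Hypothesis deg2 : forall e : edge D, face_degree e <= 2.
Hypothesis bd2 : #|boundary D| = 2.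
Hypothesis coc : forall w : edge D -> bool,
  (forall x y z, (x, y, z) \in faces D ->
     w (inl (inl x)) (+) w (inl (inr y)) (+) w (inr z) = false) ->
  exists g : vertex D -> bool, forall e c c', edge_cls e != c -> edge_cls e != c' ->
    c != c' -> w e = g (edge_end e c) (+) g (edge_end e c').
Variables e0 e1 : edge D.
Hypotheses (be0 : e0 \in boundary D) (be1 : e1 \in boundary D) (e01 : e0 != e1).

Lemma boundaryE e : (e \in boundary D) = (e == e0) || (e == e1).
Proof.
have /eqP <- : [set e0; e1] == boundary D; last by rewrite in_set2.
rewrite eqEcard bd2 cards2 e01 leqnn andbT.
by apply/subsetP => x; rewrite in_set2 => /orP[] /eqP ->.
Qed.

Definition adj : rel face := fun f g =>
  [&& f \in faces D, g \in faces D & [exists e, incident e f && incident e g]].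

Variable f1 : face.
Hypotheses (f1D : f1 \in faces D) (e1f1 : incident e1 f1).

(** The argument runs on the faces reachable from [f1] through common edges. That [e0] belongs to
    this component follows from parity in [e0_cE_at]. *)
Definition cF := [set f | connect adj f1 f].
Definition cE := [set e | [exists f in cF, incident e f]].

Lemma cF_faces f : f \in cF -> f \in faces D.
Proof.
rewrite inE => /connectP [s ps ->]; case/lastP: s ps => [|s g] //.
by rewrite rcons_path last_rcons => /andP[_ /and3P[]].
Qed.

Lemma f1_cF : f1 \in cF. Proof. by rewrite inE connect0. Qed.

Lemma cF_closed f g e : f \in cF -> g \in faces D -> incident e f -> incident e g -> g \in cF.
Proof.
move=> cf gD ef eg; have fD := cF_faces cf; move: cf; rewrite !inE => /connect_trans; apply.
by apply: connect1; rewrite /adj fD gD; apply/existsP; exists e; rewrite ef.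
Qed.

Lemma fedge_cE c f : f \in cF -> fedge c f \in cE.
Proof.
by move=> cf; rewrite inE; apply/existsP; exists f; rewrite cf; exact: incident_fedge.
Qed.

Lemma cE_face e : e \in cE -> exists2 f, f \in cF & incident e f.
Proof. by rewrite inE => /exists_inP [f]; exists f. Qed.

Definition cdeg e := #|[set f in cF | incident e f]|.

Lemma cdegE e : e \in cE -> cdeg e = face_degree e.
Proof.
case/cE_face => f cf ef; apply: eq_card => g; rewrite !inE.
have [eg|] := boolP (incident e g); rewrite ?andbF // !andbT.
apply/idP/idP => [|gD]; first by move=> cg; apply: cF_faces; rewrite inE.
by have := cF_closed cf gD ef eg; rewrite inE.
Qed.

Lemma cdeg0 e : e \notin cE -> cdeg e = 0.
Proof.
move=> ne; apply/eqP; rewrite cards_eq0; apply: contraNT ne => /set0Pn [f].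
rewrite inE => /andP[cf ef]; rewrite inE; apply/existsP; exists f; by rewrite cf.
Qed.

Lemma cdeg_interior e : e \in cE -> e != e0 -> e != e1 -> cdeg e = 2.
Proof.
move=> le n0 n1; have d := deg2 e; rewrite -cdegE // in d.
have : cdeg e != 1.
  by rewrite cdegE //; have := boundaryE e; rewrite inE (negPf n0) (negPf n1) => ->.
have : 0 < cdeg e.
  by have [f cf ef] := cE_face le; rewrite card_gt0; apply/set0Pn; exists f; rewrite inE cf.
by lia.
Qed.

Lemma cdeg_boundary e : e \in cE -> e \in boundary D -> cdeg e = 1.
Proof. by move=> le; rewrite inE cdegE // => /eqP. Qed.

Lemma e1_cE : e1 \in cE.
Proof. by rewrite inE; apply/existsP; exists f1; rewrite f1_cF. Qed.

Lemma interior_unique e f g h : e \in cE -> e != e0 -> e != e1 -> f != g ->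
  f \in cF -> g \in cF -> h \in cF -> incident e f -> incident e g -> incident e h ->
  h = f \/ h = g.
Proof.
move=> le n0 n1 fg cf cg ch ef eg eh.
have : [set f; g] == [set f in cF | incident e f].
  rewrite eqEcard cards2 fg -/(cdeg e) cdeg_interior // andbT.
  by apply/subsetP => x; rewrite !inE => /orP[] /eqP ->; rewrite ?ef ?eg andbT -?[connect _ _ _]inE;
   [move: cf|move: cg]; rewrite inE.
by move/eqP/setP/(_ h); rewrite !inE eh andbT; move: ch; rewrite inE => -> /orP[] /eqP ->; [left|right].
Qed.

Lemma boundary_unique e f g : e \in boundary D -> f \in cF -> g \in cF ->
  incident e f -> incident e g -> f = g.
Proof.
move=> be cf cg ef eg; have le : e \in cE by rewrite inE; apply/existsP; exists f; rewrite cf.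
have /eqP/cards1P [h /setP hE] := cdeg_boundary le be.
have := hE f; have := hE g; rewrite !inE -![connect _ _ _](in_set (connect adj f1)).
move: cf cg; rewrite !inE => -> ->; rewrite ef eg => /esym/eqP -> /esym/eqP ->; by [].
Qed.

(* Half-edges at the same end, and in a common face, are at the same vertex of *)
(* the normalised surface.                                                     *)
Definition halfedge : finType := (edge D * cls)%type.
Definition hrel : rel halfedge := fun h h' =>
  [&& h.2 == h'.2, edge_cls h.1 != h.2, edge_cls h'.1 != h.2
    & [exists f in cF, incident h.1 f && incident h'.1 f]].

Lemma hrel_sym : connect_sym hrel.
Proof.
apply: sym_connect_sym => -[e c] [e' c']; rewrite /hrel /= eq_sym.
case: eqP => //= ->; rewrite andbCA; do 2 congr andb.
by apply: eq_existsb => f; rewrite [X in _ && X]andbC.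
Qed.

Definition at_vertex e (q : halfedge) := (edge_cls e != q.2) && (fingraph.root hrel (e, q.2) == q).

Lemma root_cls e c : (fingraph.root hrel (e, c)).2 = c.
Proof.
have := connect_root hrel (e, c); move: (fingraph.root _ _) => h /connectP [s + ->] {h}.
elim/last_ind: s => [//|s h IH]; rewrite rcons_path last_rcons => /andP[/IH sc /and4P[/eqP <- _ _ _]].
exact: sc.
Qed.

Lemma at_root e c : edge_cls e != c -> at_vertex e (fingraph.root hrel (e, c)).
Proof. by rewrite /at_vertex root_cls => ->; rewrite eqxx. Qed.

Lemma at_vertex_cls e q : at_vertex e q -> edge_cls e != q.2.
Proof. by case/andP. Qed.

Lemma at_vertex_face e e' q f : f \in cF -> incident e f -> incident e' f ->
  edge_cls e != q.2 -> edge_cls e' != q.2 -> at_vertex e q = at_vertex e' q.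
Proof.
move=> cf ef e'f n n'; rewrite /at_vertex n n' /=; congr (_ == _).
apply/(fingraph.rootP hrel_sym)/connect1; rewrite /hrel /= eqxx n n' /=.
by apply/existsP; exists f; rewrite cf ef.
Qed.

Lemma at_vertex_fedge q f : f \in cF ->
  at_vertex (fedge q.2 f) q = false /\
  at_vertex (fedge (nxt (nxt q.2)) f) q = at_vertex (fedge (nxt q.2) f) q.
Proof.
move=> cf; split; first by rewrite /at_vertex edge_cls_fedge eqxx.
by apply: (at_vertex_face cf); rewrite ?edge_cls_fedge; try exact: incident_fedge; case: q.2.
Qed.

Lemma even_corner q f : f \in cF -> odd (\sum_c (at_vertex (fedge c f) q)) = false.
Proof.
have par (a : cls -> bool) c : a c = false -> a (nxt (nxt c)) = a (nxt c) ->
    odd (a C0 + a C1 + a C2) = false.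
  by case: c => /= -> ->; rewrite ?addn0 ?add0n addnn odd_double.
move=> /(at_vertex_fedge q) [h1 h2]; rewrite big_cls.
exact: (par (fun c => at_vertex (fedge c f) q) q.2).
Qed.

Lemma double_count (g : edge D -> nat) :
  \sum_e g e * cdeg e = \sum_(f in cF) \sum_c g (fedge c f).
Proof.
under [RHS]eq_bigr do rewrite -sum_incident.
rewrite (exchange_big_dep predT) //=; apply: eq_bigr => e _.
by rewrite /cdeg -sum1dep_card big_distrr /=; apply: eq_bigr => f _; rewrite muln1.
Qed.

(** Each face has 0 or 2 edges at q and each edge other than [e0], [e1] lies in 0 or 2 faces of the
    component, so counting incidences modulo 2 leaves the two boundary edges alone. They are thus
    parallel in the normalised surface. *)
Lemma e0_cE_at q : (e0 \in cE) && at_vertex e0 q = at_vertex e1 q.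
Proof.
have : odd (\sum_e at_vertex e q * cdeg e) = false.
  rewrite double_count (big_morph odd oddD (erefl _)) big1 // => f; exact: even_corner.
rewrite (bigD1 e0) //= (bigD1 e1) 1?eq_sym //=.
rewrite (cdeg_boundary e1_cE be1) muln1 !oddD.
have -> : odd (\sum_(i | (i != e0) && (i != e1)) at_vertex i q * cdeg i) = false.
  rewrite (big_morph odd oddD (erefl _)) big1 // => e /andP[n0 n1].
  have [le|/cdeg0 ->] := boolP (e \in cE); last by rewrite muln0.
  by rewrite (cdeg_interior le n0 n1) oddM andbF.
rewrite addbF oddM oddb.
have [le|/cdeg0 ->] := boolP (e0 \in cE).
  by rewrite (cdeg_boundary le be0) /= andbT oddb; do 2 case: at_vertex.
by rewrite andbF /= oddb.
Qed.

Lemma e0_cE : e0 \in cE.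
Proof.
have [c nc] : exists c, edge_cls e1 != c by exists (nxt (edge_cls e1)); case: edge_cls.
by have := e0_cE_at (fingraph.root hrel (e1, c)); rewrite at_root // => /andP[].
Qed.

Lemma e0_at q : at_vertex e0 q = at_vertex e1 q.
Proof. by rewrite -e0_cE_at e0_cE. Qed.

Lemma boundary_cls : edge_cls e0 = edge_cls e1.
Proof.
have h c : edge_cls e1 != c -> edge_cls e0 != c.
  by move=> nc; have := at_root nc; rewrite -e0_at => /at_vertex_cls; rewrite root_cls.
apply/eqP; apply: contraT => ne; have := h (edge_cls e0).
by rewrite eq_sym ne eqxx => /(_ isT).
Qed.

Lemma face_count : 3 * #|cF| + 2 = 2 * #|cE|.
Proof.
have e1' : e1 \in cE :\ e0 by rewrite in_setD1 eq_sym e01 e1_cE.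
have cE2 : #|cE| = #|cE :\ e0 :\ e1| + 2.
  by rewrite (cardsD1 e0) e0_cE (cardsD1 e1) e1'; lia.
have sumE : \sum_e cdeg e = 1 + (1 + #|cE :\ e0 :\ e1| * 2).
  have -> : \sum_e cdeg e = \sum_(e in cE) cdeg e.
    by rewrite [RHS]big_mkcond; apply: eq_bigr => x _; case: ifP => // /negbT /cdeg0.
  rewrite (big_setD1 e0 e0_cE) (big_setD1 e1 e1') /=.
  rewrite (cdeg_boundary e1_cE be1) (cdeg_boundary e0_cE be0); congr (_ + (_ + _)).
  rewrite -sum_nat_const; apply: eq_bigr => x; rewrite !in_setD1 => /and3P[n1 n0 lx].
  exact: cdeg_interior.
have := double_count (fun=> 1); under eq_bigr do rewrite mul1n.
rewrite sumE; under eq_bigr do rewrite big_cls.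
by rewrite sum_nat_const; lia.
Qed.

(** Take a breadth first tree of the dual graph rooted at [f1]. Each face is matched with an edge
    towards its parent, the root with [e1], and rank decreases with the distance from the root. *)
Lemma collapse : exists (m : face -> edge D) (rk : face -> nat), forall f, f \in cF ->
  [/\ incident (m f) f, m f != e0
    & forall g, g \in cF -> f <> g -> incident (m f) g -> rk f < rk g].
Proof.
have [dF dFP] := bfs adj f1.
pose P f (p : edge D * face) := f \in cF -> if f == f1 then p.1 = e1 else
    [/\ incident p.1 f, incident p.1 p.2, p.2 \in cF & dF p.2 < dF f].
have [m mP] : exists m : face -> edge D * face, forall f, P f (m f).
  apply: fin_all_exists => f; rewrite /P.
  have [->|/eqP nf] := eqVneq f f1; first by exists (e1, f1).
  have [cf|] := boolP (f \in cF); last by exists (e1, f1).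
  move: (cf); rewrite inE => /dFP [//|y [cy /and3P[_ _ /existsP [e /andP[ey ef]]] dy]].
  by exists (e, y); rewrite inE.
have dle f : dF f <= \sum_g dF g by rewrite (bigD1 f) //= leq_addr.
exists (fun f => (m f).1), (fun f => \sum_g dF g - dF f) => f cf; have := mP f cf.
have [-> ->|nf [ef ey cy dy]] := eqVneq f f1.
  split=> //; first by rewrite eq_sym.
  by move=> g cg fg eg; case: fg; exact: boundary_unique be1 f1_cF cg e1f1 eg.
have fy : f != (m f).2 by apply: contraTneq dy => <-; rewrite ltnn.
have nb e : e \in boundary D -> (m f).1 != e.
  move=> be; apply: contraNneq fy => me; apply/eqP.
  by apply: (boundary_unique be cf cy); rewrite -me.
split=> //; first exact: nb.
have le : (m f).1 \in cE by rewrite inE; apply/existsP; exists f; rewrite cf.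
move=> g cg fg eg.
have [gf|->] := interior_unique le (nb _ be0) (nb _ be1) fy cf cy cg ef ey eg.
  by rewrite gf in fg.
move: (dle f) dy; move: (dF f) (dF (m f).2) (\sum_g dF g) => a b k; clear; lia.
Qed.

Definition cV : {set halfedge} := [set q | [exists e in cE, at_vertex e q]].

Definition vadj : rel halfedge := fun q q' =>
  [exists e in cE, at_vertex e q && at_vertex e q'].

Lemma corner f e c q : f \in cF -> incident e f -> at_vertex e q -> c != q.2 ->
  at_vertex (fedge c f) q.
Proof.
move=> cf ef eq nc; rewrite -(at_vertex_face (e := e) cf) ?edge_cls_fedge //.
  exact: incident_fedge.
exact: at_vertex_cls eq.
Qed.

Lemma face_vadj f e e' q q' : f \in cF -> incident e f -> incident e' f ->
  at_vertex e q -> at_vertex e' q' -> vadj q q'.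
Proof.
move=> cf ef e'f eq e'q'.
have [c cq cq'] : exists2 c, c != q.2 & c != q'.2.
  by case: (q.2); case: (q'.2); (by exists C0) || (by exists C1) || (by exists C2).
apply/existsP; exists (fedge c f); rewrite fedge_cE //=.
by rewrite (corner cf ef eq cq) (corner cf e'f e'q' cq').
Qed.

Lemma cV_connect q0 q : at_vertex e1 q0 -> q \in cV -> connect vadj q0 q.
Proof.
move=> e1q0; rewrite inE => /existsP [e /andP[/cE_face [f cf ef] eq]].
move: (cf); rewrite inE => /connectP [s ps lf].
suff H : forall e q, incident e (last f1 s) -> at_vertex e q -> connect vadj q0 q.
  by apply: (H e) => //; rewrite -lf.
elim/last_ind: s ps {f cf lf e ef eq q} => [_|s g IH] /=.
  by move=> e q ef eq; apply: connect1; exact: (face_vadj f1_cF e1f1 ef e1q0 eq).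
rewrite rcons_path last_rcons => /andP[ps /and3P[_ gD /existsP [e' /andP[el eg]]]] e q ef eq.
have cg : g \in cF.
  rewrite inE; apply/connectP; exists (rcons s g); last by rewrite last_rcons.
  rewrite rcons_path ps /=; apply/and3P; split=> //; last by apply/existsP; exists e'; rewrite el.
  by apply: cF_faces; rewrite inE; apply/connectP; exists s.
have [c nc] : exists c, edge_cls e' != c by exists (nxt (edge_cls e')); case: edge_cls.
have h := IH ps e' _ el (at_root nc).
apply: connect_trans h (connect1 _).
exact: (face_vadj cg eg ef (at_root nc) eq).
Qed.

Lemma edge_end_root e c : e \in cE -> edge_cls e != c ->
  edge_end (fingraph.root hrel (e, c)).1 c = edge_end e c.
Proof.
move=> le nc; have := connect_root hrel (e, c); move: (fingraph.root _ _) => h.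
case/connectP => s + ->; elim/last_ind: s => [//|s g IH].
rewrite rcons_path last_rcons => /andP[ps]; rewrite -(IH ps).
have l2 : (last (e, c) s).2 = c.
  elim/last_ind: s ps {IH} => [//|s x IH]; rewrite rcons_path last_rcons.
  by move=> /andP[/IH sc /and4P[/eqP <- _ _ _]].
move=> /and4P[_ n1 n2 /existsP [f /and3P[cf i1 i2]]].
rewrite l2 in n1 n2.
by apply: (edge_end_face (cF_faces cf)).
Qed.

(* A cocycle supported on [cE] is given by a potential on [cV] vanishing at     *)
(* [q0], and there are at least [2 ^ (#|cE| - #|cF|)] of them.                  *)
Lemma euler : #|cE| + 1 <= #|cF| + #|cV|.
Proof.
have [c0 nc0] : exists c, edge_cls e1 != c by exists (nxt (edge_cls e1)); case: edge_cls.
pose q0 := fingraph.root hrel (e1, c0).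
have q0V : q0 \in cV.
  by rewrite inE; apply/existsP; exists e1; rewrite e1_cE at_root.
pose delta (w : {ffun edge D -> bool}) f :=
  w (fedge C0 f) (+) w (fedge C1 f) (+) w (fedge C2 f).
have := card_kernel_ge cE cF (delta := delta).
set Z := [set w | _] => /(_ _) ZP.
have {}ZP : 2 ^ #|cE| <= 2 ^ #|cF| * #|Z|.
  apply: ZP => w w' f; rewrite /delta !ffunE.
  by do 3 (case: (w _); case: (w' _)).
pose dl (g : {ffun halfedge -> bool}) : {ffun edge D -> bool} :=
  [ffun e => (e \in cE) && (g (fingraph.root hrel (e, nxt (edge_cls e))) (+)
     g (fingraph.root hrel (e, nxt (nxt (edge_cls e)))))].
pose G := [set g : {ffun halfedge -> bool} | g \in pffun_on false (mem (cV :\ q0)) predT].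
have cG : #|G| = 2 ^ #|cV :\ q0|.
  by rewrite cardsE card_pffun_on card_bool; congr (_ ^ _); apply: eq_card.
have ZG : #|Z| <= #|G|.
  apply: leq_trans (leq_imset_card dl G); apply: subset_leq_card; apply/subsetP => w.
  rewrite inE => /andP[/pffun_onP [/subsetP wE _] /forall_inP wF].
  have w0 e : e \notin cE -> w e = false.
    by move=> ne; apply/negP => we; have := contra (wE e) ne; rewrite inE we.
  have [|g gP] := coc (w := w).
    move=> x y z fD; have [cf|nf] := boolP ((x, y, z) \in cF).
      by have := wF _ cf; rewrite /delta /= => /negPf.
    have n c : fedge c (x, y, z) \notin cE.
      apply: contra nf => /cE_face [f cf ef]; apply: (cF_closed cf fD ef).
      exact: incident_fedge.
    by have := w0 _ (n C0); have := w0 _ (n C1); have := w0 _ (n C2) => /= -> -> ->.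
  apply/imsetP; pose v (q : halfedge) := g (edge_end q.1 q.2).
  exists [ffun q => (q \in cV) && (v q (+) v q0)].
    rewrite inE; apply/pffun_onP; split=> //; apply/subsetP => q.
    rewrite inE ffunE in_setD1; have [->|_] := eqVneq q q0; first by rewrite addbb andbF.
    by case: (q \in cV).
  apply/ffunP => e; rewrite ffunE; have [le|/w0 //] := boolP (e \in cE).
  have n1 : edge_cls e != nxt (edge_cls e) by case: edge_cls.
  have n2 : edge_cls e != nxt (nxt (edge_cls e)) by case: edge_cls.
  have n3 : nxt (edge_cls e) != nxt (nxt (edge_cls e)) by case: edge_cls.
  have rV c : edge_cls e != c -> fingraph.root hrel (e, c) \in cV.
    by move=> nc; rewrite inE; apply/existsP; exists e; rewrite le at_root.
  rewrite /= !ffunE !rV //= addbACA addbb addbF /v !root_cls !edge_end_root //.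
  exact: gP.
have := cardsD1 q0 cV; rewrite q0V add1n => cV1.
have : 2 ^ #|cE| <= 2 ^ (#|cF| + #|cV :\ q0|).
  by rewrite expnD -cG; apply: leq_trans ZP _; rewrite leq_mul2l ZG orbT.
by rewrite leq_exp2l // => h; lia.
Qed.

(** [A] consists of E - F - 1 vertices of the component other than the two common ends of [e0] and
    [e1]; [euler] provides enough of them and [face_count] turns the number into F/2. [tree] is
    given by a breadth first search on the vertices from one end of [e0], and [d] is the distance. A
    face has at most one corner per class, whence the weight 8^3 = 512. *)
Theorem surface_system : exists (d : halfedge -> nat) (A : {set halfedge})
    (tree : halfedge -> edge D) (m : face -> edge D) (rk : face -> nat),
  let S := @Sys halfedge (edge D) face cE cF fedge edge_cls at_vertex tree m rk e0 e1 in
  [/\ wf (fun q => q.2) d S A, 2 * #|A| = #|cF|, #|cE| = #|cF| + 1 + #|A|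
    & weight (fun q => q.2) S A <= 512 * #|cF|].
Proof.
pose c := edge_cls e0; have ce : edge_cls e1 = c by rewrite -boundary_cls.
pose qa := fingraph.root hrel (e0, nxt c); pose qb := fingraph.root hrel (e0, nxt (nxt c)).
have atab q : at_vertex e0 q -> q = qa \/ q = qb.
  move=> /andP[nq /eqP <-]; move: nq; rewrite /qa /qb /c.
  by case: (edge_cls e0); case: (q.2) => //=; auto.
have a0a : at_vertex e0 qa by apply: at_root; rewrite /c; case: edge_cls.
have [d dP] := bfs vadj qa.
have fc := face_count; have eu := euler.
have [A sA cA] : exists2 A : {set halfedge}, A \subset cV :\: [set qa; qb] & #|A| = #|cE| - #|cF| - 1.
  apply: subset_of_card.
  have := cardsID [set qa; qb] cV; have : #|cV :&: [set qa; qb]| <= 2.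
    by apply: leq_trans (subset_leq_card (subsetIr _ _)) _; rewrite cards2; case: (_ != _).
  by lia.
have AP q : q \in A -> [/\ q \in cV, q != qa & q != qb].
  by move/(subsetP sA); rewrite !inE negb_or => /andP[/andP[-> ->] ->].
have [m [rk mP]] := collapse.
pose P q e := q \in A -> [/\ e \in cE, at_vertex e q
      & forall q', q' \in A -> at_vertex e q' -> q' = q \/ d q' < d q].
have [tree treeP] : exists tree : halfedge -> edge D, forall q, P q (tree q).
  apply: fin_all_exists => q; rewrite /P.
  have [qA|] := boolP (q \in A); last by exists e0.
  have [qV nqa _] := AP q qA.
  have con : connect vadj qa q by apply: cV_connect => //; rewrite -e0_at.
  have [y [_ /existsP [e /and3P[le ey eq]] dy]] := dP q con (elimN eqP nqa).
  exists e => _; split=> // q' _ eq'.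
  have yq : y.2 != q.2.
    apply: contraTneq dy => yq; move: ey eq => /andP[_ /eqP <-] /andP[_ /eqP <-].
    by rewrite yq ltnn.
  have : q'.2 == q.2 \/ q'.2 == y.2.
    move: (at_vertex_cls ey) (at_vertex_cls eq) (at_vertex_cls eq') yq.
    by case: (edge_cls e); case: (y.2); case: (q.2); case: (q'.2) => //; auto.
  case=> /eqP q2; [left|right].
    by move: eq' eq => /andP[_ /eqP <-] /andP[_ /eqP <-]; rewrite q2.
  suff -> : q' = y by [].
  by move: eq' ey => /andP[_ /eqP <-] /andP[_ /eqP <-]; rewrite q2.
have n01 q : q \in A -> ~~ at_vertex e0 q.
  by move=> /AP [_ na nb]; apply/negP => /atab [] qE; [move: na|move: nb]; rewrite qE eqxx.
exists d, A, tree, m, rk; split; last 3 first.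
- by rewrite cA; lia.
- by rewrite cA; lia.
- rewrite /weight mulnC -sum_nat_const; apply: leq_sum => f cf.
  rewrite (_ : 512 = 8 ^ 3) // leq_exp2l //.
  set B := [set q in A | _].
  have /leq_trans : #|B| <= #|[set: cls]|.
    rewrite -(card_in_imset (f := snd)); first exact/subset_leq_card/subsetT.
    move=> q q'; rewrite !inE => /andP[_ /= /andP[_ /eqP h]] /andP[_ /= /andP[_ /eqP h']] e.
    rewrite -h -h'; apply/(fingraph.rootP hrel_sym)/connect1; rewrite /hrel /= e eqxx.
    rewrite !edge_cls_fedge; apply/and4P; split => //; try by case: (q'.2).
    by apply/existsP; exists f; rewrite cf !incidentE !edge_cls_fedge !eqxx.
  by apply; rewrite -sum1_card big_mkcond big_cls !inE.
split=> /=.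
- by move=> f a; exact: fedge_cE.
- by move=> f a _; exact: edge_cls_fedge.
- by move=> f q cf _; have [] := at_vertex_fedge q cf.
- by move=> f q cf _; have [] := at_vertex_fedge q cf.
- move=> f q q' cf _ _ qq'; rewrite /in_face /= qq' => /andP[_ /eqP h] /andP[_ /eqP h'].
  by rewrite -[LHS]h qq'.
- move=> q Q qA Qt QF e le eq; have [lt tq _] := treeP q qA.
  have [nt /eqP rt] := andP tq; have [ne /eqP re] := andP eq.
  have : connect hrel (tree q, q.2) (e, q.2).
    by apply/(fingraph.rootP hrel_sym); rewrite rt re.
  case/connectP => s ps es.
  have key : (last (tree q, q.2) s).2 = q.2 /\ (at_vertex (last (tree q, q.2) s).1 q /\ Q (last (tree q, q.2) s).1).
    elim/last_ind: s ps {es} => [|s g IH]; first by split.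
    rewrite rcons_path last_rcons => /andP[/IH [s2 [sq sQ]] /and4P[/eqP h2 h3 h4]].
    move=> /existsP [f /and3P[cf i1 i2]]; rewrite -h2 s2; split=> //.
    have gq : at_vertex g.1 q.
      by rewrite s2 in h3 h4; rewrite -(at_vertex_face cf i1 i2).
    split=> //; rewrite incidentE in i1; rewrite incidentE in i2.
    rewrite -(eqP i2); apply: (QF f (edge_cls (last (tree q, q.2) s).1)) => //; by rewrite ?(eqP i1) ?(eqP i2).
  by move: key; rewrite -es /= => -[_ []].
- by move=> q /treeP [].
- move=> q /treeP [/cE_face [f cf]]; rewrite incidentE => /eqP ef _ _.
  by exists f, (edge_cls (tree q)); rewrite cf ef.
- by move=> q q' /treeP [_ _ h] q'A; exact: h.
- move=> f /mP [+ _ _]; rewrite incidentE => /eqP mf.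
  by exists (edge_cls (m f)); rewrite mf.
- by move=> f /mP [].
- move=> f g a cf cg fg mg; have [_ _ h] := mP f cf; apply: h => //.
  by rewrite mg; exact: incident_fedge.
- by split; [exact: e0_cE | exact: n01].
- by split; [exact: e1_cE | move=> q /n01; rewrite e0_at].
Qed.
End Surface.

(** * Colourings *)

Lemma greedy_colouring (T : finType) (adj : rel T) M : symmetric adj ->
  (forall x, #|[set y | adj x y]| <= M) ->
  exists col : {ffun T -> 'I_M.+1}, forall x y, adj x y -> col x = col y -> x = y.
Proof.
move=> sym deg.
suff key (s : seq T) : exists col : {ffun T -> 'I_M.+1},
    {in s &, forall x y, adj x y -> col x = col y -> x = y}.
  by have [col h] := key (enum T); exists col => x y; apply: h; rewrite mem_enum.
elim: s => [|x s [col h]]; first by exists [ffun=> ord0].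
have [k kP] : exists k, k \notin [set col y | y in [set y | adj x y]].
  apply/existsP; rewrite -negb_forall; apply/negP => /forallP all.
  have : #|'I_M.+1| <= M.
    apply: leq_trans (deg x); apply: leq_trans (leq_imset_card col _).
    by apply: subset_leq_card; apply/subsetP => k _; exact: all.
  by rewrite card_ord ltnn.
have kN y : adj x y -> col y <> k.
  by move=> xy e; case/imsetP: kP; exists y; rewrite ?inE.
exists [ffun y => if y == x then k else col y] => y z; rewrite !inE !ffunE.
have [->|yx] := eqVneq y x; have [->|zx] := eqVneq z x => //=.
- by move=> _ _ /kN h1 /esym.
- by move=> _ _; rewrite sym => /kN.
- exact: h.
Qed.

(** Colour the labels of each class greedily with M+1 colours and keep the faces with the most
    frequent triple of colours: conflicting distinct labels never have the same colour. *)
Lemma conflict_free (T : finType) (L : {set T * T * T}) (adj : cls -> rel T) M :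
  (forall c, symmetric (adj c)) -> (forall c x, #|[set y | adj c x y]| <= M) ->
  exists F : {set T * T * T}, [/\ F \subset L, #|L| <= M.+1 ^ 3 * #|F| &
    forall c t t', t \in F -> t' \in F -> adj c (coord c t) (coord c t') -> coord c t = coord c t'].
Proof.
move=> sym deg.
have [col colP] := fin_all_exists (fun c => greedy_colouring (sym c) (deg c)).
pose prof (t : T * T * T) : {ffun cls -> 'I_M.+1} := [ffun c => col c (coord c t)].
have [p hp] : exists p, #|L| <= M.+1 ^ 3 * #|[set t in L | prof t == p]|.
  pose f p := #|[set t in L | prof t == p]|.
  have [p _ pmax] := arg_maxnP f (isT : predT [ffun=> ord0 : 'I_M.+1]); exists p.
  have -> : M.+1 ^ 3 = #|{: {ffun cls -> 'I_M.+1}}|.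
    by rewrite card_ffun card_ord; congr (_ ^ _); rewrite -sum1_card big_cls.
  rewrite -sum_nat_const -sum1_card (partition_big prof predT) //=; apply: leq_sum => q _.
  apply: leq_trans (pmax q isT); rewrite sum1dep_card; apply: subset_leq_card.
  by apply/subsetP => t; rewrite !inE.
exists [set t in L | prof t == p]; split=> //.
  by apply/subsetP => t; rewrite inE => /andP[].
move=> c t t'; rewrite !inE => /andP[_ /eqP tp] /andP[_ /eqP tp'] /colP; apply.
by move/ffunP/(_ c): tp; move/ffunP/(_ c): tp'; rewrite !ffunE => -> ->.
Qed.

Local Open Scope ring_scope.

(** * The counting bound *)

Section Tower.
Variables (R : realFieldType) (T : finType) (m : nat) (K : {set T * T * T}).

(** A chain of subsets of [K] ending in [L], with one link for each vertex to be eliminated. A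
    homomorphism into the smallest set is lifted into the next larger one at every elimination, and
    [Gam] is the product of the proportions kept. *)
Inductive tower : nat -> {set T * T * T} -> R -> Prop :=
| Tower0 : tower 0 K 1
| TowerS i (L L' : {set T * T * T}) (gam Gam : R) : tower i L Gam -> L' \subset L -> 0 <= gam -> gam <= 1 ->
    (forall c, star_rich (view L c) (link_rel L' c) gam m) ->
    tower i.+1 L' (gam * Gam).

Lemma tower_sub i L Gam : tower i L Gam -> L \subset K.
Proof. by elim=> // j L1 L2 _ _ _ s1 s2 _ _ _; exact: fintype.subset_trans s2 s1. Qed.

Lemma tower_ge0 i L Gam : tower i L Gam -> 0 <= Gam.
Proof. by elim=> // j L1 L2 g G _ ? _ ? _ _; exact: mulr_ge0. Qed.

Lemma tower_below k L Gam i : tower k L Gam -> (i <= k)%N ->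
  exists L' Gam', [/\ tower i L' Gam', L \subset L' & Gam <= Gam'].
Proof.
move=> tw; elim: tw => [|j L1 L2 g G tw1 IH s12 g0 g1 rich] ik.
  by exists K, 1; rewrite leqn0 in ik; rewrite (eqP ik); split=> //; exact: Tower0.
move: ik; rewrite leq_eqVlt => /orP[/eqP ->|ij].
  by exists L2, (g * G); split=> //; exact: TowerS tw1 s12 g0 g1 rich.
have [L' [G' [tw' sL hG]]] := IH ij; exists L', G'; split=> //.
  exact: fintype.subset_trans s12 sL.
by apply: le_trans hG; apply: ler_piMl => //; exact: tower_ge0 tw1.
Qed.

Hypothesis latinK : latin K.
Variables (t0 : T) (V : finType) (vc : V -> cls) (d : V -> nat).

(* The eliminated vertex [p] maximises [d], so that no other [tree q] is lost;  *)
(* the value at [x1] thus still determines the values at [tree q].              *)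
Theorem tower_bound i L Gam : tower i L Gam -> forall (S : sys V) (A : {set V}) z
    (H : {set {ffun sE S -> T}}),
  wf vc d S A -> #|A| = i -> (weight vc S A <= 8 * m)%N ->
  (forall phi, phi \in H -> hom t0 L phi /\ phi (x0 S) = z) ->
  (forall phi psi, phi \in H -> psi \in H -> phi (x1 S) = psi (x1 S) ->
     forall q, q \in A -> phi (tree S q) = psi (tree S q)) ->
  #|H|%:R * Gam * #|T|%:R ^+ (i + #|lF S| + 1) <= #|T|%:R ^+ #|lE S|.
Proof.
elim=> {i L Gam} [|i L L' gam Gam tw IH LL' gam0 _ rich] S A z H W cA wA HL Ht.
  rewrite mulr1 add0n -!natrX -natrM ler_nat; exact: card_hom_family W latinK HL.
have [p pA dmax] : exists2 p, p \in A & forall q, q \in A -> (d q <= d p)%N.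
  have /card_gt0P [a aA] : (0 < #|A|)%N by rewrite cA.
  by case: (arg_maxnP d aA) => p pA h; exists p.
pose c := vc p.
have lL : latin L := latinS (tower_sub tw) latinK.
have Lsub := tower_sub tw.
set sp := spokes S p; set pf := pfaces vc S p.
have card_pf : (#|pf| <= m)%N.
  have : (8 * #|pf| <= weight vc S A)%N.
    rewrite /weight mulnC -sum_nat_const [X in (_ <= X)%N](big_setID pf) /=.
    apply: leq_trans (leq_addr _ _).
    have -> : lF S :&: pf = pf.
      by apply/setIidPr/fintype.subsetP => f; rewrite inE => /andP[].
    apply: leq_sum => f; rewrite inE => /andP[lf fp].
    rewrite -[X in (X <= _)%N]expn1 leq_exp2l // card_gt0; apply/set0Pn; exists p.
    by rewrite inE pA.
  by lia.
pose E1 := sE (elim vc S p).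
pose H1 := [set x : {ffun sE S -> T} * {ffun E1 -> T} |
  (x.1 \in H) && (x.2 \in lifts vc p t0 L x.1)].
(* A lift determines [phi]: it shows [phi] off the spokes, in particular at [x1], hence fixes [phi]
   at [tree p]; from there the far edges carry equality around the link of [p] to all spokes. *)
have det : {in H1 &, injective (fun x => x.2)}.
  move=> [phi psi] [phi' psi'] /=; rewrite !inE /= => /andP[h /andP[_ /forall_inP l]].
  move=> /andP[h' /andP[_ /forall_inP l']] e; subst psi'; congr pair.
  have agree e : e \in lE S :\: sp -> phi e = phi' e.
    by move=> le; rewrite -(eqP (l e le)) -(eqP (l' e le)).
  have x1n : x1 S \in lE S :\: sp.
    by have [lx nx] := wf_x1 W; rewrite !inE lx (negPf (nx _ pA)).
  have tp := Ht _ _ h h' (agree _ x1n) _ pA.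
  have [hp _] := HL _ h; have [hp' _] := HL _ h'.
  apply/ffunP => e; have [le|ne] := boolP (e \in lE S); last first.
    by rewrite (hom_outside hp ne) (hom_outside hp' ne).
  have [es|ns] := boolP (e \in sp); last by apply: agree; apply/setDP.
  have ep : inc e p by move: es; rewrite inE => /andP[].
  apply: (wf_link W (Q := fun e => phi e = phi' e) pA tp) => // f a b lf fa fb ea.
  have na x : inc (ed x f) p -> x <> c by move=> + xc; rewrite xc (wf_opp W lf pA).
  have pff : f \in pf.
    rewrite inE lf /= /in_face -/c.
    have [ac|ac|ac] := cls_cases vc p a; rewrite -/c in ac; rewrite ac in fa.
    - by case: (na _ fa).
    - exact: fa.
    - by rewrite -(wf_inc W lf pA) -/c fa.
  have [_ _ _ ff] := pfacesP W pA pff.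
  have far : phi (ed c f) = phi' (ed c f) by apply: agree.
  have v1 := viewS LL' (hom_view c hp lf); have v2 := viewS LL' (hom_view c hp' lf).
  have [l0 l1 _] := view_latin c lL.
  rewrite far in v1.
  have [ac|ac|ac] := cls_cases vc p a; rewrite -/c in ac; rewrite ac in fa ea;
    first by case: (na _ fa).
    have [bc|bc|bc] := cls_cases vc p b; rewrite -/c in bc; rewrite bc in fb *;
      first by case: (na _ fb).
      by [].
    by rewrite ea in v1; exact: l0 v1 v2.
  have [bc|bc|bc] := cls_cases vc p b; rewrite -/c in bc; rewrite bc in fb *;
      first by case: (na _ fb).
    by rewrite ea in v1; exact: l1 v1 v2.
  by [].
pose H2 := [set x.2 | x in H1].
have cH2 : #|H2| = (\sum_(phi in H) #|lifts vc p t0 L phi|)%N.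
  rewrite card_in_imset // -sum1_card.
  under [RHS]eq_bigr do rewrite -sum1_card.
  by rewrite pair_big_dep /=; apply: eq_bigl => -[a b]; rewrite inE.
have low : #|H|%:R * (gam * #|T|%:R ^+ (2 + #|sp|.*2 + #|pf|)) <= #|H2|%:R.
  rewrite cH2 natr_sum mulrC mulr_natr -sumr_const; apply: ler_sum => phi pH.
  have [hp _] := HL _ pH.
  exact: (card_lifts_rich W pA lL LL' hp (rich c) card_pf).
have cA1 : #|A :\ p| = i by move: cA; rewrite (cardsD1 p) pA => -[].
have HL2 psi : psi \in H2 -> hom t0 L psi /\ psi (x0 (elim vc S p)) = z.
  case/imsetP => -[phi psi'] + ->; rewrite inE /= => /andP[h].
  rewrite inE => /andP[hs /forall_inP l].
  split=> //; have [_ <-] := HL _ h; apply/eqP; apply: l.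
  by have [lx nx] := wf_x0 W; rewrite !inE lx (negPf (nx _ pA)).
have Ht2 psi psi' : psi \in H2 -> psi' \in H2 ->
    psi (x1 (elim vc S p)) = psi' (x1 (elim vc S p)) -> forall q, q \in A :\ p ->
    psi (tree (elim vc S p) q) = psi' (tree (elim vc S p) q).
  move=> /imsetP [[phi psi1] + ->] /imsetP [[phi' psi1'] + ->]; rewrite !inE /=.
  move=> /andP[h /andP[_ /forall_inP l]] /andP[h' /andP[_ /forall_inP l']] e q /setD1P [qp qA].
  have tn := tree_nonspoke W pA dmax qA qp.
  rewrite (eqP (l _ tn)) (eqP (l' _ tn)); apply: Ht => //.
  have x1n : x1 S \in lE S :\: sp.
    by have [lx nx] := wf_x1 W; rewrite !inE lx (negPf (nx _ pA)).
  by rewrite -(eqP (l _ x1n)) -(eqP (l' _ x1n)).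
have := IH _ _ z H2 (wf_elim W pA dmax) cA1 (leq_trans (weight_elim W pA) wA) HL2 Ht2.
rewrite card_elim_lE card_elim_lF -/sp -/pf => up.
have n0 : 0 < #|T|%:R :> R by rewrite ltr0n; apply/card_gt0P; exists t0.
have sF' : (#|lF S| = #|lF S :\: pf| + #|pf|)%N.
  rewrite -(cardsID pf (lF S)) addnC; congr (_ + _)%N; apply: eq_card => f.
  by rewrite !inE; case: (f \in lF S).
have sE' : (#|lE S| = #|lE S :\: sp| + #|sp|)%N.
  rewrite -(cardsID sp (lE S)) addnC; congr (_ + _)%N; apply: eq_card => f.
  by rewrite !inE; case: (f \in lE S).
have G0 := tower_ge0 tw.
(* The number of edges added by the elimination; both sides are multiplied by this power of |T| in
   order to use the induction hypothesis. *)
pose k := (1 + #|sp|.*2 + #|pf| * 8)%N.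
have nk : 0 < #|T|%:R ^+ k :> R by rewrite exprn_gt0.
rewrite -(ler_pM2r nk) -!exprD.
have -> : (#|lE S| + k = #|lE S :\: sp| + 1 + (#|sp| * 3 + #|pf| * 8))%N by rewrite sE' /k; move: #|_ :\: _| #|sp| #|pf|; clear; lia.
apply: le_trans up.
have -> : #|H|%:R * (gam * Gam) * #|T|%:R ^+ (i.+1 + #|lF S| + 1) * #|T|%:R ^+ k =
  (#|H|%:R * (gam * #|T|%:R ^+ (2 + #|sp|.*2 + #|pf|))) *
  (Gam * #|T|%:R ^+ (i + (#|lF S :\: pf| + #|pf| * 8) + 1)) :> R.
  have -> : #|H|%:R * (gam * #|T|%:R ^+ (2 + #|sp|.*2 + #|pf|)) *
    (Gam * #|T|%:R ^+ (i + (#|lF S :\: pf| + #|pf| * 8) + 1)) =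
    #|H|%:R * (gam * Gam) * (#|T|%:R ^+ (2 + #|sp|.*2 + #|pf|) *
      #|T|%:R ^+ (i + (#|lF S :\: pf| + #|pf| * 8) + 1)) :> R by ring.
  rewrite -mulrA -!exprD; congr (_ * _ ^+ _); rewrite sF' /k; move: #|_ :\: _| #|sp| #|pf|; clear; lia.
rewrite -[X in _ <= X]mulrA ler_wpM2r //.
by rewrite mulr_ge0 // exprn_ge0.
Qed.
End Tower.

(** * Disc patterns and their copies *)

(** The combinatorial content of being a disc with boundary length 2; the last clause says that the
    first cohomology over F_2 vanishes. *)
Definition two_sided (D : tricomplex) : Prop :=
  [/\ forall e : edge D, (face_degree e <= 2)%N, #|boundary D| = 2%N
    & forall w : edge D -> bool,
  (forall x y z, (x, y, z) \in faces D ->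
     w (inl (inl x)) (+) w (inl (inr y)) (+) w (inr z) = false) ->
  exists g : vertex D -> bool, forall e c c', edge_cls e != c -> edge_cls e != c' ->
    c != c' -> w e = g (edge_end e c) (+) g (edge_end e c')].

(* The combinatorial type of a disc with fewer than [b] faces, enumerated with *)
(* repetitions: which faces share which edges, and two faces and a class       *)
(* locating the boundary edges.                                                *)
Definition pattern b : finType := ({ffun cls * ('I_b * 'I_b) -> bool} * (cls * ('I_b * 'I_b)))%type.

Section Codes.
Variable b : nat.
Implicit Type s : pattern b.

Definition disc_pattern s : Prop :=
  exists (D : tricomplex) (e0 e1 : edge D) (en : 'I_b -> tcX D * tcY D * tcZ D),
  [/\ two_sided D, (area D < b)%N, [/\ e0 \in boundary D, e1 \in boundary D & e0 != e1],
   (forall j, en j \in faces D) /\ (forall f, f \in faces D -> exists j, f = en j)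
  & [/\ forall c j j', s.1 (c, (j, j')) = (fedge c (en j) == fedge c (en j')),
      fedge s.2.1 (en s.2.2.1) = e0 & fedge s.2.1 (en s.2.2.2) = e1]].

Variable T : finType.
Implicit Type L : {set T * T * T}.

Definition copy s L z z' := [exists phi : {ffun 'I_b -> T * T * T},
  [&& [forall j, phi j \in L],
    [forall c, forall j, forall j', s.1 (c, (j, j')) ==> (coord c (phi j) == coord c (phi j'))],
    coord s.2.1 (phi s.2.2.1) == z & coord s.2.1 (phi s.2.2.2) == z']].

Lemma copyP s L z z' : reflect (exists phi : {ffun 'I_b -> T * T * T},
   [/\ forall j, phi j \in L,
    forall c j j', s.1 (c, (j, j')) -> coord c (phi j) = coord c (phi j'),
    coord s.2.1 (phi s.2.2.1) = z & coord s.2.1 (phi s.2.2.2) = z']) (copy s L z z').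
Proof.
apply: (iffP existsP) => -[phi].
- case/and4P=> /forallP h1 /forallP h2 /eqP h3 /eqP h4; exists phi; split=> // c j j' h.
  by move: (h2 c) => /forallP/(_ j)/forallP/(_ j')/implyP/(_ h)/eqP.
- case=> h1 h2 h3 h4; exists phi; apply/and4P; split; [exact/forallP| |exact/eqP|exact/eqP].
  by do 3 apply/forallP => ?; apply/implyP => h; apply/eqP; exact: h2.
Qed.

Lemma disc_pattern_swap s : disc_pattern s -> disc_pattern (s.1, (s.2.1, (s.2.2.2, s.2.2.1))).
Proof.
case=> D [e0 [e1 [en [tD aD [b0 b1 b01] h1 [h2 h3 h4]]]]]; exists D, e1, e0, en.
by split=> //; split; rewrite // eq_sym.
Qed.

Lemma copy_swap s L z z' : copy s L z z' -> copy (s.1, (s.2.1, (s.2.2.2, s.2.2.1))) L z' z.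
Proof. by case/copyP=> phi [h1 h2 h3 h4]; apply/copyP; exists phi. Qed.

Lemma copyS s L L' z z' : L \subset L' -> copy s L z z' -> copy s L' z z'.
Proof.
move=> /subsetP sL /copyP [phi [h1 h2 h3 h4]]; apply/copyP; exists phi; split=> // j.
exact: sL.
Qed.

(* A disc folds onto a single face. *)
Lemma copy_diag s L z z' : copy s L z z' -> copy s L z z.
Proof.
case/copyP=> phi [h1 _ h3 _]; apply/copyP; exists [ffun=> phi s.2.2.1].
by split=> [j|c j j' _||]; rewrite !ffunE.
Qed.

(** One homomorphism is chosen for each z', so that its value at [x1] trivially determines it. As E
    = F + 1 + |A|, the powers of |T| in [tower_bound] cancel. *)
Lemma card_copies (R : realFieldType) (m k : nat) (K L : {set T * T * T}) (Gam : R) s z :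
  latin K -> tower m K k L Gam -> (64 * b <= m)%N -> (b <= k.*2.+2)%N -> disc_pattern s ->
  #|[set z' | copy s L z z']|%:R * Gam <= 1.
Proof.
move=> lK tw bm bk [D [e0 [e1 [en [[deg2 bd2 coc] aD [b0 b1 b01] [enD enS] [sP s0 s1]]]]]].
have i1 : incident e1 (en s.2.2.2) by exact: incident_fedge s1.
have [d [A [tree [mt [rk /= [W cA cE' wA]]]]]] :=
  surface_system deg2 bd2 coc b0 b1 b01 (enD s.2.2.2) i1.
set f1 := en s.2.2.2 in i1 W cA cE' wA.
set S := Sys _ _ _ _ _ _ _ _ _ _ in W wA.
have cFa : (#|cF f1| <= area D)%N.
  by apply: subset_leq_card; apply/subsetP => f; exact: cF_faces (enD s.2.2.2) _.
have Ak : (#|A| <= k)%N.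
  by clear -cA cFa aD bk; move: cA cFa aD bk; move: #|A| #|cF f1| (area D); lia.
have [L' [G' [tw' LL' GG]]] := tower_below tw Ak.
pose Z := [set z' | copy s L z z'].
have [Z0|[z0 _]] := set_0Vmem Z; first by rewrite -/Z Z0 cards0 mul0r.
pose t0 := z0.
have ZP z' : exists phi : {ffun 'I_b -> T * T * T}, z' \in Z -> [/\ forall j, phi j \in L,
    forall c j j', s.1 (c, (j, j')) -> coord c (phi j) = coord c (phi j'),
    coord s.2.1 (phi s.2.2.1) = z & coord s.2.1 (phi s.2.2.2) = z'].
  have [|nz] := boolP (z' \in Z); last by exists [ffun=> (t0, t0, t0)].
  by rewrite in_set => /copyP [phi h]; exists phi.
have [ph phP] := fin_all_exists ZP.
pose psi z' : {ffun edge D -> T} := [ffun e => if e \in cE f1 then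
   (if [pick j | fedge (edge_cls e) (en j) == e] is Some j then coord (edge_cls e) (ph z' j) else t0)
   else t0].
have psiE z' c j : z' \in Z -> fedge c (en j) \in cE f1 ->
    psi z' (fedge c (en j)) = coord c (ph z' j).
  move=> zZ h; rewrite ffunE h edge_cls_fedge; case: pickP => [j' /eqP ej|/(_ j)]; last by rewrite eqxx.
  by have [_ h2 _ _] := phP _ zZ; apply: h2; rewrite sP ej.
have e0E : e0 \in cE f1 by apply: (e0_cE deg2 bd2 b0 b1 b01 (enD _) i1).
have e1E : e1 \in cE f1 by exact: e1_cE i1.
pose H : {set {ffun sE S -> T}} := [set psi z' | z' in Z].
have psi1 z' : z' \in Z -> psi z' e1 = z'.
  by move=> zZ; rewrite -s1 psiE // ?s1 //; have [] := phP _ zZ.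
have cH : #|H| = #|Z|.
  by apply: card_in_imset => x y xZ yZ e; rewrite -(psi1 x) // e psi1.
have w8 : (weight [eta snd] S A <= 8 * m)%N.
  by apply: leq_trans wA _; clear -cFa aD bm; move: cFa aD bm; move: #|cF f1| (area D); lia.
have n0 : 0 < #|T|%:R :> R by rewrite ltr0n; apply/card_gt0P; exists t0.
have hH phi : phi \in H -> hom t0 L' phi /\ phi (x0 S) = z.
  case/imsetP => z' zZ ->; split; last first.
    by rewrite -[x0 S]/e0 -s0 psiE // ?s0 //; have [] := phP _ zZ.
  apply/andP; split.
    by apply/pffun_onP; split=> //; apply/subsetP => e; rewrite inE ffunE; case: ifP => //; rewrite eqxx.
  apply/forall_inP => f fF; have [j fj] := enS _ (cF_faces (enD _) fF).
  rewrite fj in fF *.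
  rewrite -[ed C0 _]/(fedge C0 (en j)) -[ed C1 _]/(fedge C1 (en j)) -[ed C2 _]/(fedge C2 (en j)).
  rewrite !psiE ?fedge_cE // -!surjective_pairing.
  by have [h _ _ _] := phP _ zZ; apply: (subsetP LL').
have tH phi phi' : phi \in H -> phi' \in H -> phi (x1 S) = phi' (x1 S) ->
    forall q, q \in A -> phi (tree q) = phi' (tree q).
  move=> /imsetP [x xZ ->] /imsetP [y yZ ->] + q _.
  by rewrite -[x1 S]/e1 !psi1 // => ->.
have := tower_bound lK tw' W erefl w8 hH tH.
rewrite cH -[lF S]/(cF f1) -[lE S]/(cE f1) cE' => h.
have : #|Z|%:R * G' <= 1.
  have p : 0 < #|T|%:R ^+ (#|A| + #|cF f1| + 1) :> R by rewrite exprn_gt0.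
  rewrite -(ler_pM2r p) mul1r; apply: le_trans h _.
  by rewrite (_ : (#|cF f1| + 1 + #|A| = #|A| + #|cF f1| + 1)%N) //; clear; lia.
by apply: le_trans; apply: ler_wpM2l.
Qed.
End Codes.

(** * Star richness *)

Section StarCount.
Variables (R : realFieldType) (T : finType) (P : T -> T -> T -> bool) (L : T -> T -> bool).
Variables (B : {set T * T}) (Vx Vy : T -> T * T -> {set T * T}).
Variables (kap eta c : R).
Notation n := (#|T|%:R : R).

Definition bad_set x y := [set t : (T * T) * ((T * T) * (T * T)) |
  [&& t.1 \in B, t.2.1 \in Vx x t.1, t.2.2 \in Vy y t.1
    & (#|partners P (walk8 x y t.1 t.2.1 t.2.2)|%:R < c * n)]].

Hypotheses (kap0 : 0 <= kap) (kap1 : kap <= 1) (eta0 : 0 <= eta) (c0 : 0 <= c) (c1 : c <= 1).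
Hypothesis hB : kap * n ^+ 2 <= #|B|%:R.
Hypothesis hx : forall x y b, L x y -> b \in B -> kap * n ^+ 2 <= #|Vx x b|%:R.
Hypothesis hy : forall x y b, L x y -> b \in B -> kap * n ^+ 2 <= #|Vy y b|%:R.
Hypothesis hbad : forall x y, L x y -> #|bad_set x y|%:R <= eta * n ^+ 6.

Section Fixed.
Variables (t0 : T) (E F : finType) (S : {set E}) (Fp : {set F}) (sb sd : F -> E)
    (kind : E -> bool) (lab : E -> T).
Hypothesis hF : forall f, f \in Fp -> [/\ sb f \in S, sd f \in S, ~~ kind (sb f), kind (sd f)
                             & L (lab (sb f)) (lab (sd f))].

Definition node_set b s : {set T * T} :=
  if s \in sb @: Fp then Vx (lab s) b
  else if s \in sd @: Fp then Vy (lab s) b else setT.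

Definition routes := [set t : (T * T) * {ffun E -> T * T} |
  (t.1 \in B) && (t.2 \in pfamily (t0, t0) (mem S) (fun s => mem (node_set t.1 s)))].

Definition bad_routes f := [set t : (T * T) * {ffun E -> T * T} |
  (t.2 \in pffun_on (t0, t0) (mem S) predT) &&
  ((t.1, (t.2 (sb f), t.2 (sd f))) \in bad_set (lab (sb f)) (lab (sd f)))].

Lemma n_ge0 : 0 <= n. Proof. exact: ler0n. Qed.

Lemma node_set_ge b s : b \in B -> kap * n ^+ 2 <= #|node_set b s|%:R.
Proof.
move=> bB; rewrite /node_set; case: ifP => [/imsetP [f /hF [_ _ _ _ h] ->]|_].
  exact: hx h bB.
case: ifP => [/imsetP [f /hF [_ _ _ _ h] ->]|_]; first exact: hy h bB.
rewrite cardsT card_prod natrM -expr2; apply: ler_piMl => //.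
by rewrite exprn_ge0 ?n_ge0.
Qed.

Lemma card_pfamily_ge (I J : finType) (y0 : J) (D : {set I}) (G : I -> {set J}) (a : R) :
  0 <= a -> (forall i, i \in D -> a <= #|G i|%:R) ->
  a ^+ #|D| <= #|pfamily y0 (mem D) (fun i => mem (G i))|%:R.
Proof.
move=> a0 h; rewrite card_pfamily.
have -> : #|D| = size (enum D) by rewrite -cardE.
have : {subset enum D <= D} by move=> i; rewrite mem_enum.
rewrite /image_mem; elim: (enum _) => [|i s IH] hs; first by rewrite expr0.
rewrite /= exprS natrM; apply: ler_pM => //; first exact: exprn_ge0.
  by rewrite -[#|_|]/(#|mem (G i)|); apply: h; apply: hs; rewrite inE eqxx.
by apply: IH => j js; apply: hs; rewrite inE js orbT.
Qed.

Lemma card_routes : kap ^+ (1 + #|S|) * n ^+ (2 + #|S|.*2) <= #|routes|%:R.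
Proof.
have -> : kap ^+ (1 + #|S|) * n ^+ (2 + #|S|.*2) = (kap * n ^+ 2) * (kap * n ^+ 2) ^+ #|S|.
  by rewrite !exprD expr1 [(_ * _) ^+ #|S|]exprMn -exprM mul2n; ring.
have kn : 0 <= kap * n ^+ 2 by rewrite mulr_ge0 ?exprn_ge0 ?n_ge0.
apply: (@le_trans _ _ (#|B|%:R * (kap * n ^+ 2) ^+ #|S|)).
  by apply: ler_wpM2r => //; exact: exprn_ge0.
have -> : #|routes| = (\sum_(b in B) #|pfamily (t0, t0) (mem S) (fun s => mem (node_set b s))|)%N.
  rewrite -sum1_card; under [RHS]eq_bigr do rewrite -sum1_card.
  by rewrite pair_big_dep /=; apply: eq_bigl => -[b g]; rewrite inE.
rewrite natr_sum mulrC mulr_natr -sumr_const; apply: ler_sum => b bB.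
by apply: card_pfamily_ge => // s _; exact: node_set_ge.
Qed.

(** The base and the routes of the two spokes of f form one of at most [eta * n ^+ 6] bad triples;
    each of the other spokes has at most n^2 routes. *)
Lemma card_bad_routes f : f \in Fp -> #|bad_routes f|%:R <= eta * n ^+ (2 + #|S|.*2).
Proof.
move=> pf; have [sS dS kb kd h] := hF pf.
have bd : sb f != sd f by apply: contraNneq kb => ->.
pose S' := S :\ sb f :\ sd f.
have cS : #|S| = (#|S'| + 2)%N.
  by rewrite (cardsD1 (sb f)) sS (cardsD1 (sd f)) in_setD1 eq_sym bd dS -/S' !add1n addn2.
pose g (t : (T * T) * {ffun E -> T * T}) :=
  ((t.1, (t.2 (sb f), t.2 (sd f))), [ffun s => if s \in S' then t.2 s else (t0, t0)]).
have ginj : {in bad_routes f &, injective g}.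
  move=> [b u] [b' u']; rewrite !inE /= => /andP[/pffun_onP [/fintype.subsetP su _] _].
  move=> /andP[/pffun_onP [/fintype.subsetP su' _] _] [-> eb ed /ffunP e]; congr pair.
  apply/ffunP => s; have [->//|nb] := eqVneq s (sb f).
  have [->//|nd] := eqVneq s (sd f).
  have [sS'|nS] := boolP (s \in S).
    by have := e s; rewrite !ffunE !in_setD1 nd nb sS'.
  have := contra (su s) nS; have := contra (su' s) nS; rewrite !inE !negbK.
  by move=> /eqP -> /eqP ->.
rewrite -(card_in_imset ginj).
have sub : (g @: bad_routes f \subset setX (bad_set (lab (sb f)) (lab (sd f)))
     [set u | u \in pffun_on (t0, t0) (mem S') predT])%N.
  apply/fintype.subsetP => _ /imsetP [t + ->]; rewrite in_setX [t \in _]inE => /andP[_ ->] /=.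
  rewrite inE; apply/pffun_onP; split=> //; apply/fintype.subsetP => s; rewrite inE ffunE.
  by case: ifP => //; rewrite eqxx.
apply: (@le_trans _ _ ((#|bad_set (lab (sb f)) (lab (sd f))| * (#|T| ^ 2) ^ #|S'|)%:R)).
  rewrite ler_nat; apply: leq_trans (subset_leq_card sub) _.
  rewrite cardsX leq_mul2l [X in _ || (X <= _)%N]cardsE card_pffun_on card_prod mulnn.
  by rewrite (eq_card (B := mem S')) ?leqnn ?orbT.
rewrite natrM natrX natrX -exprM.
have -> : eta * n ^+ (2 + #|S|.*2) = (eta * n ^+ 6) * n ^+ (2 * #|S'|).
  by rewrite -mulrA -exprD; congr (_ * _ ^+ _); rewrite cS; move: #|S'| => k; clear; lia.
by apply: ler_wpM2r (hbad h); rewrite exprn_ge0 ?n_ge0.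
Qed.

Definition good_routes := routes :\: \bigcup_(f in Fp) bad_routes f.

Lemma card_good_routes :
  (kap ^+ (1 + #|S|) - #|Fp|%:R * eta) * n ^+ (2 + #|S|.*2) <= #|good_routes|%:R.
Proof.
rewrite mulrBl; have := card_routes.
have : #|routes|%:R <= #|good_routes|%:R + #|\bigcup_(f in Fp) bad_routes f|%:R :> R.
  rewrite -natrD ler_nat -(cardsID (\bigcup_(f in Fp) bad_routes f) routes) addnC leq_add2l.
  exact/subset_leq_card/subsetIr.
have : #|\bigcup_(f in Fp) bad_routes f|%:R <= #|Fp|%:R * eta * n ^+ (2 + #|S|.*2).
  apply: (@le_trans _ _ (\sum_(f in Fp) #|bad_routes f|%:R)).
    rewrite -natr_sum ler_nat.
    exact: card_bigcup_le.
  rewrite -mulrA mulr_natl -sumr_const; apply: ler_sum => f; exact: card_bad_routes.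
lra.
Qed.

Lemma card_star_choice : 0 <= kap ^+ (1 + #|S|) - #|Fp|%:R * eta ->
  (kap ^+ (1 + #|S|) - #|Fp|%:R * eta) * c ^+ #|Fp| * n ^+ (2 + #|S|.*2 + #|Fp|) <=
  #|[set w | star_choice P t0 S Fp sb sd lab w]|%:R.
Proof.
move=> g0.
have -> : (kap ^+ (1 + #|S|) - #|Fp|%:R * eta) * c ^+ #|Fp| * n ^+ (2 + #|S|.*2 + #|Fp|) =
  (kap ^+ (1 + #|S|) - #|Fp|%:R * eta) * n ^+ (2 + #|S|.*2) * (c * n) ^+ #|Fp|.
  by rewrite [n ^+ (_ + #|Fp|)]exprD exprMn; ring.
have cn : 0 <= c * n by rewrite mulr_ge0 ?n_ge0.
apply: (@le_trans _ _ (#|good_routes|%:R * (c * n) ^+ #|Fp|)).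
  by apply: ler_wpM2r card_good_routes; exact: exprn_ge0.
pose W (t : (T * T) * {ffun E -> T * T}) f :=
  walk8 (lab (sb f)) (lab (sd f)) t.1 (t.2 (sb f)) (t.2 (sd f)).
pose Q t := pfamily ([ffun=> t0] : {ffun 'I_8 -> T}) (mem Fp) (fun f => mem (partners P (W t f))).
apply: (@le_trans _ _ (\sum_(t in good_routes) #|Q t|)%N%:R).
  rewrite natr_sum mulrC (mulr_natr ((c * n) ^+ #|Fp|)) -sumr_const; apply: ler_sum => t.
  rewrite inE => /andP[nb]; rewrite inE => /andP[tB /pfamilyP [ts tn]].
  apply: card_pfamily_ge => // f pf; rewrite leNgt; apply: contra nb => nb.
  apply/bigcupP; exists f => //; rewrite inE; apply/andP; split.
    by apply/pffun_onP; split.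
  have [sS dS kb kd h] := hF pf.
  have hsb : sb f \in sb @: Fp by exact: imset_f.
  have hsd : sd f \in sd @: Fp by exact: imset_f.
  have nsd : sd f \notin sb @: Fp.
    by apply/negP => /imsetP [g /hF [_ _ + _ _] e]; rewrite -e kd.
  rewrite inE /= tB; apply/and4P; split=> //.
    by have := tn _ sS; rewrite /node_set hsb.
  by have := tn _ dS; rewrite /node_set (negPf nsd) hsd.
rewrite ler_nat.
have -> : (\sum_(t in good_routes) #|Q t|)%N =
    #|[set w : (T * T) * {ffun E -> T * T} * {ffun F -> {ffun 'I_8 -> T}} |
        (w.1 \in good_routes) && (w.2 \in Q w.1)]|.
  rewrite -[RHS]sum1_card; under eq_bigr do rewrite -sum1_card.
  by rewrite pair_big_dep /=; apply: eq_bigl => -[b g]; rewrite [RHS]in_set.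
apply: subset_leq_card; apply/fintype.subsetP => -[t u]; rewrite !inE /=.
move=> /andP[/andP[_ /andP[tB /pfamilyP [ts _]]] /pfamilyP [us uP]].
apply/and3P; split; [by apply/pffun_onP; split | by apply/pffun_onP; split |].
by apply/forall_inP => f /uP; rewrite inE.
Qed.
End Fixed.

(** Choose base and routes in at least kap^(1+|S|) n^(2+2|S|) ways, discard those bad for some face
    by a union bound, and complete each face by one of at least c n partners; |S| is at most 2m. *)
Lemma star_rich_intro gam m :
  0 <= kap ^+ (1 + m.*2) - m%:R * eta ->
  gam <= (kap ^+ (1 + m.*2) - m%:R * eta) * c ^+ m ->
  star_rich P L gam m.
Proof.
move=> g0 gle t0 E F S Fp sb sd kind lab hF Fm Sm.
have le1 : kap ^+ (1 + m.*2) - m%:R * eta <= kap ^+ (1 + #|S|) - #|Fp|%:R * eta.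
  apply: lerB; first by apply: ler_wiXn2l => //; rewrite leq_add2l.
  by apply: ler_wpM2r => //; rewrite ler_nat.
have g0' := le_trans g0 le1.
apply: le_trans (card_star_choice t0 hF g0').
apply: ler_wpM2r; first by rewrite exprn_ge0 ?n_ge0.
apply: le_trans gle _; apply: ler_pM => //; first exact: exprn_ge0.
exact: ler_wiXn2l.
Qed.
End StarCount.

(** * Averaging inequalities *)

Section Averaging.
Variable R : realFieldType.

Lemma sum_set (I J : finType) (Q : I -> J -> bool) (A : {pred I}) :
  \sum_(i in A) (#|[set j | Q i j]|%:R : R) = #|[set p : I * J | (p.1 \in A) && Q p.1 p.2]|%:R.
Proof.
rewrite -natr_sum; congr _%:R; rewrite -[RHS]sum1_card.
under eq_bigr do rewrite -sum1_card.
by rewrite pair_big_dep /=; apply: eq_bigl => -[i j]; rewrite !inE.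
Qed.

Lemma sum_set_swap (I J : finType) (Q : I -> J -> bool) (A : {pred I}) :
  \sum_(i in A) (#|[set j | Q i j]|%:R : R) = \sum_j #|[set i in A | Q i j]|%:R.
Proof.
rewrite -!natr_sum; congr _%:R.
transitivity (\sum_(i in A) \sum_(j | Q i j) 1)%N.
  by apply: eq_bigr => i _; rewrite sum1dep_card.
rewrite (exchange_big_dep predT) //=; apply: eq_bigr => j _.
by rewrite -sum1dep_card.
Qed.

Lemma exists_ge_average (I : finType) (f : I -> R) (a : R) : (0 < #|I|)%N ->
  #|I|%:R * a <= \sum_i f i -> exists i, a <= f i.
Proof.
move=> I0 h; apply/existsP; apply: contraT => /existsPn nf.
suff : \sum_i f i < #|I|%:R * a by rewrite ltNge h.
rewrite mulr_natl -sumr_const; apply: ltr_sum => [|i _]; last by rewrite ltNge.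
by have /card_gt0P [i _] := I0; apply/hasP; exists i; rewrite ?mem_index_enum.
Qed.

Lemma markov_card (I : finType) (A : {set I}) (f : I -> R) (a : R) :
  (forall i, i \in A -> 0 <= f i) ->
  #|[set i in A | a < f i]|%:R * a <= \sum_(i in A) f i.
Proof.
move=> f0; rewrite mulr_natl -sumr_const [X in _ <= X](big_setID [set i in A | a < f i]) /=.
rewrite (setIidPr _); last by apply/subsetP => i; rewrite inE => /andP[].
rewrite -[X in X <= _]addr0; apply: lerD.
  by apply: ler_sum => i; rewrite inE => /andP[_ /ltW].
by apply: sumr_ge0 => i; rewrite inE => /andP[_ /f0].
Qed.

Lemma sum_ge_threshold (I : finType) (A : {set I}) (f : I -> R) (a : R) : 0 <= a ->
  \sum_(i in A) f i <= \sum_(i in [set i in A | a <= f i]) f i + #|A|%:R * a.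
Proof.
move=> a0; rewrite (big_setID [set i in A | a <= f i]) /=.
rewrite (setIidPr _); last by apply/subsetP => i; rewrite inE => /andP[].
rewrite lerD2l mulr_natl.
apply: (@le_trans _ _ (\sum_(i in A :\: [set i in A | a <= f i]) a)).
  by apply: ler_sum => i; rewrite !inE => /andP[+ iA]; rewrite iA /= -ltNge => /ltW.
by rewrite sumr_const ler_wpMn2l // subset_leq_card // subsetDl.
Qed.
End Averaging.

(** * Many paths of length three in a dense bipartite graph *)

Section Paths.
Variables (R : realFieldType) (T : finType) (G : {set T * T}) (del : R).
Notation n := (#|T|%:R : R).
Hypotheses (T0 : (0 < #|T|)%N) (del0 : 0 < del).
Hypothesis dense : del * n ^+ 2 <= #|G|%:R.

Definition path3 x y := [set p : T * T | [&& (x, p.2) \in G, (p.1, p.2) \in G & (p.1, y) \in G]].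

(* A Balog-Szemeredi-Gowers lemma. *)
Lemma many_paths : exists X Y : {set T},
  del ^+ 2 / 32 * n ^+ 2 <= #|[set p in G | (p.1 \in X) && (p.2 \in Y)]|%:R /\
  forall x y, x \in X -> y \in Y -> del ^+ 6 / 2 ^+ 17 * n ^+ 2 <= #|path3 x y|%:R.
Proof.
have n0 : 0 < n by rewrite ltr0n.
(* A pair is bad if it has fewer than tau n common neighbours, and a vertex is discarded if it has
   more than beta n bad mates. The count of paths is beta n times tau n, which is where 2^17 comes
   from. *)
pose tau := del ^+ 4 / 2048; pose beta := del ^+ 2 / 64.
have tau0 : 0 < tau by rewrite divr_gt0 ?exprn_gt0.
have beta0 : 0 < beta by rewrite divr_gt0 ?exprn_gt0.
have [dge nge tge bge] : [/\ 0 <= del, 0 <= n, 0 <= tau & 0 <= beta] by split; exact: ltW.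
have t4 : 0 <= 4 * tau * n by rewrite mulr_ge0 // mulr_ge0.
pose N x := [set y | (x, y) \in G].
pose X1 := [set x in [set: T] | del / 2 * n <= #|N x|%:R].
have X1d x : x \in X1 -> del / 2 * n <= #|N x|%:R by rewrite inE => /andP[].
have eX1 : del / 2 * n ^+ 2 <= \sum_(x in X1) #|N x|%:R.
  have := @sum_ge_threshold R T setT (fun x => #|N x|%:R) (del / 2 * n).
  move/(_ ltac:(by rewrite mulr_ge0 // divr_ge0)).
  have -> : \sum_(x in [set: T]) #|N x|%:R = #|G|%:R :> R.
    rewrite (sum_set R (fun x y => (x, y) \in G)); congr _%:R.
    by apply: eq_card => -[x y]; rewrite !inE.
  rewrite cardsT -/X1; move: dense; nra.
pose bad x x' := (x \in X1) && (#|N x :&: N x'|%:R < tau * n).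
pose X0 y := [set x in X1 | y \in N x].
pose U y := [set p : T * T | [&& p.1 \in X0 y, p.2 \in X0 y & bad p.1 p.2]].
have sX0 : \sum_y #|X0 y|%:R = \sum_(x in X1) #|N x|%:R :> R.
  rewrite (sum_set_swap R (fun x y => (x, y) \in G)); apply: eq_bigr => y _.
  by congr _%:R; apply: eq_card => x; rewrite !inE.
have sU : \sum_y #|U y|%:R <= n ^+ 2 * (tau * n).
  pose Bd := [set p : T * T | [&& p.1 \in X1, p.2 \in X1 & bad p.1 p.2]].
  have -> : \sum_y #|U y|%:R = \sum_(p in Bd) #|N p.1 :&: N p.2|%:R :> R.
    rewrite (eq_bigr (fun p : T * T => #|[set y | (y \in N p.1) && (y \in N p.2)]|%:R)).
      rewrite (sum_set_swap R (fun (p : T * T) y => (y \in N p.1) && (y \in N p.2))).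
      apply: eq_bigr => y _; congr _%:R; apply: eq_card => -[a b]; rewrite !in_set /=.
      case: ((a, y) \in G); case: ((b, y) \in G); case: (bad a b); by rewrite ?andbF ?andbT.
    by move=> p _; congr _%:R; apply: eq_card => y; rewrite !inE.
  apply: (@le_trans _ _ (#|Bd|%:R * (tau * n))).
    rewrite mulr_natl -sumr_const; apply: ler_sum => p.
    by rewrite inE => /and3P[_ _ /andP[_ /ltW]].
  apply: ler_wpM2r; first exact: mulr_ge0.
  by rewrite -natrX ler_nat; apply: leq_trans (max_card _) _; rewrite card_prod mulnn.
(* Dependent random choice: on average over y the neighbourhood has at least (del/2) n vertices, and
   the penalty for bad pairs is scaled to cost at most half of that. *)
have [y yP] : exists y, del / 4 * n <= #|X0 y|%:R - del / (4 * tau * n) * #|U y|%:R.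
  apply: exists_ge_average => //; rewrite sumrB -mulr_sumr sX0.
  have h : del / (4 * tau * n) * \sum_y #|U y|%:R <= del / 4 * n ^+ 2.
    have -> : del / 4 * n ^+ 2 = del / (4 * tau * n) * (n ^+ 2 * (tau * n)).
      by field; rewrite !gt_eqF.
    by apply: ler_wpM2l => //; rewrite divr_ge0.
  by move: eX1 h; nra.
have U0 : 0 <= #|U y|%:R :> R by [].
have X0n : #|X0 y|%:R <= n by rewrite ler_nat max_card.
have X0big : del / 4 * n <= #|X0 y|%:R.
  apply: le_trans yP _; by rewrite lerBlDr lerDl mulr_ge0 // divr_ge0.
have Usmall : #|U y|%:R <= 4 * tau / del * n ^+ 2.
  have -> : 4 * tau / del * n ^+ 2 = (4 * tau * n / del) * n by ring.
  have -> : #|U y|%:R = (4 * tau * n / del) * (del / (4 * tau * n) * #|U y|%:R) :> R.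
    by field; rewrite !gt_eqF.
  apply: ler_wpM2l; first by rewrite divr_ge0.
  by apply: le_trans X0n; move: yP; have : 0 <= del / 4 * n; [rewrite mulr_ge0 // divr_ge0 | lra].
pose badn x := [set x' in X0 y | bad x x'].
pose Xb := [set x in X0 y | beta * n < #|badn x|%:R].
pose X := X0 y :\: Xb.
have XbX : #|Xb|%:R <= del / 8 * n.
  have := @markov_card R T (X0 y) (fun x => #|badn x|%:R) (beta * n).
  move=> /(_ _); rewrite -/Xb (sum_set R (fun x x' => (x' \in X0 y) && bad x x')).
  have -> : #|[set p : T * T | (p.1 \in X0 y) && ((p.2 \in X0 y) && bad p.1 p.2)]| = #|U y|.
    by apply: eq_card => p; rewrite !inE.
  move=> h; have {}h : #|Xb|%:R * (beta * n) <= 4 * tau / del * n ^+ 2 by apply: le_trans Usmall; apply: h.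
  rewrite -(ler_pM2r (mulr_gt0 beta0 n0)); apply: le_trans h _.
  have -> // : 4 * tau / del * n ^+ 2 = del / 8 * n * (beta * n).
  by rewrite /tau /beta; field; rewrite gt_eqF.
have Xbig : del / 8 * n <= #|X|%:R.
  have : #|X0 y|%:R <= #|X|%:R + #|Xb|%:R :> R.
    rewrite -natrD ler_nat -(cardsID Xb (X0 y)) addnC leq_add2l.
    exact/subset_leq_card/subsetIr.
  lra.
pose NX z := [set x in X | (x, z) \in G].
pose Y := [set z in [set: T] | del ^+ 2 / 32 * n <= #|NX z|%:R].
exists X, Y; split.
  have -> : #|[set p in G | (p.1 \in X) && (p.2 \in Y)]|%:R = \sum_(z in Y) #|NX z|%:R :> R.
    rewrite (sum_set R (fun z x => (x \in X) && ((x, z) \in G))); congr _%:R.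
    pose sw (p : T * T) := (p.2, p.1).
    have swi : injective sw by move=> [a b] [a' b'] [-> ->].
    rewrite -(card_imset _ swi); apply: eq_card => -[a b].
    apply/idP/imsetP => [|[[u v]]]; rewrite inE /= => /and3P[h1 h2 h3].
      by exists (b, a) => //; rewrite inE /= h3 h2 h1.
    by move=> [-> ->]; rewrite inE /= h3 h2 h1.
  have := @sum_ge_threshold R T setT (fun z => #|NX z|%:R) (del ^+ 2 / 32 * n).
  move/(_ ltac:(by rewrite mulr_ge0 // divr_ge0 // exprn_ge0)); rewrite -/Y cardsT.
  have -> : \sum_(z in [set: T]) #|NX z|%:R = \sum_(x in X) #|N x|%:R :> R.
    rewrite (sum_set_swap R (fun x z => (x, z) \in G)); apply: eq_big => [z|z _]; first by rewrite inE.
    by congr _%:R; apply: eq_card => x; rewrite !inE.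
  have : #|X|%:R * (del / 2 * n) <= \sum_(x in X) #|N x|%:R.
    rewrite mulr_natl -sumr_const; apply: ler_sum => x; rewrite inE => /andP[_].
    by rewrite inE => /andP[/X1d].
  have : del / 8 * n * (del / 2 * n) <= #|X|%:R * (del / 2 * n).
    by apply: ler_wpM2r => //; rewrite mulr_ge0 // divr_ge0.
  have -> : del / 8 * n * (del / 2 * n) = 2 * (del ^+ 2 / 32 * n ^+ 2) by field.
  have -> : n * (del ^+ 2 / 32 * n) = del ^+ 2 / 32 * n ^+ 2 by ring.
  lra.
move=> x z xX zY; have zd : del ^+ 2 / 32 * n <= #|NX z|%:R by move: zY; rewrite inE => /andP[].
have xX0 : x \in X0 y by move: xX; rewrite inE => /andP[].
have xX1 : x \in X1 by move: xX0; rewrite inE => /andP[].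
have xb : #|badn x|%:R <= beta * n.
  by move: xX; rewrite [x \in X]inE [x \in Xb]inE xX0 /= andbT -leNgt.
pose gd := NX z :\: badn x.
have gdn : beta * n <= #|gd|%:R.
  have : #|NX z|%:R <= #|gd|%:R + #|badn x|%:R :> R.
    rewrite -natrD ler_nat -(cardsID (badn x) (NX z)) addnC leq_add2l.
    exact/subset_leq_card/subsetIr.
  have : del ^+ 2 / 32 * n = 2 * (beta * n) by rewrite /beta; field.
  lra.
apply: (@le_trans _ _ (\sum_(x' in gd) #|N x :&: N x'|%:R)).
  have -> : del ^+ 6 / 2 ^+ 17 * n ^+ 2 = (beta * n) * (tau * n).
    by rewrite /beta /tau; field.
  apply: (@le_trans _ _ (#|gd|%:R * (tau * n))).
    by apply: ler_wpM2r => //; rewrite mulr_ge0.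
  rewrite mulr_natl -sumr_const; apply: ler_sum => x'.
  rewrite inE => /andP[nb]; rewrite inE => /andP[x'X _].
  have x'X0 : x' \in X0 y by move: x'X; rewrite inE => /andP[].
  by move: nb; rewrite inE x'X0 /= /bad xX1 /= -leNgt.
rewrite (eq_bigr (fun x' => #|[set y' | (y' \in N x) && (y' \in N x')]|%:R)); last first.
  by move=> x' _; congr _%:R; apply: eq_card => y'; rewrite !inE.
rewrite (sum_set R (fun x' y' => (y' \in N x) && (y' \in N x'))) ler_nat.
apply: subset_leq_card; apply/subsetP => -[x' y']; rewrite [_ \in [set _ | _]]inE /=.
move=> /and3P[]; rewrite inE => /andP[_]; rewrite inE => /andP[_ zx'].
by rewrite !inE /= => -> ->.
Qed.
End Paths.

Lemma cauchy_schwarz_card (R : realFieldType) (I : finType) (A : {pred I}) (f : I -> R) :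
  (\sum_(i in A) f i) ^+ 2 <= #|A|%:R * \sum_(i in A) f i ^+ 2.
Proof.
have : 0 <= \sum_(i in A) \sum_(j in A) (f i - f j) ^+ 2.
  by apply: sumr_ge0 => i _; apply: sumr_ge0 => j _; exact: sqr_ge0.
have -> : \sum_(i in A) \sum_(j in A) (f i - f j) ^+ 2 =
    2 * (#|A|%:R * \sum_(i in A) f i ^+ 2) - 2 * (\sum_(i in A) f i) ^+ 2.
  have e i j : (f i - f j) ^+ 2 = f i ^+ 2 + f j ^+ 2 - 2 * (f i * f j) by ring.
  under eq_bigr do under eq_bigr do rewrite e.
  under eq_bigr do rewrite sumrB big_split /= sumr_const -mulr_sumr -mulr_sumr.
  rewrite sumrB big_split /= sumr_const -mulr_sumr -mulr_suml.
  rewrite sumrMnl; set s := \sum_(i in A) f i ^+ 2; rewrite -(mulr_natl s); ring.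
lra.
Qed.

(** * Four-cycles in the link and twins *)

Section FourCycles.
Variables (R : realFieldType) (T : finType).
Notation n := (#|T|%:R : R).

Definition walks k (E : T -> T -> bool) : {set {ffun 'I_k -> T}} :=
  [set w : {ffun 'I_k -> T} | [forall j, E (w (evn j)) (w (odn j))]].

(** Sidorenko's inequality for the 4-cycle, by Cauchy-Schwarz first over vertices and then over
    pairs of vertices. *)
Lemma card_walks4 (E : T -> T -> bool) :
  #|[set p : T * T | E p.1 p.2]|%:R ^+ 4 <= n ^+ 4 * #|walks 4 E|%:R.
Proof.
pose g (p : (T * T) * (T * T)) : {ffun 'I_4 -> T} :=
  [ffun j : 'I_4 => nth p.1.1 [:: p.2.1; p.1.1; p.2.2; p.1.2] j].
have ginj : injective g.
  move=> [[y y'] [x x']] [[z z'] [w w']] /ffunP e.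
  have := e (@Ordinal 4 0 isT); have := e (@Ordinal 4 1 isT).
  have := e (@Ordinal 4 2 isT); have := e (@Ordinal 4 3 isT).
  by rewrite !ffunE /= => -> -> -> ->.
pose Q (q : T * T) x := E x q.1 && E x q.2.
have c4 : \sum_(q : T * T) #|[set x | Q q x]|%:R ^+ 2 <= #|walks 4 E|%:R :> R.
  have -> : \sum_(q : T * T) #|[set x | Q q x]|%:R ^+ 2 =
      \sum_(q in predT) #|[set r : T * T | Q q r.1 && Q q r.2]|%:R :> R.
    apply: eq_bigr => q _; rewrite -natrX; congr _%:R.
    by rewrite -mulnn -cardsX; apply: eq_card => -[a b]; rewrite !inE.
  rewrite sum_set ler_nat -(card_imset _ ginj); apply: subset_leq_card.
  apply/subsetP => _ /imsetP [[[y y'] [x x']] + ->]; rewrite inE /= /Q /=.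
  move=> /andP[/andP[a b] /andP[a' b']]; rewrite inE; apply/forallP => -[[|[|[|[|j]]]] jk] //;
    by rewrite !ffunE /=.
have c3 : (#|[set p : T * T | E p.1 p.2]|%:R ^+ 2 <= n * \sum_(q : T * T) #|[set x | Q q x]|%:R :> R).
  have -> : #|[set p : T * T | E p.1 p.2]|%:R = \sum_(x in T) #|[set y | E x y]|%:R :> R.
    by rewrite sum_set; congr _%:R; apply: eq_card => p; rewrite !inE.
  apply: le_trans (cauchy_schwarz_card _ _) _; apply: ler_wpM2l => //.
  have -> : \sum_(q : T * T) #|[set x | Q q x]|%:R = \sum_(x in T) #|[set q | Q q x]|%:R :> R.
    have := sum_set_swap R Q predT; rewrite /= => ->; apply: eq_bigr => x _; congr _%:R.
  apply: ler_sum => x _; rewrite -natrX ler_nat -mulnn -cardsX.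
  by apply: subset_leq_card; apply/subsetP => -[a b]; rewrite !inE.
have c2 := cauchy_schwarz_card (@predT (T * T)%type) (fun q : T * T => #|[set x | Q q x]|%:R : R).
rewrite -[#|predT|]/(#|{: T * T}|) card_prod natrM /= in c2.
set e := #|[set p : T * T | E p.1 p.2]|%:R : R in c3 *.
set s := \sum_(q : T * T) #|[set x | Q q x]|%:R : R in c3 c2 *.
have -> : e ^+ 4 = (e ^+ 2) ^+ 2 by rewrite -exprM.
have n0 : 0 <= n by [].
have : (e ^+ 2) ^+ 2 <= (n * s) ^+ 2.
  by rewrite ler_sqr ?nnegrE ?sqr_ge0 //; apply: le_trans c3; exact: sqr_ge0.
move/le_trans; apply; rewrite exprMn.
have -> : n ^+ 4 * #|walks 4 E|%:R = n ^+ 2 * (n * n * #|walks 4 E|%:R) by ring.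
apply: ler_wpM2l; first exact: exprn_ge0.
by apply: le_trans c2 _; apply: ler_wpM2l => //; rewrite mulr_ge0.
Qed.

Definition popular_walks (P : T -> T -> T -> bool) k E c :=
  [set w in walks k E | c * n <= #|partners P w|%:R].

(* Popular 4-cycles have few label quadruples, so many of them share theirs. *)
Lemma twins_popular (P : T -> T -> T -> bool) (L : {set T * T}) (c : R) : platin P ->
  (forall x y, (x, y) \in L -> exists z, P z x y) -> 0 < c -> (0 < #|T|)%N ->
  c * #|popular_walks P 4 (fun x y => (x, y) \in L) c|%:R ^+ 2 <= n ^+ 3 * #|twins (fun z x y => P z x y && ((x, y) \in L))|%:R.
Proof.
move=> [l0 l1 l2] LP c0 T0; set W := popular_walks _ _ _ _.
pose lb x y := odflt x [pick z | P z x y].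
have lbP z x y : P z x y -> lb x y = z.
  by rewrite /lb; case: pickP => [z' h1 h2|-> //]; exact: l2 h1 h2.
pose lab (w : {ffun 'I_4 -> T}) : {ffun 'I_4 -> T} := [ffun j => lb (w (evn j)) (w (odn j))].
have labS w w' : partner P w w' -> lab w = lab w'.
  move=> /forallP h; apply/ffunP => j; rewrite !ffunE.
  by have /existsP [z /andP[h1 h2]] := h j; rewrite (lbP _ _ _ h1) (lbP _ _ _ h2).
pose Z := lab @: W.
(* Each label quadruple of a popular walk is shared by at least c n of the n^4 quadruples of
   nodes. *)
have cZ : #|Z|%:R * c <= n ^+ 3.
  have n0 : 0 < n by rewrite ltr0n.
  rewrite -(ler_pM2r n0) -mulrA.
  apply: (@le_trans _ _ (\sum_(l in Z) #|[set w | lab w == l]|%:R)).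
    rewrite mulr_natl -sumr_const; apply: ler_sum => _ /imsetP [w + ->].
    rewrite inE => /andP[_ /le_trans]; apply; rewrite ler_nat; apply: subset_leq_card.
    by apply/subsetP => w'; rewrite !inE => /labS ->.
  rewrite sum_set -exprSr -natrX ler_nat.
  have -> : (#|T| ^ 4 = #|{ffun 'I_4 -> T}|)%N by rewrite card_ffun card_ord.
  pose sn (p : {ffun 'I_4 -> T} * {ffun 'I_4 -> T}) := p.2.
  rewrite -(card_in_imset (f := sn)); first exact: max_card.
  by move=> [a b] [a' b']; rewrite !inE /= => /andP[_ /eqP <-] /andP[_ /eqP <-] ->.
have cW : #|W|%:R ^+ 2 <= #|Z|%:R * #|[set p : {ffun 'I_4 -> T} * {ffun 'I_4 -> T} |
     [&& p.1 \in W, p.2 \in W & lab p.1 == lab p.2]]|%:R :> R.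
  have -> : #|W|%:R = \sum_(l in Z) #|[set w | (w \in W) && (lab w == l)]|%:R :> R.
    rewrite -natr_sum; congr _%:R; rewrite -sum1_card (partition_big lab (mem Z)) /=.
      by apply: eq_bigr => l _; rewrite sum1dep_card.
    by move=> w wW; exact: imset_f.
  apply: le_trans (cauchy_schwarz_card _ _) _; apply: ler_wpM2l => //.
  apply: (@le_trans _ _ (\sum_(l in Z) #|[set q : {ffun 'I_4 -> T} * {ffun 'I_4 -> T} |
       [&& q.1 \in W, q.2 \in W, lab q.1 == l & lab q.2 == l]]|%:R)).
    apply: ler_sum => l _; rewrite -natrX ler_nat -mulnn -cardsX.
    by apply: subset_leq_card; apply/subsetP => -[a b]; rewrite !in_set /=; case/andP=> /andP[-> ->] /andP[-> ->].
  rewrite (sum_set R (fun l (q : {ffun 'I_4 -> T} * {ffun 'I_4 -> T}) =>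
    [&& q.1 \in W, q.2 \in W, lab q.1 == l & lab q.2 == l])) ler_nat.
  pose sn (p : {ffun 'I_4 -> T} * ({ffun 'I_4 -> T} * {ffun 'I_4 -> T})) := p.2.
  rewrite -(card_in_imset (f := sn)).
    apply: subset_leq_card; apply/subsetP => _ /imsetP [[l [a b]] + ->]; rewrite !in_set /=.
    by move=> /and5P[_ -> -> /eqP -> /eqP ->]; rewrite eqxx.
  move=> [l [a b]] [l' [a' b']]; rewrite !in_set /=.
  move=> /and5P[_ _ _ /eqP <- _] /and5P[_ _ _ /eqP <- _] e.
  by move: e; rewrite /sn /= => -[-> ->].
have cT : (#|[set p : {ffun 'I_4 -> T} * {ffun 'I_4 -> T} |
     [&& p.1 \in W, p.2 \in W & lab p.1 == lab p.2]]| <=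
   #|twins (fun z x y => P z x y && ((x, y) \in L))|)%N.
  pose o k (k4 : (k < 4)%N) := @Ordinal 4 k k4.
  pose g (p : {ffun 'I_4 -> T} * {ffun 'I_4 -> T}) :
      {ffun bool * bool -> T} * {ffun bool * bool -> T} :=
    ([ffun i => (if i.2 then p.2 else p.1) (if i.1 then o 2 isT else o 0 isT)],
     [ffun i => (if i.2 then p.2 else p.1) (if i.1 then o 3 isT else o 1 isT)]).
  have ginj : injective g.
    move=> [a b] [a' b'] [/ffunP ex /ffunP ey].
    have e0 := ex (false, false); have e1 := ey (false, false).
    have e2 := ex (true, false); have e3 := ey (true, false).
    have f0 := ex (false, true); have f1 := ey (false, true).
    have f2 := ex (true, true); have f3 := ey (true, true).
    rewrite !ffunE /= in e0 e1 e2 e3 f0 f1 f2 f3.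
    by congr pair; apply/ffunP => -[[|[|[|[|j]]]] j4] //;
      rewrite (bool_irrelevance j4 isT).
  rewrite -(card_imset _ ginj); apply: subset_leq_card.
  apply/subsetP => _ /imsetP [[a b] + ->]; rewrite !in_set /=.
  move=> /and3P[/andP[aL _] /andP[bL _] /eqP ab].
  move/forallP: aL => aL; move/forallP: bL => bL.
  have key j : same (fun z x y => P z x y && ((x, y) \in L))
      (a (evn j)) (a (odn j)) (b (evn j)) (b (odn j)).
    have [z1 h1] := LP _ _ (aL j); have [z2 h2] := LP _ _ (bL j).
    have := congr1 (fun u : {ffun 'I_4 -> T} => u j) ab.
    rewrite !ffunE (lbP _ _ _ h1) (lbP _ _ _ h2) => z12; subst z2.
    by apply/existsP; exists z1; rewrite h1 h2 aL bL.
  have k0 := key (o 0 isT); have k1 := key (o 1 isT).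
  have k2 := key (o 2 isT); have k3 := key (o 3 isT).
  have ev (j : 'I_4) i : (nat_of_ord j = i) -> forall i4 : (i < 4)%N, j = o i i4.
    by move=> ji i4; apply: val_inj.
  rewrite (ev (evn (o 0 isT)) 0 erefl isT) (ev (odn (o 0 isT)) 1 erefl isT) in k0.
  rewrite (ev (evn (o 1 isT)) 2 erefl isT) (ev (odn (o 1 isT)) 1 erefl isT) in k1.
  rewrite (ev (evn (o 2 isT)) 2 erefl isT) (ev (odn (o 2 isT)) 3 erefl isT) in k2.
  rewrite (ev (evn (o 3 isT)) 0 erefl isT) (ev (odn (o 3 isT)) 3 erefl isT) in k3.
  by apply/forallP => -[]; apply/forallP => -[]; rewrite !ffunE /=.
apply: (@le_trans _ _ (c * (#|Z|%:R * #|twins (fun z x y => P z x y && ((x, y) \in L))|%:R))).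
  apply: ler_wpM2l; first exact: ltW.
  by apply: le_trans cW _; apply: ler_wpM2l => //; rewrite ler_nat.
by rewrite mulrA [c * _]mulrC; apply: ler_wpM2r.
Qed.
End FourCycles.

(** * A change of apex preserving mostly popular walks *)

Section PopularShift.
Variables (R : realFieldType) (T : finType) (P : T -> T -> T -> bool).
Hypothesis pl : platin P.
Notation n := (#|T|%:R : R).

Definition unpopular k (c : R) h : {set {ffun 'I_k -> T}} :=
  [set w | shift_walk P h w && (#|partners P w|%:R < c * n)].

(** By [card_shift_walk], a walk with fewer than c n partners is preserved by at most c n^3 changes
    of apex. *)
Lemma sum_unpopular k (c : R) (j0 : 'I_k) : 0 <= c ->
  (forall j : 'I_k, ~~ odd (evn j) /\ odd (odn j)) ->
  \sum_h #|unpopular k c h|%:R <= c * n ^+ (k + 3).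
Proof.
move=> c0 par; have n0 : 0 <= n by [].
have := sum_set_swap R (fun h (w : {ffun 'I_k -> T}) =>
  shift_walk P h w && (#|partners P w|%:R < c * n)) predT => /= ->.
have -> : c * n ^+ (k + 3) = \sum_(w : {ffun 'I_k -> T}) c * n ^+ 3.
  rewrite sumr_const card_ffun card_ord -(mulr_natl (c * n ^+ 3)) natrX exprD; ring.
apply: ler_sum => w _; case: (ltP (#|partners P w|%:R) (c * n)) => [lt|_]; last first.
  rewrite (eq_card (B := pred0)) ?card0 ?mulr_ge0 ?exprn_ge0 // => h.
  by rewrite !inE andbF.
apply: (@le_trans _ _ (#|partners P w| * #|T| ^ 2)%:R).
  rewrite ler_nat; apply: leq_trans (card_shift_walk pl w j0 par).
  by apply: subset_leq_card; apply/subsetP => h; rewrite !inE andbT.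
by rewrite natrM natrX (exprS n 2) mulrA; apply: ler_wpM2r; [exact: exprn_ge0 | exact: ltW].
Qed.

Lemma popular_shift (eps c4 c8 : R) : (0 < #|T|)%N -> 0 < eps -> 0 < c4 -> 0 < c8 ->
  eps * n ^+ 5 <= #|twins P|%:R ->
  exists h, [/\ eps / 2 * n ^+ 2 <= #|[set p : T * T | shift_ok P h p.1 p.2]|%:R,
    eps * #|unpopular 4 c4 h|%:R <= 4 * c4 * n ^+ 4
  & eps * #|unpopular 8 c8 h|%:R <= 4 * c8 * n ^+ 8].
Proof.
move=> T0 e0 c40 c80 he; have n0 : 0 < n by rewrite ltr0n.
pose G h := #|[set p : T * T | shift_ok P h p.1 p.2]|%:R : R.
(* The weights give the three averages the ratio 4 : 1 : 1, so a single h with [f h] at least the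
   mean satisfies all three conclusions. *)
pose f h := 4 * c4 * c8 * n ^+ 6 * G h
  - eps * c4 * #|unpopular 8 c8 h|%:R - eps * c8 * n ^+ 4 * #|unpopular 4 c4 h|%:R.
have par8 (j : 'I_8) : ~~ odd (evn j) /\ odd (odn j) by rewrite evn_odd odn_odd.
have par4 (j : 'I_4) : ~~ odd (evn j) /\ odd (odn j) by case: j => [[|[|[|[|j]]]] ?].
have U8 := @sum_unpopular 8 c8 ord0 (ltW c80) par8.
have U4 := @sum_unpopular 4 c4 ord0 (ltW c40) par4.
have GS : eps * n ^+ 5 <= \sum_h G h.
  apply: le_trans he _; rewrite (sum_set R (fun h p => shift_ok P h p.1 p.2) predT) ler_nat.
  exact: card_twins_le pl.
have cT : #|{: T * T * T}|%:R = n ^+ 3 by rewrite !card_prod !natrM; ring.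
have [||h hh] := @exists_ge_average R _ f (2 * eps * c4 * c8 * n ^+ 8).
- by rewrite !card_prod !muln_gt0 T0.
- rewrite cT /f !sumrB -!mulr_sumr.
  have p1 : 0 < 4 * c4 * c8 * n ^+ 6 by rewrite !mulr_gt0 ?exprn_gt0.
  have p2 : 0 < eps * c4 by rewrite mulr_gt0.
  have p3 : 0 < eps * c8 * n ^+ 4 by rewrite !mulr_gt0 ?exprn_gt0.
  have h1 := ler_wpM2l (ltW p1) GS; have h2 := ler_wpM2l (ltW p2) U8.
  have h3 := ler_wpM2l (ltW p3) U4.
  have := lerB (lerB h1 h2) h3; apply: le_trans.
  by rewrite le_eqVlt; apply/orP; left; apply/eqP; rewrite /=; ring.
have [e0' c40' c80' n0'] : [/\ 0 <= eps, 0 <= c4, 0 <= c8 & 0 <= n] by split; exact: ltW.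
have q1 : 0 <= eps * c4 * #|unpopular 8 c8 h|%:R by rewrite !mulr_ge0.
have q2 : 0 <= eps * c8 * n ^+ 4 * #|unpopular 4 c4 h|%:R by rewrite !mulr_ge0 ?exprn_ge0.
have q3 : 0 <= 2 * eps * c4 * c8 * n ^+ 8 by rewrite !mulr_ge0 ?exprn_ge0.
have Gn : G h <= n ^+ 2.
  by rewrite /G -natrX ler_nat; apply: leq_trans (max_card _) _; rewrite card_prod mulnn.
have Gn' : 4 * c4 * c8 * n ^+ 6 * G h <= 4 * c4 * c8 * n ^+ 8.
  have -> : n ^+ 8 = n ^+ 6 * n ^+ 2 by rewrite -exprD.
  by rewrite mulrA; apply: ler_wpM2l => //; rewrite !mulr_ge0 ?exprn_ge0.
rewrite /f in hh; exists h; split.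
- have p : 0 < 4 * c4 * c8 * n ^+ 6 by rewrite !mulr_gt0 ?exprn_gt0.
  rewrite -(ler_pM2l p) -/(G h).
  have -> : 4 * c4 * c8 * n ^+ 6 * (eps / 2 * n ^+ 2) = 2 * eps * c4 * c8 * n ^+ 8 by field.
  lra.
- have p : 0 < c8 * n ^+ 4 by rewrite mulr_gt0 ?exprn_gt0.
  rewrite -(ler_pM2l p).
  have -> : c8 * n ^+ 4 * (eps * #|unpopular 4 c4 h|%:R) = eps * c8 * n ^+ 4 * #|unpopular 4 c4 h|%:R by ring.
  have -> : c8 * n ^+ 4 * (4 * c4 * n ^+ 4) = 4 * c4 * c8 * n ^+ 8 by ring.
  lra.
- rewrite -(ler_pM2l c40).
  have -> : c4 * (eps * #|unpopular 8 c8 h|%:R) = eps * c4 * #|unpopular 8 c8 h|%:R by ring.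
  have -> : c4 * (4 * c8 * n ^+ 8) = 4 * c4 * c8 * n ^+ 8 by ring.
  lra.
Qed.
End PopularShift.

(** * Restriction to a set of link edges *)

Section Restrict.
Variable T : finType.
Implicit Types A : {set T * T * T}.

Definition link_pair c (t : T * T * T) :=
  match c with C0 => (t.1.2, t.2) | C1 => (t.2, t.1.1) | C2 => (t.1.1, t.1.2) end.

Definition restrict A c (L : {set T * T}) := [set t in A | link_pair c t \in L].

Lemma restrict_sub A c L : restrict A c L \subset A.
Proof. by apply/subsetP => t; rewrite inE => /andP[]. Qed.

Lemma view_restrict A c L z x y :
  view (restrict A c L) c z x y = view A c z x y && ((x, y) \in L).
Proof. by case: c; rewrite /= inE. Qed.

Lemma link_rel_restrict A c L x y : link_rel (restrict A c L) c x y -> (x, y) \in L.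
Proof. by case/existsP=> z; rewrite view_restrict => /andP[]. Qed.

Lemma link_relS A A' c x y : A \subset A' -> link_rel A c x y -> link_rel A' c x y.
Proof. by move=> s /existsP [z h]; apply/existsP; exists z; exact: viewS s h. Qed.

Lemma eq_card_twins P P' : (forall z x y : T, P z x y = P' z x y) -> #|twins P| = #|twins P'|.
Proof.
move=> e; apply: eq_card => t; rewrite !inE; do 2 (apply: eq_forallb => ?).
by apply: eq_existsb => z; rewrite !e.
Qed.

Lemma card_octs_restrict A c L : latin A ->
  #|octs (restrict A c L)| = #|twins (fun z x y => view A c z x y && ((x, y) \in L))|.
Proof.
move=> lA; rewrite -(card_twins c (latinS (restrict_sub A c L) lA)).
by apply: eq_card_twins => z x y; rewrite view_restrict.
Qed.

Definition oct_face (t : {ffun bool * bool -> T} * {ffun bool * bool -> T} * {ffun bool * bool -> T})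
  (w : bool * bool * bool) := (t.1.1 (w.1.2, w.2), t.1.2 (w.1.1, w.2), t.2 (w.1.1, w.1.2)).

(* One face and three further edges determine an octahedron. *)
Lemma card_octs_face A (Z : {set T * T * T}) w : latin A ->
  (#|[set t in octs A | oct_face t w \in Z]| <= #|Z| * #|T| ^ 3)%N.
Proof.
case: w => [[i j] k] [l0 l1 l2].
pose g (t : {ffun bool * bool -> T} * {ffun bool * bool -> T} * {ffun bool * bool -> T}) :=
  (oct_face t (i, j, k), (t.1.2 (i, ~~ k), t.2 (i, ~~ j), t.1.2 (~~ i, ~~ k))).
have ginj : {in [set t in octs A | oct_face t (i, j, k) \in Z] &, injective g}.
  move=> [[a b] d] [[a' b'] d']; rewrite in_set => /andP[/octsP/= h _].
  rewrite in_set => /andP[/octsP/= h' _] [e1 e2 e3 e4 e5 e6].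
  have e7 : a (j, ~~ k) = a' (j, ~~ k) by apply: l2 (h i j (~~ k)) _; rewrite e4 e3; exact: h'.
  have e8 : a (~~ j, k) = a' (~~ j, k) by apply: l2 (h i (~~ j) k) _; rewrite e2 e5; exact: h'.
  have e9 : a (~~ j, ~~ k) = a' (~~ j, ~~ k).
    by apply: l2 (h i (~~ j) (~~ k)) _; rewrite e4 e5; exact: h'.
  have e10 : d (~~ i, j) = d' (~~ i, j).
    by apply: l0 (h (~~ i) j (~~ k)) _; rewrite e7 e6; exact: h'.
  have e11 : d (~~ i, ~~ j) = d' (~~ i, ~~ j).
    by apply: l0 (h (~~ i) (~~ j) (~~ k)) _; rewrite e9 e6; exact: h'.
  have e12 : b (~~ i, k) = b' (~~ i, k).
    by apply: l1 (h (~~ i) j k) _; rewrite e1 e10; exact: h'.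
  clear g h h'; congr (_, _, _); apply/ffunP => -[].
  - by clear -e1 e7 e8 e9; case: j e1 e7 e8 e9; case: k => /= ? ? ? ? [] [].
  - by clear -e2 e4 e6 e12; case: i e2 e4 e6 e12; case: k => /= ? ? ? ? [] [].
  - by clear -e3 e5 e10 e11; case: i e3 e5 e10 e11; case: j => /= ? ? ? ? [] [].
rewrite -(card_in_imset ginj).
have -> : (#|Z| * #|T| ^ 3)%N = #|setX Z [set: T * T * T]|.
  by rewrite cardsX cardsT !card_prod; congr (_ * _)%N; rewrite -mulnA.
apply: subset_leq_card; apply/subsetP => _ /imsetP [t + ->]; rewrite in_set => /andP[_ tZ].
by rewrite in_setX in_setT andbT.
Qed.

Lemma card_octs_le A : latin A -> (#|octs A| <= #|A| * #|T| ^ 3)%N.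
Proof.
move=> lA; apply: leq_trans (card_octs_face A (false, false, false) lA).
apply: subset_leq_card; apply/subsetP => t tA; rewrite in_set tA.
by move/octsP: tA; apply.
Qed.

(** A lost octahedron has one of its eight faces in [A :\: A'], and a given face in a given position
    lies in at most |T|^3 octahedra. *)
Lemma card_octs_sub A A' : latin A ->
  (#|octs A| <= #|octs A'| + 8 * #|A :\: A'| * #|T| ^ 3)%N.
Proof.
move=> lA; rewrite -(cardsID (octs A') (octs A)); apply: leq_add.
  by rewrite subset_leq_card // subsetIr.
apply: (@leq_trans (\sum_(w : bool * bool * bool) #|[set t in octs A | oct_face t w \in A :\: A']|)).
  apply: leq_trans (card_bigcup_le _ _).
  apply: subset_leq_card; apply/subsetP => t; rewrite in_setD => /andP[nt tA].
  have [w nw] : exists w, oct_face t w \notin A'.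
    apply/existsP; rewrite -negb_forall; apply: contra nt => /forallP h.
    by apply/octsP => i j k; exact: (h (i, j, k)).
  apply/bigcupP; exists w => //; rewrite in_set tA in_setD nw.
  by move/octsP: tA; apply.
apply: (@leq_trans (\sum_(w : bool * bool * bool) #|A :\: A'| * #|T| ^ 3)).
  by apply: leq_sum => w _; exact: card_octs_face.
by rewrite sum_nat_const !card_prod card_bool mulnA.
Qed.
End Restrict.

Lemma star_rich_mono (R : realFieldType) (T : finType) (P P' : T -> T -> T -> bool)
    (L L' : T -> T -> bool) (gam gam' : R) m :
  (forall z x y, P z x y -> P' z x y) -> (forall x y, L' x y -> L x y) -> gam' <= gam ->
  star_rich P L gam m -> star_rich P' L' gam' m.
Proof.
move=> PP LL gg rich t0 E F S Fp sb sd kind lab hF Fm Sm.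
have := rich t0 E F S Fp sb sd kind lab _ Fm Sm.
move=> /(_ (fun f pf => let: And5 a b c d e := hF f pf in And5 a b c d (LL _ _ e))) h.
apply: (@le_trans _ _ (gam * #|T|%:R ^+ (2 + #|S|.*2 + #|Fp|))).
  by apply: ler_wpM2r gg; rewrite exprn_ge0.
apply: le_trans h _; rewrite ler_nat; apply: subset_leq_card; apply/subsetP => w.
rewrite !in_set => /and3P[w1 w2 /forall_inP h]; apply/and3P; split=> //; apply/forall_inP => f /h /forallP p.
apply/forallP => j; have /existsP [z /andP[h1 h2]] := p j.
by apply/existsP; exists z; rewrite !PP.
Qed.

(** * Star rich sets at arbitrary density *)

Section LowClass.
Variables (R : realFieldType) (T : finType) (P : T -> T -> T -> bool).
Hypothesis pl : platin P.
Notation n := (#|T|%:R : R).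

(** With kap = eps^6 / 2^23, the path density of [many_paths] at density eps/2, this keeps m * eta
    below half of kap^(1+2m), so the union bound in [star_rich_intro] loses at most half. *)
Definition low_eta m (eps : R) := (eps ^+ 6 / 2 ^+ 23) ^+ (1 + m.*2) / (2 * (m%:R + 1)).
Definition low_gam m (eps : R) :=
  (eps ^+ 6 / 2 ^+ 23) ^+ (1 + m.*2) / 2 * (eps ^+ 3 * low_eta m eps / 2 ^+ 10) ^+ m.

Lemma shift_ok_link h x y : shift_ok P h x y -> exists z, P z x y.
Proof.
case/existsP=> u /existsP [v] /existsP [w] /and4P[/existsP [z /andP[h1 _]] _ _ _].
by exists z.
Qed.

(** Fix a change of apex from [popular_shift]. In the graph it preserves, [many_paths] gives sides
    X, Y whose edges serve as bases and whose 3-paths serve as routes. Every resulting closed 8-walk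
    is preserved, so few are unpopular, and edges in too many of those are deleted. The 4-cycles
    left are mostly popular and give back many octahedra by [twins_popular]. *)
Lemma low_class m (eps : R) : (0 < #|T|)%N -> 0 < eps -> eps <= 1 ->
  eps * n ^+ 5 <= #|twins P|%:R ->
  exists L : {set T * T}, [/\ forall x y, (x, y) \in L -> exists z, P z x y,
    eps ^+ 25 / 2 ^+ 101 * n ^+ 5 <= #|twins (fun z x y => P z x y && ((x, y) \in L))|%:R
  & star_rich P (fun x y => (x, y) \in L) (low_gam m eps) m].
Proof.
move=> T0 e0 e1 he; have n0 : 0 < n by rewrite ltr0n.
pose lam := eps ^+ 2 / 256.
have lam0 : 0 < lam by rewrite divr_gt0 ?exprn_gt0.
pose kap := eps ^+ 6 / 2 ^+ 23; have kap0 : 0 < kap by rewrite divr_gt0 ?exprn_gt0.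
have eX k : eps ^+ k <= 1 by rewrite exprn_ile1 // ltW.
have kap1 : kap <= 1.
  rewrite ler_pdivrMr ?exprn_gt0 // mul1r; apply: le_trans (eX 6%N) _.
  by rewrite exprn_ege1 // ler1n.
have kaplam : kap <= lam.
  have h : eps ^+ 6 <= eps ^+ 2 by apply: ler_wiXn2l => //; exact: ltW.
  rewrite /kap /lam (_ : 256 = 2 ^+ 8 :> R); last by rewrite -natrX.
  apply: ler_pM => //; rewrite ?exprn_ge0 ?invr_ge0 ?exprn_ge0 ?(ltW e0) //.
  by rewrite lef_pV2 ?posrE ?exprn_gt0 // ler_eXn2l // ltr1n.
set eta := low_eta m eps; have eta0 : 0 < eta.
  by rewrite divr_gt0 ?exprn_gt0 // mulr_gt0 // ltr_wpDl.
(* Chosen so that 4 * c8 / (eps * eta) = lam: Markov's inequality then removes at most lam n^2 of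
   the 2 lam n^2 edges of [B]. *)
pose c8 := eps ^+ 3 * eta / 2 ^+ 10.
pose c4 := eps * lam ^+ 4 / 8.
have c80 : 0 < c8 by apply: divr_gt0; [apply: mulr_gt0 => //|]; exact: exprn_gt0.
have c40 : 0 < c4 by apply: divr_gt0 => //; apply: mulr_gt0 => //; exact: exprn_gt0.
have [h [hG h4 h8]] := popular_shift pl T0 e0 c40 c80 he.
pose G : {set T * T} := [set p : T * T | shift_ok P h p.1 p.2].
have [X [Y [hXY hp]]] : exists X Y : {set T},
  (eps / 2) ^+ 2 / 32 * n ^+ 2 <= #|[set p in G | (p.1 \in X) && (p.2 \in Y)]|%:R /\
  forall x y, x \in X -> y \in Y -> (eps / 2) ^+ 6 / 2 ^+ 17 * n ^+ 2 <= #|path3 G x y|%:R.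
  by apply: many_paths => //; rewrite divr_gt0.
have kE : (eps / 2) ^+ 6 / 2 ^+ 17 = kap by rewrite /kap; field.
pose B := [set p in G | (p.1 \in X) && (p.2 \in Y)].
have lE : (eps / 2) ^+ 2 / 32 = 2 * lam by rewrite /lam; field.
rewrite lE -/B in hXY.
pose bad := bad_set P B (fun x b => path3 G x b.2) (fun y b => path3 G b.1 y) c8.
pose L := [set p in B | #|bad p.1 p.2|%:R <= eta * n ^+ 6].
have walkOK x y t : (x, y) \in G -> t \in bad x y ->
    walk8 x y t.1 t.2.1 t.2.2 \in unpopular P 8 c8 h.
  case: t => [b [p q]]; rewrite inE [_ \in bad_set _ _ _ _ _ _ _]in_set /=.
  rewrite inE => xy /and4P[]; rewrite !in_set => /andP[bG _] /and3P[p1 p2 p3] /and3P[q1 q2 q3] ->.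
  rewrite andbT; apply/forallP => -[[|[|[|[|[|[|[|[|j]]]]]]]] j8]; last (by []);
    by rewrite !ffunE.
have hL : lam * n ^+ 2 <= #|L|%:R.
  have BL : #|B|%:R = #|L|%:R + #|[set p in B | eta * n ^+ 6 < #|bad p.1 p.2|%:R]|%:R :> R.
    rewrite -natrD -(cardsID L B); congr (_ + _)%:R; apply: eq_card => p.
      by rewrite in_setI [p \in L]in_set andbA andbb.
    by rewrite in_setD in_set [p \in L]in_set negb_and -ltNge; case: (p \in B); rewrite ?andbF ?andbT.
  have bads : \sum_(p in B) #|bad p.1 p.2|%:R <= #|unpopular P 8 c8 h|%:R :> R.
    have := sum_set R (fun p : T * T => fun t => t \in bad p.1 p.2) B.
    under eq_bigr => p _ do rewrite cardsE.
    move=> ->; rewrite ler_nat.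
    pose g (u : (T * T) * ((T * T) * ((T * T) * (T * T)))) :=
      walk8 u.1.1 u.1.2 u.2.1 u.2.2.1 u.2.2.2.
    have ginj : injective g.
      move=> [[x y] [b [p q]]] [[x' y'] [b' [p' q']]] /walk8_inj /=.
      by case=> -> -> -> -> ->.
    rewrite -(card_imset _ ginj); apply: subset_leq_card; apply/subsetP => _ /imsetP [[[x y] t] + ->].
    rewrite in_set /= => /andP[+ tb]; rewrite in_set => /andP[xyG _]; exact: walkOK.
  have mk := @markov_card R _ B (fun p => #|bad p.1 p.2|%:R) (eta * n ^+ 6) (fun _ _ => ler0n _ _).
  have : #|[set p in B | eta * n ^+ 6 < #|bad p.1 p.2|%:R]|%:R <= lam * n ^+ 2.
    have p : 0 < eps * eta * n ^+ 6 by apply: mulr_gt0; [exact: mulr_gt0 | exact: exprn_gt0].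
    rewrite -(ler_pM2l p).
    have -> : eps * eta * n ^+ 6 * (lam * n ^+ 2) = 4 * c8 * n ^+ 8 by rewrite /lam /c8; field.
    apply: le_trans h8; apply: le_trans (ler_wpM2l (ltW e0) (le_trans mk bads)).
    by rewrite le_eqVlt; apply/orP; left; apply/eqP; ring.
  move: hXY; rewrite BL; lra.
have LG p : p \in L -> p \in G by rewrite !inE; case/andP=> /andP[].
exists L; split.
- by move=> x y /LG; rewrite inE => /shift_ok_link.
- have Lp x y : (x, y) \in L -> exists z, P z x y by move=> /LG; rewrite inE => /shift_ok_link.
  have := twins_popular pl Lp c40 T0.
  set W := popular_walks _ _ _ _; set t := #|twins _|%:R.
  have w4 := card_walks4 R (fun x y => (x, y) \in L).
  have WU : #|walks 4 (fun x y => (x, y) \in L)|%:R <= #|W|%:R + #|unpopular P 4 c4 h|%:R :> R.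
    rewrite -natrD ler_nat -(cardsID W (walks 4 _)) leq_add ?subset_leq_card ?subsetIr //.
    apply/subsetP => w; rewrite in_setD [w \in W]in_set => /andP[+ ww]; rewrite ww /= -ltNge in_set => ->.
    move: ww; rewrite in_set andbT => /forallP ww; apply/forallP => j.
    by have := LG _ (ww j); rewrite in_set.
  have hW : lam ^+ 4 / 2 * n ^+ 4 <= #|W|%:R.
    have l4 : lam ^+ 4 * n ^+ 4 <= #|walks 4 (fun x y => (x, y) \in L)|%:R.
      have p : 0 < n ^+ 4 by rewrite exprn_gt0.
      rewrite -(ler_pM2l p); apply: le_trans w4.
      have -> : n ^+ 4 * (lam ^+ 4 * n ^+ 4) = (lam * n ^+ 2) ^+ 4 by ring.
      have -> : #|[set p | (p.1, p.2) \in L]| = #|L| by apply: eq_card => -[x y]; rewrite inE.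
      apply: lerXn2r hL; rewrite nnegrE //; apply: mulr_ge0; [exact: ltW | exact: exprn_ge0].
    have u4 : #|unpopular P 4 c4 h|%:R <= lam ^+ 4 / 2 * n ^+ 4.
      rewrite -(ler_pM2l e0); apply: le_trans h4 _.
      rewrite le_eqVlt; apply/orP; left; apply/eqP; by rewrite /c4; field.
    lra.
  move=> tw; have p : 0 < n ^+ 3 by rewrite exprn_gt0.
  rewrite -(ler_pM2l p); apply: le_trans tw.
  have -> : n ^+ 3 * (eps ^+ 25 / 2 ^+ 101 * n ^+ 5) = c4 * (lam ^+ 4 / 2 * n ^+ 4) ^+ 2.
    by rewrite /c4 /lam; field.
  apply: ler_wpM2l; first exact: ltW.
  apply: lerXn2r hW; rewrite nnegrE //; apply: mulr_ge0; last exact: exprn_ge0.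
  by apply: divr_ge0 => //; apply: exprn_ge0; exact: ltW.
- have mE : m%:R * eta <= kap ^+ (1 + m.*2) / 2.
    rewrite /eta /low_eta -/kap; have k0 : 0 < kap ^+ (1 + m.*2) by rewrite exprn_gt0.
    rewrite mulrA ler_pdivrMr; last by rewrite mulr_gt0 // ltr_wpDl.
    have -> : kap ^+ (1 + m.*2) / 2 * (2 * (m%:R + 1)) = m%:R * kap ^+ (1 + m.*2) + kap ^+ (1 + m.*2) by field.
    by rewrite lerDl ltW.
  have k0 : 0 < kap ^+ (1 + m.*2) by rewrite exprn_gt0.
  have c81 : c8 <= 1.
    have et1 : eta <= 1.
      rewrite /eta /low_eta -/kap ler_pdivrMr; last by rewrite mulr_gt0 // ltr_wpDl.
      rewrite mul1r; apply: (@le_trans _ _ 1); first by rewrite exprn_ile1 // ltW.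
      have := ler0n R m; lra.
    rewrite ler_pdivrMr ?exprn_gt0 // mul1r; apply: (@le_trans _ _ (1 * 1)).
      by apply: ler_pM => //; rewrite ?exprn_ge0 // ltW.
    by rewrite mul1r exprn_ege1 // ler1n.
  apply: (@star_rich_intro R T P (fun x y => (x, y) \in L) B (fun x b => path3 G x b.2)
    (fun y b => path3 G b.1 y) kap eta c8 (ltW kap0) kap1 (ltW eta0) (ltW c80) c81).
  + apply: le_trans hXY; apply: ler_wpM2r; first by rewrite exprn_ge0 // ltW.
    by apply: le_trans kaplam _; lra.
  + move=> x y b; rewrite inE => /andP[]; rewrite inE => /and3P[_ xX _] _.
    by rewrite inE => /and3P[_ _ bY]; rewrite -kE; exact: hp.
  + move=> x y b; rewrite inE => /andP[]; rewrite inE => /and3P[_ _ yY] _.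
    by rewrite inE => /and3P[_ bX _]; rewrite -kE; exact: hp.
  + by move=> x y; rewrite inE => /andP[].
  + by rewrite subr_ge0; apply: le_trans mE _; lra.
  + rewrite /low_gam -/kap -/eta -/c8; apply: ler_wpM2r; first by rewrite exprn_ge0 // ltW.
    lra.
Qed.
End LowClass.

Section LowTower.
Variables (R : realFieldType) (T : finType) (m : nat).
Notation n := (#|T|%:R : R).

Definition low_step (e : R) := e ^+ 25 / 2 ^+ 101.

Lemma low_step_range (e : R) : 0 < e -> e <= 1 -> 0 < low_step e /\ low_step e <= e.
Proof.
move=> e0 e1; split; first by rewrite divr_gt0 ?exprn_gt0.
rewrite ler_pdivrMr ?exprn_gt0 //; apply: (@le_trans _ _ (e * 1)).
  by rewrite exprS; apply: ler_wpM2l; [exact: ltW | rewrite exprn_ile1 // ltW].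
by apply: ler_wpM2l; [exact: ltW | rewrite exprn_ege1 // ler1n].
Qed.

Lemma iter_low_step_range (e : R) k : 0 < e -> e <= 1 ->
  0 < iter k low_step e /\ iter k low_step e <= e.
Proof.
move=> e0 e1; elim: k => [//|k [h1 h2]] /=.
have [p1 p2] := low_step_range h1 (le_trans h2 e1).
by split=> //; exact: le_trans p2 h2.
Qed.

Definition low_gam_exp := (6 * (1 + m.*2) + m * (3 + 6 * (1 + m.*2)))%N.
Definition low_gam_den : R :=
  2 ^+ (23 * (1 + m.*2)) * 2 * (2 ^+ (23 * (1 + m.*2)) * (2 * (m%:R + 1)) * 2 ^+ 10) ^+ m.

Lemma low_gam_den_ge1 : 1 <= low_gam_den.
Proof.
have h k : 1 <= 2 ^+ k :> R by rewrite exprn_ege1 // ler1n.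
have m0 := ler0n R m.
apply: mulr_ege1; first by apply: mulr_ege1 => //; lra.
by apply: exprn_ege1; apply: mulr_ege1 => //; apply: mulr_ege1 => //; lra.
Qed.

(** Separating a power of e from a constant gives monotonicity and lets the loss be read as an
    exponent. *)
Lemma low_gamE (e : R) : low_gam m e = e ^+ low_gam_exp / low_gam_den.
Proof.
have m0 : m%:R + 1 != 0 :> R by rewrite lt0r_neq0 // ltr_wpDl.
rewrite /low_gam /low_eta /low_gam_exp /low_gam_den [e ^+ (_ + _)]exprD (mulnC m).
set j := (1 + m.*2)%N.
rewrite (exprM _ (3 + 6 * j) m) (exprD _ 3) !(exprM _ _ j) expr_div_n.
set X := (e ^+ 6) ^+ j; set D := (2 ^+ 23) ^+ j.
have D0 : D != 0 by rewrite lt0r_neq0 // !exprn_gt0.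
have -> : e ^+ 3 * (X / D / (2 * (m%:R + 1))) / 2 ^+ 10 =
    e ^+ 3 * X / (D * (2 * (m%:R + 1)) * 2 ^+ 10) by field; rewrite D0 m0.
rewrite expr_div_n; set Q := (D * _ * _) ^+ m.
have Q0 : Q != 0.
  apply: expf_neq0; apply: mulf_neq0; last by rewrite lt0r_neq0 // exprn_gt0.
  by apply: mulf_neq0 => //; apply: mulf_neq0 => //; rewrite pnatr_eq0.
by field; rewrite D0 Q0.
Qed.

Lemma low_gam_mono (e e' : R) : 0 <= e -> e <= e' -> low_gam m e <= low_gam m e'.
Proof.
move=> e0 ee; rewrite !low_gamE; apply: ler_wpM2r.
  by rewrite invr_ge0; apply: le_trans low_gam_den_ge1.
by apply: lerXn2r; rewrite ?nnegrE //; exact: le_trans ee.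
Qed.

Lemma low_gam_range (e : R) : 0 < e -> e <= 1 -> 0 < low_gam m e /\ low_gam m e <= 1.
Proof.
move=> e0 e1; have d1 := low_gam_den_ge1; have d0 := lt_le_trans ltr01 d1.
rewrite low_gamE; split; first by rewrite divr_gt0 ?exprn_gt0.
rewrite ler_pdivrMr // mul1r; apply: le_trans d1.
by rewrite exprn_ile1 // ltW.
Qed.

(** The three classes are treated in succession. Richness obtained for an earlier class survives,
    because it is kept when the smaller set shrinks and the larger one grows. *)
Lemma low_level (A : {set T * T * T}) (e : R) : latin A -> (0 < #|T|)%N -> 0 < e -> e <= 1 ->
  e * n ^+ 5 <= #|octs A|%:R ->
  exists L : {set T * T * T}, [/\ L \subset A, iter 3 low_step e * n ^+ 5 <= #|octs L|%:R
    & forall c, star_rich (view A c) (link_rel L c) (low_gam m (iter 3 low_step e)) m].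
Proof.
move=> lA T0 e0 e1 he.
have one c B e' : latin B -> 0 < e' -> e' <= 1 -> e' * n ^+ 5 <= #|octs B|%:R ->
    exists L : {set T * T * T}, [/\ L \subset B, low_step e' * n ^+ 5 <= #|octs L|%:R
      & star_rich (view B c) (link_rel L c) (low_gam m e') m].
  move=> lB e0' e1' he'; rewrite -(card_twins c lB) in he'.
  have [L [_ hL rich]] := low_class (view_latin c lB) m T0 e0' e1' he'.
  exists (restrict B c L); split; first exact: restrict_sub.
    by rewrite card_octs_restrict.
  by apply: star_rich_mono rich => // x y; exact: link_rel_restrict.
have [L1 [s1 h1 r1]] := one C0 A e lA e0 e1 he.
have [p1 q1] := iter_low_step_range 1 e0 e1.
have lL1 := latinS s1 lA.
have [L2 [s2 h2 r2]] := one C1 L1 _ lL1 p1 (le_trans q1 e1) h1.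
have [p2 q2] := iter_low_step_range 2 e0 e1.
have lL2 := latinS s2 lL1.
have [L3 [s3 h3 r3]] := one C2 L2 _ lL2 p2 (le_trans q2 e1) h2.
have [p3 q3] := low_step_range p2 (le_trans q2 e1).
have [_ q32] := low_step_range p1 (le_trans q1 e1).
exists L3; split=> //; first exact: fintype.subset_trans s3 (fintype.subset_trans s2 s1).
case.
- apply: star_rich_mono r1 => // [x y|]; last by apply: low_gam_mono (ltW p3) (iter_low_step_range 3 e0 e1).2.
  by apply: link_relS; exact: fintype.subset_trans s3 s2.
- apply: star_rich_mono r2 => [z x y|x y|]; last by apply: low_gam_mono (ltW p3) (le_trans q3 q32).
    exact: viewS.
  exact: link_relS.
- apply: star_rich_mono r3 => // [z x y|]; last by apply: low_gam_mono (ltW p3) q3.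
  by apply: viewS; exact: fintype.subset_trans s2 s1.
Qed.

Lemma low_tower k (A : {set T * T * T}) (e : R) : latin A -> (0 < #|T|)%N -> 0 < e -> e <= 1 ->
  e * n ^+ 5 <= #|octs A|%:R ->
  exists (L : {set T * T * T}) Gam, [/\ tower m A k L Gam, iter (3 * k) low_step e * n ^+ 5 <= #|octs L|%:R
    & low_gam m (iter (3 * k) low_step e) ^+ k <= Gam].
Proof.
move=> lA T0 e0 e1 he; elim: k => [|k [L [G [tw hL hG]]]].
  by exists A, 1; split=> //; exact: Tower0.
have [p q] := iter_low_step_range (3 * k) e0 e1.
have lL := latinS (tower_sub tw) lA.
have [L' [s h rich]] := low_level lL T0 p (le_trans q e1) hL.
rewrite -iterD -mulnS in h rich.
have [p' q'] := iter_low_step_range (3 * k.+1) e0 e1.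
have [g0 g1] := low_gam_range p' (le_trans q' e1).
exists L', (low_gam m (iter (3 * k.+1) low_step e) * G); split=> //.
  by apply: TowerS tw s _ g1 rich; exact: ltW.
rewrite exprS; apply: ler_wpM2l; first exact: ltW.
apply: le_trans hG; apply: lerXn2r.
- by rewrite nnegrE ltW.
- by rewrite nnegrE ltW //; have [] := low_gam_range p (le_trans q e1).
apply: low_gam_mono; first exact: ltW.
rewrite mulnS iterD.
by have [] := @iter_low_step_range (iter (3 * k) low_step e) 3 p (le_trans q e1).
Qed.
End LowTower.

(** * Star rich sets in nearly complete relations *)

Section HighClass.
Variables (R : realFieldType) (T : finType) (P : T -> T -> T -> bool).
Hypothesis pl : platin P.
Notation n := (#|T|%:R : R).

Definition broken := [set u : (T * T * T) * (T * T) | ~~ shift_ok P u.1 u.2.1 u.2.2].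

Lemma card_broken (eta : R) : (1 - eta) * n ^+ 5 <= #|twins P|%:R -> #|broken|%:R <= eta * n ^+ 5.
Proof.
move=> he; have := card_twins_le pl; set ok := [set t | _] => h.
have cok : #|ok|%:R + #|broken|%:R = n ^+ 5 :> R.
  have -> : broken = ~: ok by apply/setP => u; rewrite !in_set.
  by rewrite -natrD cardsC !card_prod !natrM; ring.
have : #|twins P|%:R <= #|ok|%:R :> R by rewrite ler_nat.
lra.
Qed.

Lemma card_broken_at (j : 'I_8) :
  (#|[set u : (T * T * T) * {ffun 'I_8 -> T} | ~~ shift_ok P u.1 (u.2 (evn j)) (u.2 (odn j))]|
   <= #|broken| * #|T| ^ 6)%N.
Proof.
have [t0 _|T0] := pickP (@predT T); last first.
  rewrite (eq_card0 (A := [set _ | _])) // => -[[[x y] z] w].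
  by have := T0 x.
set e := evn j; set o := odn j.
have eo : e != o by rewrite /e /o; case: j {e o} => [[|[|[|[|[|[|[|[|j]]]]]]]] ?].
pose D := ~: [set e; o].
have cD : #|D| = 6%N.
  by have := cardsC [set e; o]; rewrite cards2 eo card_ord -/D => -[].
pose r (w : {ffun 'I_8 -> T}) := [ffun i => if i \in D then w i else t0].
pose g (u : (T * T * T) * {ffun 'I_8 -> T}) := ((u.1, (u.2 e, u.2 o)), r u.2).
have ginj : injective g.
  move=> [h w] [h' w'] [-> we wo /ffunP rw]; congr pair; apply/ffunP => i.
  have := rw i; rewrite !ffunE /D in_setC in_set2.
  by have [->|_] := eqVneq i e => //=; have [->|_] := eqVneq i o.
rewrite -(card_imset _ ginj).
have -> : (#|broken| * #|T| ^ 6)%N = #|setX broken [set w | w \in pffun_on t0 (mem D) (@predT T)]|.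
  by rewrite cardsX [X in (_ = _ * X)%N]cardsE card_pffun_on; congr (_ * _ ^ _)%N; rewrite -[LHS]cD.
apply: subset_leq_card; apply/subsetP => _ /imsetP [[h w] + ->]; rewrite in_set /= => ho.
rewrite in_setX; apply/andP; split; first by rewrite in_set.
rewrite in_set; apply/pffun_onP; split=> //.
by apply/subsetP => i; rewrite inE ffunE; case: ifP => //; rewrite eqxx.
Qed.

Lemma high_class m (eta xi xi' : R) : (0 < #|T|)%N -> 0 < xi -> 0 < xi' -> xi' <= 1 ->
  m%:R * xi <= xi' -> (1 - eta) * n ^+ 5 <= #|twins P|%:R ->
  exists L : {set T * T}, xi * #|~: L|%:R <= 8 * eta * n ^+ 2 /\
    star_rich P (fun x y => (x, y) \in L) ((1 - m%:R * (xi / xi')) * (1 - xi') ^+ m) m.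
Proof.
move=> T0 xi0 xi'0 xi'1 mxi he; have n0 : 0 < n by rewrite ltr0n.
pose bad x y := [set u : (T * T * T) * ((T * T) * ((T * T) * (T * T))) |
  ~~ shift_walk P u.1 (walk8 x y u.2.1 u.2.2.1 u.2.2.2)].
pose L := [set p : T * T | #|bad p.1 p.2|%:R <= xi * n ^+ 9].
exists L; split.
  have sumb : \sum_(p in [set: T * T]) #|bad p.1 p.2|%:R <= 8 * eta * n ^+ 11.
    apply: (@le_trans _ _ (8 * (#|broken| * #|T| ^ 6)%:R)); last first.
      have := ler_wpM2r (exprn_ge0 6 (ltW n0)) (card_broken he); rewrite natrM natrX; lra.
    have := sum_set R (fun p : T * T => fun u => u \in bad p.1 p.2) [set: T * T].
    under eq_bigr => p _ do rewrite cardsE.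
    move=> ->.
    pose B j := [set u : (T * T * T) * {ffun 'I_8 -> T} |
      ~~ shift_ok P u.1 (u.2 (evn j)) (u.2 (odn j))].
    pose g (u : (T * T) * ((T * T * T) * ((T * T) * ((T * T) * (T * T))))) :=
      (u.2.1, walk8 u.1.1 u.1.2 u.2.2.1 u.2.2.2.1 u.2.2.2.2).
    have ginj : injective g.
      move=> [[x y] [h [b [p q]]]] [[x' y'] [h' [b' [p' q']]]] [/= -> /walk8_inj].
      by case=> -> -> -> -> ->.
    rewrite -natrM ler_nat -(card_imset _ ginj).
    apply: (@leq_trans #|\bigcup_j B j|).
      apply: subset_leq_card; apply/subsetP => _ /imsetP [[[x y] t] + ->].
      rewrite in_set /= => /andP[_]; rewrite in_set negb_forall => /existsP [j hj].
      by apply/bigcupP; exists j => //; rewrite in_set.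
    apply: leq_trans (card_bigcup_le _ _) _.
    apply: (@leq_trans (\sum_(j < 8) #|broken| * #|T| ^ 6)).
      by apply: leq_sum => j _; exact: card_broken_at.
    by rewrite sum_nat_const card_ord.
  have mk := @markov_card R _ [set: T * T] (fun p => #|bad p.1 p.2|%:R) (xi * n ^+ 9) (fun _ _ => ler0n _ _).
  have LE : [set p in [set: T * T] | xi * n ^+ 9 < #|bad p.1 p.2|%:R] = ~: L.
    by apply/setP => p; rewrite !in_set ltNge.
  rewrite LE in mk; have p : 0 < n ^+ 9 by rewrite exprn_gt0.
  rewrite -(ler_pM2r p).
  have -> : 8 * eta * n ^+ 2 * n ^+ 9 = 8 * eta * n ^+ 11 by ring.
  by apply: le_trans sumb; apply: le_trans mk; rewrite le_eqVlt; apply/orP; left; apply/eqP; ring.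
have q0 : 0 <= xi / xi' by rewrite divr_ge0 // ltW.
have d1 : m%:R * (xi / xi') <= 1 by rewrite mulrA ler_pdivrMr // mul1r.
apply: (@star_rich_intro R T P _ setT (fun _ _ => setT) (fun _ _ => setT) 1 (xi / xi') (1 - xi')) => //.
- by rewrite subr_ge0.
- by rewrite gerBl ltW.
- by rewrite cardsT card_prod natrM mul1r.
- by move=> x y b _ _; rewrite cardsT card_prod natrM mul1r.
- by move=> x y b _ _; rewrite cardsT card_prod natrM mul1r.
- move=> x y; rewrite in_set /= => hL; have p : 0 < xi' * n ^+ 3 by rewrite mulr_gt0 ?exprn_gt0.
  rewrite -(ler_pM2l p).
  have -> : xi' * n ^+ 3 * (xi / xi' * n ^+ 6) = xi * n ^+ 9.
    by field; rewrite lt0r_neq0.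
  apply: le_trans hL; set S := bad_set _ _ _ _ _ _ _.
  have st (t : (T * T) * ((T * T) * (T * T))) : t \in S -> xi' * n ^+ 3 <=
    #|[set h | ~~ shift_walk P h (walk8 x y t.1 t.2.1 t.2.2)]|%:R.
    rewrite in_set => /and4P[_ _ _ hp].
    have par (j : 'I_8) : ~~ odd (evn j) /\ odd (odn j) by rewrite evn_odd odn_odd.
    have hw := card_shift_walk pl (walk8 x y t.1 t.2.1 t.2.2) ord0 par.
    set ok := [set h | _] in hw; have -> : [set h | ~~ shift_walk P h (walk8 x y t.1 t.2.1 t.2.2)] = ~: ok.
      by apply/setP => h; rewrite !in_set.
    have ct : #|ok|%:R + #|~: ok|%:R = n ^+ 3 :> R.
      by rewrite -natrD cardsC !card_prod !natrM; ring.
    have : #|ok|%:R <= (1 - xi') * n * n ^+ 2.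
      apply: (@le_trans _ _ (#|partners P (walk8 x y t.1 t.2.1 t.2.2)| * #|T| ^ 2)%:R).
        by rewrite ler_nat.
      by rewrite natrM natrX; apply: ler_wpM2r; [rewrite exprn_ge0 | exact: ltW].
    rewrite -mulrA -exprS; lra.
  apply: (@le_trans _ _ (\sum_(t in S) #|[set h | ~~ shift_walk P h (walk8 x y t.1 t.2.1 t.2.2)]|%:R)).
    by rewrite mulr_natr -sumr_const; exact: ler_sum.
  rewrite (sum_set R (fun (t : (T * T) * ((T * T) * (T * T))) h => ~~ shift_walk P h (walk8 x y t.1 t.2.1 t.2.2)) S) ler_nat.
  pose sw (u : ((T * T) * ((T * T) * (T * T))) * (T * T * T)) := (u.2, u.1).
  have swi : injective sw by move=> [a b] [a' b'] [-> ->].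
  rewrite -(card_imset _ swi); apply: subset_leq_card; apply/subsetP => _ /imsetP [[t h] + ->].
  by rewrite !in_set => /andP[].
- by rewrite expr1n subr_ge0.
- by rewrite expr1n.
Qed.
End HighClass.

Lemma bernoulli (R : realFieldType) (x : R) k : 0 <= x -> x <= 1 -> 1 - k%:R * x <= (1 - x) ^+ k.
Proof.
move=> x0 x1; elim: k => [|k IH]; first by rewrite mul0r subr0 expr0.
have h : 0 <= 1 - x by rewrite subr_ge0.
rewrite exprS; apply: le_trans (ler_wpM2l h IH); rewrite -natr1.
have : 0 <= k%:R * x * x by rewrite !mulr_ge0.
lra.
Qed.

Section HighTower.
Variables (R : realFieldType) (T : finType) (m : nat) (xi xi' : R).
Hypotheses (T0 : (0 < #|T|)%N) (xi0 : 0 < xi) (xi1 : xi <= 1) (xi'0 : 0 < xi') (xi'1 : xi' <= 1).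
Hypothesis mxi : m%:R * xi <= xi'.
Notation n := (#|T|%:R : R).

Definition high_gam := (1 - m%:R * (xi / xi')) * (1 - xi') ^+ m.

Lemma link_pair_inj (A : {set T * T * T}) c : latin A -> {in A &, injective (@link_pair T c)}.
Proof.
move=> [l0 l1 l2] [[a b] d] [[a' b'] d']; case: c => /= h h' [e1 e2]; subst.
- by rewrite (l2 _ _ _ _ h h').
- by rewrite (l1 _ _ _ _ h h').
- by rewrite (l0 _ _ _ _ h h').
Qed.

(** The three classes lose at most (24/xi) eta n^2 faces together, each costing up to 8 n^3
    octahedra. With the eta missing before, at most eta/xi, this is 8 * 24 + 1 = 193. *)
Lemma high_level (A : {set T * T * T}) (eta : R) : latin A -> 0 <= eta ->
  (1 - eta) * n ^+ 5 <= #|octs A|%:R ->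
  exists L : {set T * T * T}, [/\ L \subset A, (1 - 193 / xi * eta) * n ^+ 5 <= #|octs L|%:R
    & forall c, star_rich (view A c) (link_rel L c) high_gam m].
Proof.
move=> lA eta0 he.
have one c : exists L : {set T * T}, xi * #|~: L|%:R <= 8 * eta * n ^+ 2 /\
    star_rich (view A c) (fun x y => (x, y) \in L) high_gam m.
  by apply: high_class => //; [exact: view_latin | rewrite card_twins].
have [L0 [h0 r0]] := one C0; have [L1 [h1 r1]] := one C1; have [L2 [h2 r2]] := one C2.
pose L := restrict (restrict (restrict A C0 L0) C1 L1) C2 L2.
have LE t : (t \in L) = [&& t \in A, link_pair C0 t \in L0, link_pair C1 t \in L1 & link_pair C2 t \in L2].
  by rewrite !in_set -!andbA.
have LA : L \subset A by apply/subsetP => t; rewrite LE => /and4P[].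
exists L; split=> //; last first.
  have key c (L' : {set T * T}) : (forall t, t \in L -> link_pair c t \in L') ->
      forall x y, link_rel L c x y -> (x, y) \in L'.
    by move=> h x y /existsP [z]; case: c h => h /h.
  case.
  - by apply: star_rich_mono r0 => //; apply: key => t; rewrite LE => /and4P[].
  - by apply: star_rich_mono r1 => //; apply: key => t; rewrite LE => /and4P[].
  - by apply: star_rich_mono r2 => //; apply: key => t; rewrite LE => /and4P[].
have cD : (#|A :\: L| <= #|~: L0| + #|~: L1| + #|~: L2|)%N.
  pose Z c (L' : {set T * T}) := [set t in A | link_pair c t \notin L'].
  have cZ c L' : (#|Z c L'| <= #|~: L'|)%N.
    rewrite -(card_in_imset (f := @link_pair T c)); last first.
      move=> t t'; rewrite !in_set => /andP[tA _] /andP[tA' _]; exact: link_pair_inj lA _ _ tA tA'.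
    apply: subset_leq_card; apply/subsetP => _ /imsetP [t + ->].
    by rewrite in_set => /andP[_ h]; rewrite in_setC.
  have s : A :\: L \subset Z C0 L0 :|: Z C1 L1 :|: Z C2 L2.
    apply/subsetP => t; rewrite in_setD LE => /andP[+ tA]; rewrite tA /= !negb_and.
    by rewrite !in_setU !in_set tA /= orbA.
  apply: leq_trans (subset_leq_card s) _.
  apply: leq_trans (_ : #|Z C0 L0| + #|Z C1 L1| + #|Z C2 L2| <= _)%N; last by rewrite !leq_add.
  by rewrite cardsU (leq_trans (leq_subr _ _)) // leq_add2r cardsU leq_subr.
have := card_octs_sub L lA; rewrite -(ler_nat R) natrD natrM natrX natrM => ho.
move: cD; rewrite -(ler_nat R) !natrD => cD.
have D1 : xi * #|A :\: L|%:R <= 24 * eta * n ^+ 2.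
  by have := ler_wpM2l (ltW xi0) cD; lra.
have D2 : #|A :\: L|%:R <= 24 / xi * eta * n ^+ 2.
  rewrite -(ler_pM2l xi0); apply: le_trans D1 _.
  by rewrite le_eqVlt; apply/orP; left; apply/eqP; field; rewrite lt0r_neq0.
have D3 := ler_wpM2r (exprn_ge0 3 (ler0n R #|T|)) D2.
have x1 : 1 <= xi^-1 by rewrite invf_ge1.
have e5 : 0 <= eta * n ^+ 5 by rewrite mulr_ge0 // exprn_ge0.
have := ler_wpM2r e5 x1; rewrite mul1r; lra.
Qed.

Lemma high_gam_range : 0 <= high_gam /\ high_gam <= 1.
Proof.
have q0 : 0 <= xi / xi' by rewrite divr_ge0 // ltW.
have d1 : m%:R * (xi / xi') <= 1 by rewrite mulrA ler_pdivrMr // mul1r.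
have d0 : 0 <= m%:R * (xi / xi') by rewrite mulr_ge0.
have x0 : 0 <= 1 - xi' by rewrite subr_ge0.
have x1 : 1 - xi' <= 1 by rewrite gerBl ltW.
split; first by rewrite mulr_ge0 ?exprn_ge0 ?subr_ge0.
by rewrite mulr_ile1 ?exprn_ge0 ?subr_ge0 ?gerBl ?exprn_ile1.
Qed.

Lemma high_tower k (A : {set T * T * T}) (eta : R) : latin A -> 0 <= eta ->
  (1 - eta) * n ^+ 5 <= #|octs A|%:R ->
  exists L : {set T * T * T}, tower m A k L (high_gam ^+ k) /\
    (1 - (193 / xi) ^+ k * eta) * n ^+ 5 <= #|octs L|%:R.
Proof.
move=> lA eta0 he; elim: k => [|k [L [tw hL]]].
  by exists A; rewrite expr0 mul1r; split=> //; exact: Tower0.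
have lL := latinS (tower_sub tw) lA.
have e0 : 0 <= (193 / xi) ^+ k * eta.
  by rewrite mulr_ge0 // exprn_ge0 // divr_ge0 // ltW.
have [L' [s h rich]] := high_level lL e0 hL.
have [g0 g1] := high_gam_range.
exists L'; split; first by rewrite exprS; exact: TowerS tw s g0 g1 rich.
by rewrite exprS -mulrA.
Qed.
End HighTower.

(* The constants make each factor [1 - m * (xi / xi')] and [(1 - xi') ^+ m] of *)
(* [high_gam] at least [1 - 1 / (8 * k)].                                      *)
Lemma high_tower_choice (R : realFieldType) (T : finType) m k (A : {set T * T * T}) (eta : R) :
  (0 < #|T|)%N -> (0 < m)%N -> (0 < k)%N -> latin A -> 0 <= eta ->
  (1 - eta) * #|T|%:R ^+ 5 <= #|octs A|%:R ->
  exists (L : {set T * T * T}) (Gam : R), [/\ tower m A k L Gam, 1 / 2 < Gam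
    & (1 - ((193 * 64 * m ^ 2 * k ^ 2) ^ k)%:R * eta) * #|T|%:R ^+ 5 <= #|octs L|%:R].
Proof.
move=> T0 m0 k0 lA eta0 he; pose mr := m%:R : R; pose kr := k%:R : R.
have mp : 1 <= mr by rewrite ler1n.
have kp : 1 <= kr by rewrite ler1n.
have mp0 : 0 < mr by apply: lt_le_trans mp.
have kp0 : 0 < kr by apply: lt_le_trans kp.
pose xi := (64 * mr ^+ 2 * kr ^+ 2)^-1; pose xi' := (8 * mr * kr)^-1.
have mk : 1 <= mr * kr by exact: mulr_ege1.
have p8 : 0 < 8 * mr * kr by lra.
have p64 : 0 < 64 * mr ^+ 2 * kr ^+ 2 by rewrite !mulr_gt0 ?exprn_gt0.
have xi0 : 0 < xi by rewrite invr_gt0.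
have xi'0 : 0 < xi' by rewrite invr_gt0.
have xi'1 : xi' <= 1 by rewrite invf_le1 //; lra.
have xi1 : xi <= 1.
  rewrite invf_le1 //; have -> : 64 * mr ^+ 2 * kr ^+ 2 = 64 * (mr * kr) ^+ 2 by ring.
  have : 1 <= (mr * kr) ^+ 2 by rewrite exprn_ege1.
  lra.
have mn0 : mr != 0 by rewrite lt0r_neq0.
have kn0 : kr != 0 by rewrite lt0r_neq0.
have qE : mr * (xi / xi') = (8 * kr)^-1 by rewrite /xi /xi'; field; rewrite ?mn0 ?kn0.
have sE : mr * xi' = (8 * kr)^-1 by rewrite /xi'; field; rewrite ?mn0 ?kn0.
pose u := (8 * kr)^-1.
have u0 : 0 < u by rewrite invr_gt0; lra.
have ku : kr * u = 1 / 8 by rewrite /u; field.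
have u1 : u <= 1 by rewrite invf_le1; lra.
have mxi : m%:R * xi <= xi' by rewrite -[X in _ <= X]mul1r -ler_pdivrMr // -mulrA qE.
have [L [tw hL]] := high_tower T0 xi0 xi1 xi'0 xi'1 mxi k lA eta0 he.
exists L, (high_gam m xi xi' ^+ k); split=> //.
- have [g0 g1] := high_gam_range xi0 xi'0 xi'1 mxi.
  have g : 1 - 2 * u <= high_gam m xi xi'.
    rewrite /high_gam -/mr qE -/u.
    have b := bernoulli m (ltW xi'0) xi'1; rewrite -/mr sE -/u in b.
    have p : 0 <= 1 - u by rewrite subr_ge0.
    apply: le_trans (ler_wpM2l p b); have := sqr_ge0 u; rewrite expr2; lra.
  have u2 : 2 * u <= 1.
    have : kr * u <= kr * 1 by rewrite ku; lra.
    have : 1 * u <= kr * u by rewrite ler_pM2r.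
    rewrite ku; lra.
  have u20 : 0 <= 2 * u by lra.
  have b := bernoulli k u20 u2.
  have le : (1 - 2 * u) ^+ k <= high_gam m xi xi' ^+ k by rewrite lerXn2r // nnegrE // subr_ge0.
  apply: lt_le_trans le; apply: lt_le_trans b.
  have -> : k%:R * (2 * u) = 2 * (kr * u) by rewrite /kr; ring.
  rewrite ku; lra.
- have -> : ((193 * 64 * m ^ 2 * k ^ 2) ^ k)%:R = (193 / xi) ^+ k :> R; last by [].
  by rewrite natrX /xi invrK !natrM -/mr -/kr; congr (_ ^+ _); ring.
Qed.

(** * Exponents *)

Section Regimes.
Variable R : realFieldType.

Lemma expr_1subr_le (x : R) N : 0 <= x -> x <= 1 -> (1 - x) ^+ N * (1 + N%:R * x) <= 1.
Proof.
move=> x0 x1; have x10 : 0 <= 1 - x by rewrite subr_ge0.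
elim: N => [|N IH]; first by rewrite expr0 mul0r addr0 mulr1.
apply: le_trans IH; rewrite exprSr -mulrA; apply: ler_wpM2l; first exact: exprn_ge0.
rewrite -natr1; have : 0 <= (N%:R + 1) * x * x by rewrite !mulr_ge0 // addr_ge0.
lra.
Qed.

(** The left side is at most 1/(1 + N eta), and (1 + 2 Q eta)(1 - Q eta) is at least 1 as long as Q
    eta is at most 1/2. *)
Lemma high_exponent (eta : R) Q N : 0 <= eta -> eta <= 1 -> Q%:R * eta <= 1 / 2 ->
  (2 * Q <= N)%N -> (1 - eta) ^+ N <= 1 - Q%:R * eta.
Proof.
move=> e0 e1 Qe QN; have := expr_1subr_le N e0 e1.
have QN' : 2 * Q%:R <= N%:R :> R by rewrite -natrM ler_nat.
have p : 0 < 1 + N%:R * eta by rewrite ltr_pwDl // mulr_ge0.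
move=> h; rewrite -(ler_pM2r p); apply: le_trans h _.
have ne : 0 <= N%:R * eta by rewrite mulr_ge0.
have h1 := ler_wpM2r ne Qe; have h2 := ler_wpM2r e0 QN'.
lra.
Qed.

Lemma low_exponent (eps : R) Q : 0 < eps -> eps <= 1 -> 1 / 2 < Q%:R * (1 - eps) ->
  eps ^+ (2 * Q) <= 1 / 2.
Proof.
move=> e0 e1 h; have x0 : 0 <= 1 - eps by rewrite subr_ge0.
have x1 : 1 - eps <= 1 by rewrite gerBl ltW.
have := expr_1subr_le (2 * Q) x0 x1; rewrite subKr natrM => h1.
have p : 0 <= eps ^+ (2 * Q) by rewrite exprn_ge0 // ltW.
have h2 := ler_wpM2l p (ltW h); lra.
Qed.
End Regimes.

Section LowExponents.
Variables (R : realFieldType) (eps : R) (N : nat).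
Hypotheses (e0 : 0 < eps) (e1 : eps <= 1) (N0 : (0 < N)%N) (hN : eps ^+ N <= 1 / 2).

Lemma expr_eps_le a c : (a <= c)%N -> eps ^+ c <= eps ^+ a.
Proof. by apply: ler_wiXn2l => //; exact: ltW. Qed.

(** The device that pays for absolute constants: each factor 2 costs [N] in the exponent of
    [eps]. *)
Lemma pow2_eps k : eps ^+ (N * k) * 2 ^+ k <= 1.
Proof.
rewrite exprM -exprMn; apply: exprn_ile1; first by rewrite mulr_ge0 // exprn_ge0 // ltW.
by rewrite -ler_pdivlMr.
Qed.

Lemma iter_low_step_ge j : eps ^+ (25 ^ j * (6 * N)) <= iter j (@low_step R) eps.
Proof.
(* The slack 5 N closes the induction: one step costs 25 a + 101 N, and 101 + 5 is at most 25 *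
   5. *)
suff [a ha h] : exists2 a, (a + 5 * N <= 25 ^ j * (6 * N))%N & eps ^+ a <= iter j (@low_step R) eps.
  by apply: le_trans h; apply: expr_eps_le; apply: leq_trans ha; exact: leq_addr.
elim: j => [|j [a ha h]].
  by exists N; [lia | rewrite -[X in _ <= X]expr1; apply: expr_eps_le].
exists (25 * a + N * 101)%N; first by rewrite expnS; move: ha; move: (25 ^ j)%N => t; lia.
rewrite /= /low_step ler_pdivlMr ?exprn_gt0 // exprD mulnC exprM -mulrA.
apply: (@le_trans _ _ ((eps ^+ a) ^+ 25 * 1)).
  by apply: ler_wpM2l; [rewrite !exprn_ge0 // ltW | exact: pow2_eps].
rewrite mulr1; apply: lerXn2r => //; rewrite nnegrE; first by rewrite exprn_ge0 // ltW.
by apply: le_trans h; rewrite exprn_ge0 // ltW.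
Qed.

Lemma low_gam_den_le m : (0 < m)%N -> low_gam_den R m <= 2 ^+ (151 * m ^ 2).
Proof.
move=> m0; have mm : m%:R + 1 <= 2 ^+ m :> R.
  by rewrite natr1 -natrX ler_nat ltn_expl.
have g k : 1 <= 2 ^+ k :> R by rewrite exprn_ege1 // ler1n.
apply: (@le_trans _ _ (2 ^+ (23 * (1 + m.*2) + 1 + (23 * (1 + m.*2) + (1 + m) + 10) * m))).
  rewrite /low_gam_den; move: (23 * _)%N => j.
  rewrite (exprD _ (j + 1)) (exprD _ j 1) expr1 exprM (exprD _ (j + _)) (exprD _ j) (exprD _ 1 m) expr1.
  set D := 2 ^+ j.
  have D0 : 0 <= D by apply: le_trans (g _).
  apply: ler_wpM2l; first by rewrite mulr_ge0.
  have i0 : 0 <= 2 * (m%:R + 1) :> R by rewrite mulr_ge0 // addr_ge0.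
  have p k : 0 <= 2 ^+ k :> R by rewrite exprn_ge0.
  apply: lerXn2r.
  - by rewrite nnegrE; apply: mulr_ge0 => //; exact: mulr_ge0.
  - by rewrite nnegrE; apply: mulr_ge0 => //; apply: mulr_ge0 => //; exact: mulr_ge0.
  apply: ler_wpM2r; first by rewrite exprn_ge0.
  by apply: ler_wpM2l => //; apply: ler_wpM2l.
apply: ler_weXn2l; first by rewrite ler1n.
by rewrite -mulnn; nia.
Qed.

Lemma low_gam_ge m a e : (0 < m)%N -> eps ^+ a <= e ->
  eps ^+ (a * low_gam_exp m + N * (151 * m ^ 2)) <= low_gam m e.
Proof.
move=> m0 ae; rewrite low_gamE; have d1 := low_gam_den_ge1 R m.
rewrite ler_pdivlMr ?(lt_le_trans ltr01) // exprD exprM -mulrA.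
have p k : 0 <= eps ^+ k by rewrite exprn_ge0 // ltW.
apply: (@le_trans _ _ ((eps ^+ a) ^+ low_gam_exp m * 1)).
  apply: ler_wpM2l; first by rewrite exprn_ge0.
  by apply: le_trans (pow2_eps (151 * m ^ 2)); apply: ler_wpM2l (low_gam_den_le m0).
by rewrite mulr1; apply: lerXn2r => //; rewrite nnegrE //; exact: le_trans ae.
Qed.
End LowExponents.

(** The total is at most 195 A k m^2, and 8 <= b^2 turns the powers of 2 into powers of b. This
    gives b^(19 + 32 k), where 2 k is at most b - 1. *)
Lemma exponent_bound b k m Q A : (3 <= b)%N -> k = (b.-1)./2 -> m = (64 * b)%N ->
  Q = ((193 * 64 * m ^ 2 * k ^ 2) ^ k)%N -> A = (25 ^ (3 * k) * (6 * (2 * Q)))%N ->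
  (2 * Q <= A /\
   A + 3 * (k * (A * low_gam_exp m + 2 * Q * (151 * m ^ 2)) + 2 * Q * (6 * b ^ 2 + 1)) <= b ^ (25 * b))%N.
Proof.
move=> b3 kE mE QE AE.
have k0 : (0 < k)%N by rewrite kE; lia.
have kb : (2 * k <= b.-1)%N by rewrite kE; lia.
have A12 : (12 * Q <= A)%N.
  have : (0 < 25 ^ (3 * k))%N by rewrite expn_gt0.
  by rewrite AE; move: (25 ^ _)%N => t; nia.
split; first by clear -A12; lia.
have step1 : (A + 3 * (k * (A * low_gam_exp m + 2 * Q * (151 * m ^ 2)) + 2 * Q * (6 * b ^ 2 + 1))
   <= 195 * A * (k * m ^ 2))%N.
  have m0 : (0 < m)%N by rewrite mE; lia.
  have E39 : (low_gam_exp m <= 39 * m ^ 2)%N by rewrite /low_gam_exp -mulnn; clear -m0; nia.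
  have X1 : (1 <= k * m ^ 2)%N by rewrite muln_gt0 k0 expn_gt0 m0.
  have X2 : (6 * (6 * b ^ 2 + 1) <= k * m ^ 2)%N.
    apply: (@leq_trans (1 * m ^ 2)); last by rewrite leq_mul2r k0 orbT.
    by rewrite mE expnMn mul1n (_ : 64 ^ 2 = 4096)%N // -!mulnn; clear -b3; nia.
  have h1 : (k * low_gam_exp m <= 39 * (k * m ^ 2))%N.
    by rewrite mulnCA leq_mul2l E39 orbT.
  set X := (k * m ^ 2)%N in X1 X2 h1 *.
  have -> : (A + 3 * (k * (A * low_gam_exp m + 2 * Q * (151 * m ^ 2)) + 2 * Q * (6 * b ^ 2 + 1)) =
     A + 3 * (A * (k * low_gam_exp m)) + 906 * (Q * X) + Q * (6 * (6 * b ^ 2 + 1)))%N.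
    by rewrite /X; ring.
  have h2 : (A * (k * low_gam_exp m) <= 39 * (A * X))%N by rewrite [X in (_ <= X)%N]mulnCA leq_mul2l h1 orbT.
  have h3 : (12 * (Q * X) <= A * X)%N by rewrite mulnA leq_mul2r A12 orbT.
  have h4 : (Q * (6 * (6 * b ^ 2 + 1)) <= Q * X)%N by rewrite leq_mul2l X2 orbT.
  have h5 : (A <= A * X)%N by rewrite leq_pmulr.
  move: h2 h3 h4 h5; rewrite -mulnA; move: (A * (k * low_gam_exp m))%N (A * X)%N (Q * X)%N.
  by move: (Q * (6 * _))%N; clear; lia.
apply: leq_trans step1 _.
have b8 : (2 ^ 3 <= b ^ 2)%N by rewrite -mulnn; nia.
have pw j : (2 ^ (3 * j) <= b ^ (2 * j))%N by rewrite !expnM; case: j => // j; rewrite leq_exp2r.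
have kb' : (k <= b)%N by clear -kb; lia.
apply: (@leq_trans (2 ^ 24 * b ^ 3 * (2 ^ 42 * b ^ 4) ^ k)).
  have -> : (195 * A * (k * m ^ 2) = (195 * 12 * 64 ^ 2 * (k * b ^ 2)) * (25 ^ 3 * (193 * 64 * (64 ^ 2 * b ^ 2) * k ^ 2)) ^ k)%N.
    rewrite -(expnMn 64 b 2) (expnMn (25 ^ 3)) -expnM -mE -QE AE mE expnMn.
    by move: (64 ^ 2)%N (b ^ 2)%N (25 ^ _)%N => x y z; ring.
  apply: leq_mul.
    rewrite (expnSr b 2) (mulnC (b ^ 2)%N); apply: leq_mul; last by rewrite leq_mul2r kb' orbT.
    have -> : (2 ^ 24 = 2 ^ 8 * 2 ^ 4 * (2 ^ 6) ^ 2)%N by rewrite -expnM -!expnD.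
    by apply: leq_mul; [apply: leq_mul | rewrite leq_exp2r].
  rewrite leq_exp2r //.
  have -> : (25 ^ 3 * (193 * 64 * (64 ^ 2 * b ^ 2) * k ^ 2) = (25 ^ 3 * 193 * 64 ^ 3) * (b ^ 2 * k ^ 2))%N by ring.
  apply: leq_mul; last by rewrite (expnD b 2 2) leq_mul2l leq_exp2r ?kb' ?orbT.
  apply: (@leq_trans ((2 ^ 5) ^ 3 * 2 ^ 8 * (2 ^ 6) ^ 3)).
    by apply: leq_mul; [apply: leq_mul; rewrite ?leq_exp2r | rewrite leq_exp2r].
  by rewrite -!expnM -!expnD leq_exp2l.
apply: (@leq_trans (b ^ 16 * b ^ 3 * (b ^ 28 * b ^ 4) ^ k)).
  apply: leq_mul; first by rewrite leq_mul2r (pw 8%N) orbT.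
  by rewrite leq_exp2r // leq_mul2r (pw 14%N) orbT.
rewrite -!expnD -expnM -expnD leq_exp2l; last by lia.
by clear -kb b3; lia.
Qed.

(** * The dense and the sparse case *)

Section Main.
Variables (R : realFieldType) (b : nat) (T : finType) (A : {set T * T * T}) (eps : R).
Hypotheses (b3 : (3 <= b)%N) (T0 : (0 < #|T|)%N) (lA : latin A).
Hypotheses (e0 : 0 < eps) (e1 : eps <= 1).
Notation n := (#|T|%:R : R).
Hypothesis hA : eps * n ^+ 5 <= #|octs A|%:R.

(** [k] bounds the number of interior vertices of a disc with fewer than [b] faces. [m] makes 512 F
    at most 8 m, as [tower_bound] asks of the weight. [Q] is the factor by which [high_tower_choice]
    multiplies the defect 1 - eps. *)
Let k := (b.-1)./2.
Let m := (64 * b)%N.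
Let Q := ((193 * 64 * m ^ 2 * k ^ 2) ^ k)%N.

Let k0 : (0 < k)%N. Proof. by rewrite /k; lia. Qed.
Let m0 : (0 < m)%N. Proof. by rewrite /m; lia. Qed.
Let bk : (b <= k.*2.+2)%N. Proof. by rewrite /k; lia. Qed.
Let Q0 : (0 < Q)%N.
Proof. by rewrite /Q; move: k0 m0; move: (k) (m) => x y x0 y0; rewrite expn_gt0 !muln_gt0 x0 y0. Qed.

Lemma card_octs_density (L : {set T * T * T}) (a : R) : latin L ->
  a * n ^+ 5 <= #|octs L|%:R -> a * n ^+ 2 <= #|L|%:R.
Proof.
move=> lL h; have p : 0 < n ^+ 3 by rewrite exprn_gt0 // ltr0n.
rewrite -(ler_pM2r p) -mulrA -exprD; apply: le_trans h _.
by rewrite -natrX -natrM ler_nat card_octs_le.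
Qed.

(** If z and z' were distinct, then z' and the folded copy z would be two labels, while [Gam] > 1/2
    allows fewer than two. The top of the tower itself has no conflict. *)
Lemma dense_case : Q%:R * (1 - eps) <= 1 / 2 ->
  exists F : {set T * T * T}, [/\ F \subset A, eps ^+ (b ^ (25 * b)) * n ^+ 2 <= #|F|%:R
    & forall s : pattern b, disc_pattern s -> forall z z', copy s F z z' -> z = z'].
Proof.
move=> hQ; have x0 : 0 <= 1 - eps by rewrite subr_ge0.
have x1 : 1 - eps <= 1 by rewrite gerBl ltW.
have h : (1 - (1 - eps)) * n ^+ 5 <= #|octs A|%:R by rewrite subKr.
have [L [Gam [tw hG hL]]] := high_tower_choice T0 m0 k0 lA x0 h.
have lL := latinS (tower_sub tw) lA.
exists L; split; first exact: tower_sub tw.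
  apply: le_trans (card_octs_density lL hL); apply: ler_wpM2r; first by rewrite exprn_ge0.
  rewrite -/Q; have [QA AM] := @exponent_bound b k m Q _ b3 erefl erefl erefl erefl.
  have := @high_exponent R (1 - eps) Q (b ^ (25 * b)) x0 x1 hQ; rewrite subKr; apply.
  by apply: leq_trans QA _; apply: leq_trans AM; exact: leq_addr.
move=> s ds z z' c; apply: contraTeq isT => zz'.
have := card_copies z lA tw (leqnn m) bk ds; rewrite leNgt => /negP[].
have : (2 <= #|[set y | copy s L z y]|)%N.
  have -> : 2%N = #|[set z; z']| by rewrite cards2 zz'.
  by apply: subset_leq_card; apply/subsetP => y; rewrite !inE => /orP[] /eqP -> //; exact: copy_diag c.
rewrite -(ler_nat R) => h2; have G0 : 0 <= Gam by lra.
have := ler_wpM2r G0 h2; lra.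
Qed.

(** Two labels conflict if some disc pattern joins them in the top of the tower. Each pattern
    contributes at most 1/[Gam] to a degree, there are at most 2^(6 b^2) patterns, and
    [conflict_free] removes all conflicts at the cost of the cube of the degree. *)
Lemma sparse_case : 1 / 2 < Q%:R * (1 - eps) ->
  exists F : {set T * T * T}, [/\ F \subset A, eps ^+ (b ^ (25 * b)) * n ^+ 2 <= #|F|%:R
    & forall s : pattern b, disc_pattern s -> forall z z', copy s F z z' -> z = z'].
Proof.
move=> hQ; pose N := (2 * Q)%N.
have hN : eps ^+ N <= 1 / 2 by exact: low_exponent.
have N0 : (0 < N)%N by rewrite muln_gt0 Q0.
have [L [Gam [tw hL hG]]] := low_tower m k lA T0 e0 e1 hA.
have lL := latinS (tower_sub tw) lA.
set e := iter (3 * k) (@low_step R) eps in hL hG.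
pose a := (25 ^ (3 * k) * (6 * N))%N.
have he : eps ^+ a <= e by exact: iter_low_step_ge.
have eX j : 0 < eps ^+ j by exact: exprn_gt0.
have eX0 j : 0 <= eps ^+ j by exact: ltW.
pose g := (k * (a * low_gam_exp m + N * (151 * m ^ 2)))%N.
have hg : eps ^+ g <= Gam.
  apply: le_trans hG; rewrite /g mulnC exprM; have hl := low_gam_ge e0 e1 N0 hN m0 he.
  apply: lerXn2r => //; rewrite nnegrE //.
  exact: le_trans hl.
have G0 : 0 < Gam by apply: lt_le_trans hg.
pose adj c : rel T := fun z z' => [exists s : pattern b,
  [&& `[< disc_pattern s >], s.2.1 == c & copy s L z z']].
have adj_sym c : symmetric (adj c).
  move=> z z'; apply/existsP/existsP => -[s /and3P[/asboolP ds /eqP sc cs]];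
  exists (s.1, (s.2.1, (s.2.2.2, s.2.2.1))); apply/and3P; split;
    by [apply/asboolP; exact: disc_pattern_swap | apply/eqP | exact: copy_swap].
pose deg (cz : cls * T) := #|[set z' | adj cz.1 cz.2 z']|.
pose M := (\max_cz deg cz)%N.
have cC : (#|{: pattern b}| <= 2 ^ (6 * b ^ 2))%N.
  rewrite !card_prod card_ffun card_bool !card_prod card_ord.
  have -> : #|{: cls}| = 3 by rewrite -sum1_card big_cls.
  have -> : (3 * (b * b) = 3 * b ^ 2)%N by rewrite mulnn.
  rewrite (_ : 6 * b ^ 2 = 3 * b ^ 2 + 3 * b ^ 2)%N; last by rewrite -mulnDl.
  by rewrite expnD leq_mul2l; apply/orP; right; exact/ltnW/ltn_expl.
have hM : M%:R * Gam <= #|{: pattern b}|%:R.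
  have [t0 _] := card_gt0P T0.
  have [|[c z] Mz] := @bigop.eq_bigmax _ deg; first by apply/card_gt0P; exists (C0, t0).
  rewrite /M Mz.
  apply: (@le_trans _ _ (\sum_(s : pattern b | `[< disc_pattern s >]) #|[set z' | copy s L z z']|%:R * Gam)).
    rewrite -mulr_suml -natr_sum; apply: ler_wpM2r; first exact: ltW.
    rewrite ler_nat /deg /=.
    apply: leq_trans (card_bigcup_le _ _).
    apply: subset_leq_card; apply/subsetP => z'; rewrite inE => /existsP [s /and3P[ds _ cs]].
    by apply/bigcupP; exists s => //; rewrite inE.
  apply: (@le_trans _ _ (\sum_(s : pattern b) 1)).
    rewrite [X in _ <= X](bigID (fun s => `[< disc_pattern s >])) /= -[X in X <= _]addr0.
    apply: lerD; last exact: sumr_ge0.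
    by apply: ler_sum => s /asboolP ds; exact: card_copies z lA tw (leqnn m) bk ds.
  by rewrite sumr_const.
have [F [FL cF hF]] := @conflict_free T L adj M adj_sym (fun c z => bigop.leq_bigmax (F := deg) (c, z)).
exists F; split; first exact: fintype.subset_trans FL (tower_sub tw).
  (* [g] pays for 1/[Gam], [N * (6 * b ^ 2)] for the number of patterns, and the last [N] for
     passing from M to M+1. *)
  pose q := (g + N * (6 * b ^ 2 + 1))%N.
  have M1 : M.+1%:R * eps ^+ q <= 1.
    have h1 : M%:R * eps ^+ (g + N * (6 * b ^ 2)) <= 1.
      apply: le_trans (pow2_eps e0 hN (6 * b ^ 2)); rewrite exprD mulrA mulrC.
      apply: ler_wpM2l => //; apply: le_trans (_ : #|{: pattern b}|%:R <= _).
        by apply: le_trans hM; exact: ler_wpM2l.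
      by rewrite -natrX ler_nat.
    have h2 : eps ^+ (g + N * (6 * b ^ 2)) <= 1 by rewrite exprn_ile1 // ltW.
    rewrite /q mulnDr muln1 addnA exprD -natr1 mulrDl mul1r mulrA.
    move: (eX0 N) hN h1 h2; move: (eps ^+ N) (eps ^+ (g + _)) (M%:R * _) => y v u.
    move=> y0 y1 /(ler_wpM2r y0) uy /(ler_wpM2r y0) vy; apply: le_trans (lerD uy vy) _.
    by rewrite !mul1r; apply: le_trans (lerD y1 y1) _; rewrite -splitr.
  have [_ ] := @exponent_bound b k m Q _ b3 erefl erefl erefl erefl.
  rewrite -/N -/a -/g => hE.
  have hE' : (a + 3 * q <= b ^ (25 * b))%N by [].
  apply: (@le_trans _ _ (eps ^+ (a + 3 * q) * n ^+ 2)).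
    by apply: ler_wpM2r; [rewrite exprn_ge0 | exact: expr_eps_le].
  have h1 : eps ^+ a * n ^+ 2 <= (M.+1 ^ 3)%:R * #|F|%:R.
    apply: (@le_trans _ _ #|L|%:R); last by rewrite -natrM ler_nat.
    apply: le_trans (card_octs_density lL hL); apply: ler_wpM2r => //; exact: exprn_ge0.
  rewrite exprD mulrAC mulrC mulnC exprM.
  apply: le_trans (ler_wpM2l (exprn_ge0 3 (eX0 q)) h1) _.
  rewrite natrX mulrA -exprMn -[X in _ <= X]mul1r; apply: ler_wpM2r => //.
  by apply: exprn_ile1; [exact: mulr_ge0 | rewrite mulrC].
move=> s ds z z' cs; have /copyP [phi [h1 h2 h3 h4]] := cs.
rewrite -h3 -h4; apply: hF => //; rewrite h3 h4.
by apply/existsP; exists s; rewrite eqxx (copyS FL cs) /= andbT; apply/asboolP.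
Qed.
End Main.

From mathcomp Require Import all_classical all_reals all_analysis.
Import numFieldNormedType.Exports.
Local Open Scope classical_set_scope.
Local Open Scope ring_scope.

(** * Cocycles on a disc *)

Section StarPotential.
Variables (R : realType) (V : normedModType R) (P : set V).
Variables (I : Type) (le : I -> I -> Prop) (a : I -> I -> bool) (c : V -> I).
Hypothesis aD : forall i j k, le i j -> le j k -> a i k = a i j (+) a j k.
Hypothesis cP : compact P.
Hypothesis starP : forall p t, P p -> 0 <= t <= 1 -> P (t *: p).
Hypothesis P1 : forall p, P p -> `|p| <= 1.
Hypothesis loc : forall p, P p ->
  exists2 r : R, 0 < r & forall q, P q -> `|p - q| < r -> le (c p) (c q).

Lemma lebesgue_centers : exists (eta : R) (u : V -> V) (r : V -> R),
  [/\ 0 < eta,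
      forall p, P p -> [/\ P (u p), `|p - u p| < r (u p) / 3 & eta <= r (u p) / 3],
      forall p, P p -> 0 < r p
    & forall p q, P p -> P q -> `|p - q| < r p -> le (c p) (c q)].
Proof.
have /choice [r rP] : forall p, exists r : R, P p ->
    0 < r /\ forall q, P q -> `|p - q| < r -> le (c p) (c q).
  move=> p; have [Pp|nPp] := pselect (P p); last by exists 0.
  by have [r r0 rle] := loc Pp; exists r.
pose Q (e : R) (p : V) :=
  P p -> exists u, [/\ P u, `|p - u| < r u / 3 & e <= r u / 3].
have : \forall e \near 0^'+, P `<=` Q e.
  move/compact_near_coveringP: cP; apply=> p Pp.
  have r3 : 0 < r p / 3 by rewrite divr_gt0//; case: (rP p Pp).
  exists ([set p' : V | `|p' - p| < r p / 3], [set e : R | e <= r p / 3]) => /=.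
    split; last exact: nbhs_right_le.
    exact: (@cvgr_distC_lt _ _ _ _ _ id p _ _ r3).
  by move=> [p' e] /= [pp' er] Pp'; exists p.
move=> [e /= e0 eQ].
have eta0 : 0 < e / 2 by rewrite divr_gt0.
have etaQ : P `<=` Q (e / 2).
  apply: eQ => //=; rewrite sub0r normrN gtr0_norm//.
  by rewrite ltr_pdivrMr// ltr_pMr// ltr1n.
have /choice [u uP] : forall p, exists u, P p ->
    [/\ P u, `|p - u| < r u / 3 & e / 2 <= r u / 3].
  move=> p; have [Pp|nPp] := pselect (P p); last by exists 0.
  by have [u ?] := etaQ p Pp Pp; exists u.
exists (e / 2), u, r; split=> //; first by move=> p /rP [].
by move=> p q Pp Pq; case: (rP p Pp) => _; apply.
Qed.

(* [g p] sums the transitions along the segment from 0 to [p], cut into steps   *)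
(* shorter than a Lebesgue number.                                              *)
Lemma star_potential : exists g : V -> bool, forall p, P p ->
  exists2 r : R, 0 < r &
    forall q, P q -> `|p - q| < r -> g p (+) g q = a (c p) (c q).
Proof.
have [eta [u [r [eta0 uP r0 rle]]]] := lebesgue_centers.
(* Transport from p to a nearby q through the cell of the centre [u p], which lies below the cells
   of both. *)
pose s p q := a (c (u p)) (c p) (+) a (c (u p)) (c q).
have uq p q : P p -> P q -> `|p - q| < eta -> `|u p - q| < r (u p).
  move=> Pp Pq pq; have [Pu up re] := uP p Pp; have := r0 _ Pu.
  have := ler_distD p (u p) q; rewrite [`|u p - p|]distrC; lra.
have leu p q : P p -> P q -> `|p - q| < eta -> le (c (u p)) (c q).
  move=> Pp Pq pq; have [Pu _ _] := uP p Pp; exact: rle (uq _ _ _ _ _).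
have coc p q w : P p -> P q -> P w -> `|p - q| < eta -> `|q - w| < eta ->
    `|p - w| < eta -> s p q (+) s q w = s p w.
  move=> Pp Pq Pw pq qw pw.
  have qp : `|q - p| < eta by rewrite distrC.
  have qq : `|q - q| < eta by rewrite subrr normr0.
  have [Pu up re] := uP p Pp; have [Pu' up' re'] := uP q Pq.
  have uu : `|u p - u q| < r (u p) / 3 + eta + r (u q) / 3.
    have -> : u p - u q = (u p - p) + (p - q) + (q - u q).
      by rewrite !addrA !subrK.
    rewrite (le_lt_trans (ler_normD _ _))// ltrD//.
    by rewrite (le_lt_trans (ler_normD _ _))// ltrD// distrC.
  (* The two centres are closer than the larger of their radii, so the cell of one lies below that
     of the other and either centre computes the same transition. *)
  have -> : s p q (+) s q w = s p q (+) (a (c (u p)) (c q) (+) a (c (u p)) (c w)).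
    congr addb; rewrite /s.
    have [rpq|rpq] := leP (r (u q)) (r (u p)).
      have upq : le (c (u p)) (c (u q)) by apply: rle => //; lra.
      rewrite (aD upq (leu _ _ Pq Pq qq)) (aD upq (leu _ _ Pq Pw qw)).
      by rewrite addbACA addbb.
    have upq : le (c (u q)) (c (u p)) by apply: rle => //; rewrite distrC; lra.
    rewrite (aD upq (leu _ _ Pp Pq pq)) (aD upq (leu _ _ Pp Pw pw)).
    by rewrite addbACA addbb.
  by rewrite /s addbA -[X in X (+) _]addbA addbb addbF.
have [N N0 NP] : exists2 N : nat, (0 < N)%N & N%:R^-1 < eta / 2.
  have e2 : 0 < eta / 2 by rewrite divr_gt0.
  exists (Num.truncn (eta / 2)^-1).+1 => //.
  rewrite -[ltRHS]invrK ltf_pV2 ?posrE ?invr_gt0 ?ltr0n//.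
  exact: truncnS_gt.
pose sc k (p : V) : V := (k%:R / N%:R : R) *: p.
have Psc k p : (k <= N)%N -> P p -> P (sc k p).
  move=> kN Pp; apply: starP => //.
  by rewrite divr_ge0//= ler_pdivrMr ?ltr0n// mul1r ler_nat.
have scS k p : P p -> `|sc k p - sc k.+1 p| < eta / 2.
  move=> Pp; rewrite -scalerBl -mulrBl -natr1 opprD addNKr.
  rewrite normrZ mulN1r normrN gtr0_norm ?invr_gt0 ?ltr0n//.
  rewrite (le_lt_trans _ NP)// ler_piMr ?invr_ge0//; exact: P1.
have scB k p q : (k <= N)%N -> `|sc k p - sc k q| <= `|p - q|.
  move=> kN; rewrite -scalerBr normrZ ger0_norm ?divr_ge0//.
  by rewrite ler_piMl// ler_pdivrMr ?ltr0n// mul1r ler_nat.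
pose g p := \big[addb/false]_(0 <= k < N) s (sc k p) (sc k.+1 p).
exists g => p Pp.
exists (Num.min (r p) (eta / 2)); first by rewrite lt_min r0// divr_gt0.
move=> q Pq; rewrite lt_min => /andP[pqr pqe].
(* Both segments are compared step by step; each small quadrilateral between them is cut by a
   diagonal into two triangles on which [coc] applies. *)
have tel m : (m <= N)%N ->
    \big[addb/false]_(0 <= k < m) s (sc k p) (sc k.+1 p) (+)
    \big[addb/false]_(0 <= k < m) s (sc k q) (sc k.+1 q) = s (sc m p) (sc m q).
  elim: m => [|m IH] mN; first by rewrite !big_geq// /sc mul0r !scale0r /s !addbb.
  rewrite !big_nat_recr//= addbACA IH ?(ltnW mN)//.
  have /Psc Pm := ltnW mN; have /Psc Pm1 := mN.
  have sp := scS m p Pp; have sq := scS m q Pq.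
  have sm := scB m p q (ltnW mN); have sm1 := scB m.+1 p q mN.
  have d1 : `|sc m p - sc m.+1 q| < eta.
    have -> : sc m p - sc m.+1 q = (sc m p - sc m q) + (sc m q - sc m.+1 q).
      by rewrite addrA subrK.
    by rewrite (le_lt_trans (ler_normD _ _))//; lra.
  rewrite [X in _ (+) X]addbC addbA.
  rewrite (coc (sc m p) (sc m q) (sc m.+1 q)) //; try exact: Pm; try exact: Pm1; try lra.
  rewrite -(coc (sc m p) (sc m.+1 p) (sc m.+1 q)) //; try exact: Pm; try exact: Pm1; try lra.
  by rewrite addbAC addbb.
rewrite /g tel// /sc divff ?pnatr_eq0 -?lt0n// !scale1r /s.
have pe : `|p - q| < eta by lra.
have pp : `|p - p| < eta by rewrite subrr normr0.
rewrite (aD (leu _ _ Pp Pp pp) (rle _ _ Pp Pq pqr)).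
by rewrite addbA addbb.
Qed.
End StarPotential.

Lemma locally_constant_segment (R : realType) (H : R -> bool) :
  (forall t, 0 <= t <= 1 -> exists2 r : R, 0 < r &
     forall t', 0 <= t' <= 1 -> `|t - t'| < r -> H t' = H t) ->
  H 0 = H 1.
Proof.
move=> loc.
have /choice [r rP] : forall t, exists r : R, 0 <= t <= 1 ->
    0 < r /\ forall t', 0 <= t' <= 1 -> `|t - t'| < r -> H t' = H t.
  move=> t; have [/loc [r]|] := boolP (0 <= t <= 1); last by exists 0.
  by exists r.
pose C b := \bigcup_(t in [set t | (0 <= t <= 1) && (H t == b)]) ball t (r t).
have oC b : open (C b) by apply: bigcup_open => t _; exact: ball_open.
have CE b t : 0 <= t <= 1 -> C b t -> H t = b.
  move=> t01 [t' /= /andP[t'01 /eqP <-]] tt'.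
  by case: (rP t' t'01) => _; apply.
have EC b t : 0 <= t <= 1 -> H t = b -> C b t.
  move=> t01 Ht; exists t; first by rewrite /= t01 Ht eqxx.
  by apply: ballxx; case: (rP t t01).
have := @segment_connected R 0 1 [set t | 0 <= t <= 1 /\ H t = H 0].
have i0 : (0 <= (0 : R) <= 1) by rewrite lexx ler01.
have i1 : (0 <= (1 : R) <= 1) by rewrite lexx ler01.
move=> /(_ _ _ _)/seteqP [] //.
- by exists 0.
- exists (C (H 0)) => //; apply/seteqP; split=> t /=; rewrite in_itv/=.
    by move=> [t01 Ht]; split=> //; exact: EC.
  by move=> [t01 Ct]; split=> //; exact: CE Ct.
- exists (~` C (~~ H 0)); first by rewrite closedC.
  apply/seteqP; split=> t /=; rewrite in_itv/=.
    by move=> [t01 Ht]; split=> // /(CE _ _ t01); rewrite Ht; case: (H 0).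
  move=> [t01 Ct]; split=> //; apply: contra_notP Ct => Ht; apply: EC => //.
  by case: (H t) (H 0) Ht => [] [].
- by move=> _ /(_ 1); rewrite /= in_itv/= => /(_ i1) [].
Qed.

Section SetTypeNbhs.
Variables (R : realType) (V : normedModType R) (A : set V).

Lemma nbhs_set_typeP (p : A) (U : set A) : nbhs p U <->
  exists2 r : R, 0 < r & forall q : A, `|set_val p - set_val q| < r -> U q.
Proof.
split.
  move=> [_ [[W oW <-]] /= Wp WU].
  have /nbhs_ballP [r r0 rW] : nbhs (set_val p) W by exact: open_nbhs_nbhs.
  by exists r => // q pq; apply: WU; apply: rW; rewrite -ball_normE.
move=> [r r0 rU].
exists (set_val @^-1` (ball (set_val p) r)); first split=> /=.
- by exists (ball (set_val p) r) => //; exact: ball_open.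
- exact: ballxx.
- by move=> q /=; rewrite -ball_normE => /rU.
Qed.
End SetTypeNbhs.

Definition edge_ends (D : tricomplex) (e : edge D) : vertex D * vertex D :=
  match e with
  | inl (inl x) => (inl (inl (srcX x)), inl (inr (tgtX x)))
  | inl (inr y) => (inl (inr (srcY y)), inr (tgtY y))
  | inr z => (inl (inl (srcZ z)), inr (tgtZ z))
  end.

Section CellOrder.
Variable D : tricomplex.

Definition cell_le (s t : cell D) : bool :=
  match s, t with
  | inl (inl v), inl (inl v') => v == v'
  | inl (inl v), inl (inr e) => v \in [:: (edge_ends e).1; (edge_ends e).2]
  | inl (inl v), inr f =>
    v \in [:: inl (inl (srcX (val f).1.1)); inl (inr (srcY (val f).1.2));
              inr (tgtZ (val f).2)]
  | inl (inr e), inl (inr e') => e == e'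
  | inl (inr e), inr f => incident e (val f)
  | inr f, inr f' => f == f'
  | _, _ => false
  end.

Variable w : edge D -> bool.
Hypothesis wP : forall x y z, (x, y, z) \in faces D ->
  w (inl (inl x)) (+) w (inl (inr y)) (+) w (inr z) = false.

(* [cell_pot t s] is the transport along [w], inside the closed cell [t], from *)
(* the first vertex of [t] (in the order U, V, W) to the first vertex of [s].  *)
Definition cell_pot (t s : cell D) : bool :=
  match t, s with
  | inl (inr (inl (inl x as e))), inl (inl (inl (inr _))) => w (inl (inl x))
  | inl (inr (inl (inr y))), inl (inl (inr _)) => w (inl (inr y))
  | inl (inr (inr z)), inl (inl (inr _)) => w (inr z)
  | inr f, inl (inl (inl (inr _))) => w (inl (inl (val f).1.1))
  | inr f, inl (inl (inr _)) => w (inr (val f).2)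
  | inr f, inl (inr (inl (inr _))) => w (inl (inl (val f).1.1))
  | _, _ => false
  end.

Lemma cell_le_refl s : cell_le s s.
Proof. by case: s => [[v|e]|f] /=. Qed.

Lemma cell_le_trans s t u : cell_le s t -> cell_le t u -> cell_le s u.
Proof.
case: t => [[t|t]|t]; case: s => [[s|s]|s] //; case: u => [[u|u]|u] //=.
all: try by move=> /eqP ->.
all: try by move=> st /eqP <-.
case: u t => -[[x y] z] /= fP [[t|t]|t] /=; have [e1 e2 e3] := facesP fP;
  rewrite !inE => /orP[] /eqP -> /eqP <- /=; rewrite ?e1 ?e2 -?e3 eqxx ?orbT //.
Qed.

Lemma cell_potD s t u : cell_le s t -> cell_le t u ->
  cell_pot u s = cell_pot t s (+) cell_pot u t.
Proof.
have pot_refl c : cell_pot c c = false.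
  by case: c => [[[[?|?]|?]|[[?|?]|?]]|?].
have [-> _ _|tu] := eqVneq t u; first by rewrite pot_refl addbF.
have [-> _ _|st] := eqVneq s t; first by rewrite pot_refl.
case: t st tu => [[t|t]|t]; case: s => [[s|s]|s] //; case: u => [[u|u]|u] //=.
all: try by move=> st _ /eqP e; rewrite e eqxx in st.
all: try by move=> _ tu _ /eqP e; rewrite e eqxx in tu.
case: u t => -[[x y] z] /= fP [[t|t]|t] /= _ _; have := wP fP;
  rewrite !inE => wf st /eqP e; subst t; case/orP: st => /eqP -> /=.
all: by rewrite ?addbb ?addbF//; move: wf; do 3 case: (w _).
Qed.
End CellOrder.

Section DiscCocycle.
Variables (R : realType) (D : tricomplex).

(** Nonzero barycentric coordinates stay nonzero nearby, so passing to a nearby point can only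
    enlarge the supporting cell. *)
Lemma carrier_open (s : cell D) (p0 : R * R * R) : simplex s p0 ->
  exists2 r : R, 0 < r & forall p, simplex s p -> `|p0 - p| < r ->
    cell_le (carrier s p0) (carrier s p).
Proof.
move=> sp0.
have keep (f : R * R * R -> R) : continuous f ->
    exists2 r : R, 0 < r & forall p, `|p0 - p| < r -> f p = 0 -> f p0 = 0.
  move=> cf; have [->|f0] := eqVneq (f p0) 0; first by exists 1.
  have /nbhs_ballP [r r0 rf] : \forall p \near p0, f p != 0.
    exact: (cvgr_neq0 (f p0) (cf p0) f0).
  by exists r => // p pp /eqP; have := rf p; rewrite -ball_normE /= => /(_ pp)/negPf ->.
have [r1 r10 h1] := keep (fun p => p.1.1) (fun p => cvg_comp _ _ cvg_fst cvg_fst).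
have [r2 r20 h2] := keep (fun p => p.1.2) (fun p => cvg_comp _ _ cvg_fst cvg_snd).
have [r3 r30 h3] := keep (fun p => p.2) (fun p => cvg_snd).
exists (Num.min r1 (Num.min r2 r3)); first by rewrite !lt_min r10 r20.
move=> p sp; rewrite !lt_min => /and3P[/h1 + /h2 + /h3 +].
move=> /= k1 k2 k3.
have nz : ~ [/\ p0.1.1 = 0, p0.1.2 = 0 & p0.2 = 0].
  case: sp0 => -[_ /eqP s1] _ [e1 e2 e3].
  by rewrite e1 e2 e3 !addr0 eq_sym oner_eq0 in s1.
have im (a b : R) : (a = 0 -> b = 0) -> (a == 0) ==> (b == 0).
  by move=> ab; apply/implyP => /eqP /ab ->.
move: (im _ _ k1) (im _ _ k2) (im _ _ k3) => {k1 k2 k3 h1 h2 h3}.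
have {nz} : ~~ [&& p0.1.1 == 0, p0.1.2 == 0 & p0.2 == 0].
  by apply/and3P => -[/eqP ? /eqP ? /eqP ?]; exact: nz.
case: s sp0 sp => [[v|e]|[[[x y] z] fP]] sp0 sp.
- by rewrite /= eqxx.
- case: e sp0 sp => [[x|y]|z] [_ /= /eqP sp0] [_ /= /eqP sp]; rewrite /=;
  move: sp0 sp;
  move: (p0.1.1 == 0) (p.1.1 == 0) (p0.1.2 == 0) (p.1.2 == 0) (p0.2 == 0) (p.2 == 0);
  clear; do 6 case; rewrite //= ?inE ?eqxx ?orbT //.
- have [e1 e2 e3] := facesP fP.
  rewrite /carrier /edge_carrier /=.
  move: (p0.1.1 == 0) (p.1.1 == 0) (p0.1.2 == 0) (p.1.2 == 0) (p0.2 == 0) (p.2 == 0).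
  clear -e1 e2 e3.
  by do 6 case; rewrite //= ?inE ?e1 ?e2 ?e3 ?eqxx ?orbT.
Qed.

Definition disc_cell (q : realization R D) : cell D :=
  (point_data (repr q : disjoint_simplices R D)).1.

Lemma disc_cell_pi (x : disjoint_simplices R D) :
  disc_cell (\pi_(realization R D) x)%qT = carrier (projT1 x) (set_val (projT2 x)).
Proof.
rewrite /disc_cell.
have /eqmodP : (repr (\pi_(realization R D) x)%qT = x %[mod realization R D])%qT.
  exact: reprK.
by move=> /eqP /(congr1 fst) /= e; exact: e.
Qed.
End DiscCocycle.

Lemma closed_disc_coord (R : realType) (p : R * R) : closed_disc R p ->
  `|p.1| <= 1 /\ `|p.2| <= 1.
Proof.
move=> dp; have dp' : p.1 ^+ 2 + p.2 ^+ 2 <= 1 := dp.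
rewrite -[`|p.1| <= 1]ler_sqr ?nnegrE// -[`|p.2| <= 1]ler_sqr ?nnegrE//.
by rewrite !real_normK ?num_real// expr1n; have := sqr_ge0 p.1; have := sqr_ge0 p.2; lra.
Qed.

Lemma closed_disc_compact (R : realType) : compact (closed_disc R).
Proof.
apply: (@subclosed_compact _ _ (`[(-1 : R), 1]%classic `*` `[(-1 : R), 1]%classic)).
- rewrite (_ : closed_disc R = (fun p : R * R => p.1 * p.1 + p.2 * p.2) @^-1` [set x | x <= 1]) //.
  apply: closed_comp; last exact: closed_le.
  move=> p _; apply: cvgD.
    by apply: cvgM; exact: cvg_fst.
  by apply: cvgM; exact: cvg_snd.
- by apply: compact_setX; exact: segment_compact.
- move=> p /closed_disc_coord [p1 p2]; split; rewrite /= in_itv /=.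
    by rewrite -ler_norml.
  by rewrite -ler_norml.
Qed.

Section DiscCocycle.
Variables (R : realType) (D : tricomplex) (w : edge D -> bool).
Hypothesis wP : forall x y z, (x, y, z) \in faces D ->
  w (inl (inl x)) (+) w (inl (inr y)) (+) w (inr z) = false.

Definition edge_point (e : edge D) (t : R) : R * R * R :=
  match e with
  | inl (inl _) => (1 - t, t, 0)
  | inl (inr _) => (0, 1 - t, t)
  | inr _ => (1 - t, 0, t)
  end.

Lemma edge_pointP e t : 0 <= t <= 1 -> simplex (edge_cell e) (edge_point e t).
Proof.
by case/andP=> t0 t1; case: e => [[x|y]|z];
  rewrite /simplex /std_triangle /=; split => //=; split; rewrite ?subr_ge0 ?lexx //;
  ring.
Qed.

Lemma edge_point_dist e t t' : `|edge_point e t - edge_point e t'| <= `|t - t'|.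
Proof.
have d : `|(1 - t) - (1 - t')| = `|t - t'|.
  by rewrite opprB addrC addrA subrK distrC.
by case: e => [[x|y]|z]; rewrite prod_normE /= !prod_normE /= ?d ?subrr ?normr0
  !ge_max ?lexx ?normr_ge0.
Qed.

Definition vertex_point (v : vertex D) : R * R * R :=
  match v with
  | inl (inl _) => (1, 0, 0)
  | inl (inr _) => (0, 1, 0)
  | inr _ => (0, 0, 1)
  end.

Lemma vertex_pointP v : simplex (vertex_cell v) (vertex_point v).
Proof.
by case: v => [[u|v]|z]; rewrite /simplex /std_triangle /=; split => //=;
  split; rewrite ?ler01 ?addr0 ?add0r.
Qed.

Lemma edge_carrier_le (e : edge D) p : cell_le (edge_carrier (R := R) e p) (edge_cell e).
Proof.
by case: e => [[x|y]|z]; rewrite /edge_carrier; do 2?case: ifP => _;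
  rewrite /= ?eqxx ?inE ?eqxx ?orbT.
Qed.

Lemma edge_carrier0 (e : edge D) : edge_carrier e (edge_point e 0) = vertex_cell (edge_ends e).1.
Proof. by case: e => [[x|y]|z]; rewrite /= subr0 oner_eq0 eqxx. Qed.

Lemma edge_carrier1 (e : edge D) : edge_carrier e (edge_point e 1) = vertex_cell (edge_ends e).2.
Proof. by case: e => [[x|y]|z]; rewrite /= subrr eqxx. Qed.

Lemma edge_point0 (e : edge D) : edge_point e 0 = vertex_point (edge_ends e).1.
Proof. by case: e => [[x|y]|z]; rewrite /= subr0. Qed.

Lemma edge_point1 (e : edge D) : edge_point e 1 = vertex_point (edge_ends e).2.
Proof. by case: e => [[x|y]|z]; rewrite /= subrr. Qed.

Lemma disc_cell_nbhs (q : realization R D) :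
  nbhs q [set q' | cell_le (disc_cell q) (disc_cell q')].
Proof.
pose U := [set q' : realization R D | cell_le (disc_cell q) (disc_cell q')].
apply: (@open_nbhs_nbhs _ q U); split; last exact: cell_le_refl.
rewrite /open /= /quotient_open; apply/sigT_openP => s.
rewrite openE => p qp0.
have qp : cell_le (disc_cell q) (carrier s (set_val p)).
  by rewrite -[X in cell_le _ X](disc_cell_pi (existT _ s p)); exact: qp0.
have [r r0 rP] := carrier_open (set_valP p).
apply/nbhs_set_typeP; exists r => // p' pp'.
rewrite [preimage _ _ _]/= /U /= -[X in is_true X]/(cell_le _ _).
rewrite disc_cell_pi /=; apply: cell_le_trans qp _; apply: rP => //; exact: set_valP.
Qed.

(** The disc is compact and star-shaped, so [star_potential] integrates the transitions [cell_pot]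
    to a function on it; its values at the vertices are the wanted potential. *)
Lemma disc_cocycle_trivial : homeomorphic (realization R D) (closed_disc R) ->
  exists g : vertex D -> bool,
    forall e, w e = g (edge_ends e).1 (+) g (edge_ends e).2.
Proof.
move=> [h [k [ch ck hk kh]]].
have d0 : closed_disc R 0 by rewrite /closed_disc /= expr0n /= addr0 ler01.
pose o : closed_disc R := exist _ 0 (mem_set d0).
pose c (p : R * R) := disc_cell (k (insubd o p)).
have cE (x : closed_disc R) : c (set_val x) = disc_cell (k x).
  by rewrite /c valKd.
have [|||||g gP] := @star_potential R (R * R)%type (closed_disc R) (cell D)
    (@cell_le D) (fun s t => cell_pot w t s) c.
- by move=> s t u; exact: cell_potD.
- exact: closed_disc_compact.
- move=> p t dp /andP[t0 t1]; rewrite /closed_disc /= !exprMn -mulrDr.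
  by apply: mulr_ile1 => //; rewrite ?exprn_ge0 ?exprn_ile1// addr_ge0 ?sqr_ge0.
- by move=> p /closed_disc_coord [p1 p2]; rewrite prod_normE /= ge_max p1.
- move=> p dp; pose x : closed_disc R := exist _ p (mem_set dp).
  have /nbhs_set_typeP [r r0 rP] : nbhs x (k @^-1` [set q' | cell_le (disc_cell (k x)) (disc_cell q')]).
    by apply: ck; exact: disc_cell_nbhs.
  exists r => // q dq pq; pose y : closed_disc R := exist _ q (mem_set dq).
  by rewrite -[p]/(set_val x) -[q]/(set_val y) !cE; exact: rP.
pose gg (x : disjoint_simplices R D) := g (set_val (h (\pi_(realization R D) x)%qT)).
have ggP (s : cell D) (p : simplex s) : exists2 r : R, 0 < r &
    forall p' : simplex s, `|set_val p - set_val p'| < r ->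
    cell_le (carrier s (set_val p)) (carrier s (set_val p')) /\
    gg (existT _ s p) (+) gg (existT _ s p') =
    cell_pot w (carrier s (set_val p')) (carrier s (set_val p)).
  have [r1 r10 r1P] := carrier_open (set_valP p).
  set q := (\pi_(realization R D) (existT _ s p : disjoint_simplices R D))%qT.
  have [r r0 rP] := gP _ (set_valP (h q)).
  have /nbhs_set_typeP [r2 r20 r2P] : nbhs p
      [set p' : simplex s | `|set_val (h q) -
        set_val (h (\pi_(realization R D) (existT _ s p' : disjoint_simplices R D))%qT)| < r].
    have : nbhs (h q) [set x | `|set_val (h q) - set_val x| < r].
      by apply/nbhs_set_typeP; exists r.
    move/ch; rewrite nbhs_simpl => /pi_continuous; rewrite nbhs_simpl.
    exact: existT_continuous.
  exists (Num.min r1 r2); first by rewrite lt_min r10.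
  move=> p'; rewrite lt_min => /andP[/r1P pp1 /r2P /= pp2]; split.
    by apply: pp1; exact: set_valP.
  rewrite /gg rP //; last exact: set_valP.
  by rewrite !cE !hk !disc_cell_pi.
pose pv v : simplex (vertex_cell v) := exist _ (vertex_point v) (mem_set (vertex_pointP v)).
pose gv v := gg (existT (fun s => set_type (simplex s)) (vertex_cell v) (pv v)).
exists gv => e.
have i0 : (0 <= (0 : R) <= 1) by rewrite lexx ler01.
have i1 : (0 <= (1 : R) <= 1) by rewrite lexx ler01.
pose pe0 : simplex (edge_cell e) := exist _ (edge_point e 0) (mem_set (edge_pointP e i0)).
pose pe t : simplex (edge_cell e) := insubd pe0 (edge_point e t).
have peE t : 0 <= t <= 1 -> set_val (pe t) = edge_point e t.
  by move=> t01; exact: (insubdK pe0 (mem_set (edge_pointP e t01))).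
pose ge t := gg (existT _ (edge_cell e) (pe t)).
have geE t v : 0 <= t <= 1 -> edge_point e t = vertex_point v ->
    edge_carrier e (edge_point e t) = vertex_cell v -> ge t = gv v.
  move=> t01 tv cv; rewrite /ge /gv /gg; congr (g (set_val (h _))).
  apply/eqmodP; rewrite /= /glued /point_data /= peE// cv tv.
  exact: eqxx.
(* Correcting by the transition to the edge removes the jumps at the ends, so [H] is locally
   constant, and comparing its ends yields [w e]. *)
pose H t := ge t (+) cell_pot w (edge_cell e) (edge_carrier e (edge_point e t)).
have : H 0 = H 1.
  apply: locally_constant_segment => t t01.
  have [r r0 rP] := ggP _ (pe t); exists r => // t' t'01 tt'.
  have [] := rP (pe t').
    by rewrite !peE//; exact: le_lt_trans (edge_point_dist _ _ _) tt'.
  rewrite !peE//= => le1 e1.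
  rewrite /H (cell_potD wP le1 (edge_carrier_le _ _)) -e1.
  by rewrite addbA addbA addbb.
rewrite /H (geE _ _ i0 (edge_point0 e) (edge_carrier0 e)).
rewrite (geE _ _ i1 (edge_point1 e) (edge_carrier1 e)).
rewrite edge_carrier0 edge_carrier1.
have -> : cell_pot w (edge_cell e) (vertex_cell (edge_ends e).1) = false.
  by case: (e) => [[x|y]|z].
have -> : cell_pot w (edge_cell e) (vertex_cell (edge_ends e).2) = w e.
  by case: (e) => [[x|y]|z].
by rewrite addbF => ->; rewrite addbAC addbb.
Qed.
End DiscCocycle.

Local Close Scope classical_set_scope.
From mathcomp Require Import fintype finset.

(** * From complexes to labels *)

Lemma disc_two_sided (R : realType) (D : tricomplex) :
  tripartite_disc R D -> #|boundary D| = 2%N -> two_sided D.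
Proof.
case=> hD deg2 bd2; split=> // w wP.
have [g gP] := disc_cocycle_trivial wP hD; exists g => e c c'.
rewrite gP; case: e => [[?|?]|?]; case: c; case: c' => //= _ _ _; by rewrite addbC.
Qed.

Lemma boundary_face (D : tricomplex) (e : edge D) : e \in boundary D ->
  exists2 f, f \in faces D & incident e f.
Proof.
rewrite in_set => /eqP h; have /card_gt0P [f] : (0 < face_degree e)%N by rewrite h.
by rewrite in_set => /andP[]; exists f.
Qed.

Lemma boundary_pair (D : tricomplex) : #|boundary D| = 2%N ->
  exists e0 e1, [/\ e0 \in boundary D, e1 \in boundary D & e0 != e1].
Proof.
move=> h; have /cards2P [e0 [e1 [ne bE]]] : #|boundary D| == 2%N by rewrite h.
by exists e0, e1; rewrite bE !in_set2 !eqxx orbT.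
Qed.

(** A component carrying the boundary has 2 |A| faces, a positive even number. *)
Lemma two_sided_area (D : tricomplex) : two_sided D -> (2 <= area D)%N.
Proof.
case=> deg2 bd2 coc; have [e0 [e1 [b0 b1 ne]]] := boundary_pair bd2.
have [f1 fD i1] := boundary_face b1.
have [d [A [tree [mt [rk /= [_ cA _ _]]]]]] := surface_system deg2 bd2 coc b0 b1 ne fD i1.
have : (#|cF f1| <= area D)%N.
  by apply: subset_leq_card; apply/subsetP => f; exact: cF_faces fD _.
have : (0 < #|cF f1|)%N by apply/card_gt0P; exists f1; exact: f1_cF.
by move: cA; move: #|A| #|cF f1| (area D); lia.
Qed.

Section Transfer.
Variables (n : nat) (K : tricomplex).
Hypothesis hK : linear_tricomplex n K.

Let cX : #|tcX K| = n. Proof. by have [_ [[]]] := hK. Qed.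
Let cY : #|tcY K| = n. Proof. by have [_ [[]]] := hK. Qed.
Let cZ : #|tcZ K| = n. Proof. by have [_ [[]]] := hK. Qed.

Definition label (t : tcX K * tcY K * tcZ K) : 'I_n * 'I_n * 'I_n :=
  (cast_ord cX (enum_rank t.1.1), cast_ord cY (enum_rank t.1.2), cast_ord cZ (enum_rank t.2)).

Lemma coord_label c t t' : coord c (label t) = coord c (label t') -> fedge c t = fedge c t'.
Proof. by case: c => /= /cast_ord_inj/enum_rank_inj ->. Qed.

Lemma label_inj : injective label.
Proof.
move=> [[x y] z] [[x' y'] z'] e; have := coord_label (congr1 (coord C0) e).
have := coord_label (congr1 (coord C1) e); have := coord_label (congr1 (coord C2) e).
by move=> [->] [->] [->].
Qed.

Definition label_set : {set 'I_n * 'I_n * 'I_n} := label @: faces K.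

(** By linearity, two faces with two common edges coincide. *)
Lemma label_set_latin : latin label_set.
Proof.
have key t t' c c' : t \in faces K -> t' \in faces K -> c != c' ->
    coord c (label t) = coord c (label t') -> coord c' (label t) = coord c' (label t') -> t = t'.
  move=> tK tK' cc /coord_label h /coord_label h'.
  have ne : fedge c t != fedge c' t.
    by apply: contraNneq cc => e; rewrite -(edge_cls_fedge c t) e edge_cls_fedge.
  have [_ [_ lin]] := hK.
  have /card_le1_eqP := lin _ _ ne; apply; rewrite inE; apply/andP; split=> //; apply/andP; split;
    by [exact: incident_fedge erefl | exact: incident_fedge (esym h) | exact: incident_fedge (esym h')].
split=> a b.
- move=> d d' /imsetP [t tK e] /imsetP [t' tK' e'].
  have E : t = t' by apply: (key t t' C0 C1) => //; rewrite -e -e'.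
  by rewrite E -e' in e; case: e.
- move=> b' d /imsetP [t tK e] /imsetP [t' tK' e'].
  have E : t = t' by apply: (key t t' C0 C2) => //; rewrite -e -e'.
  by rewrite E -e' in e; case: e.
- move=> d d' /imsetP [t tK e] /imsetP [t' tK' e'].
  have E : t = t' by apply: (key t t' C1 C2) => //; rewrite -e -e'.
  by rewrite E -e' in e; case: e.
Qed.

Lemma num_octahedra_le : (num_octahedra K <= #|octs label_set|)%N.
Proof.
pose g (t : {ffun bool * bool * bool -> tcX K * tcY K * tcZ K}) :
    {ffun bool * bool -> 'I_n} * {ffun bool * bool -> 'I_n} * {ffun bool * bool -> 'I_n} :=
  ([ffun w => coord C0 (label (t (false, w.1, w.2)))],
   [ffun w => coord C1 (label (t (w.1, false, w.2)))],
   [ffun w => coord C2 (label (t (w.1, w.2, false)))]).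
have gE (t : {ffun bool * bool * bool -> tcX K * tcY K * tcZ K}) : octahedron t ->
    (forall w, t w \in faces K) /\ forall i j k,
    ((g t).1.1 (j, k), (g t).1.2 (i, k), (g t).2 (i, j)) = label (t (i, j, k)).
  case/andP=> /forallP h1 /forallP h2; split=> // i j k; rewrite !ffunE /=.
  have /forallP/(_ (i, j, k))/and3P [/implyP hx _ _] := h2 (false, j, k).
  have /forallP/(_ (i, j, k))/and3P [_ /implyP hy _] := h2 (i, false, k).
  have /forallP/(_ (i, j, k))/and3P [_ _ /implyP hz] := h2 (i, j, false).
  have /eqP ex := hx (introT andP (conj (eqxx j) (eqxx k))).
  have /eqP ey := hy (introT andP (conj (eqxx i) (eqxx k))).
  have /eqP ez := hz (introT andP (conj (eqxx i) (eqxx j))).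
  by rewrite /label ex ey ez.
have ginj : {in [set t | octahedron (K := K) t] &, injective g}.
  move=> t t'; rewrite !in_set => /gE [_ h] /gE [_ h'] e; apply/ffunP => -[[i j] k].
  by apply: label_inj; rewrite -h -h' e.
rewrite /num_octahedra -(card_in_imset ginj); apply: subset_leq_card.
apply/subsetP => _ /imsetP [t + ->]; rewrite in_set => /gE [h1 h2].
by apply/octsP => i j k; rewrite h2; exact: imset_f.
Qed.
End Transfer.

Lemma card_octs_max (T : finType) (A : {set T * T * T}) : latin A -> (#|octs A| <= #|T| ^ 5)%N.
Proof.
move=> lA; rewrite -(card_twins C0 lA); apply: leq_trans (card_twins_le (view_latin C0 lA)) _.
by apply: leq_trans (max_card _) _; rewrite !card_prod !expnS expn0 muln1 !mulnA.
Qed.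

(** The faces of the disc, listed with repetitions, give a pattern, and the homomorphism gives a
    copy of it. The boundary edges have the same class and now the same label, so their images
    coincide. *)
Lemma no_copy (R : realType) n (K : tricomplex) (hK : linear_tricomplex n K) b
    (F : {set tcX K * tcY K * tcZ K}) (sFK : F \subset faces K) (FT : {set 'I_n * 'I_n * 'I_n}) :
  (forall t, t \in F -> label hK t \in FT) ->
  (forall s : pattern b, disc_pattern s -> forall z z', copy s FT z z' -> z = z') ->
  ~ (exists (D : tricomplex) (h : tri_hom D (subcomplex sFK)),
         [/\ tripartite_disc R D,
             (area D < b)%N,
             #|boundary D| = 2%N
           & forall e e' : edge D, e \in boundary D -> e' \in boundary D ->
               e != e' -> tri_hom_edge h e != tri_hom_edge h e']).
Proof.
move=> FFT hF [D [h [discD aD bd2 hne]]].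
have tD := disc_two_sided discD bd2; have [deg2 _ coc] := tD.
have [e0 [e1 [b0 b1 ne]]] := boundary_pair bd2.
have [f0 f0D i0] := boundary_face b0; have [f1 f1D i1] := boundary_face b1.
pose en (j : 'I_b) := nth f1 (enum (faces D)) j.
have enD j : en j \in faces D.
  rewrite /en; have [lt|ge] := ltnP j (size (enum (faces D))).
    by rewrite -mem_enum mem_nth.
  by rewrite nth_default.
have enS f : f \in faces D -> exists j, f = en j.
  rewrite -mem_enum => fD.
  have lt : (index f (enum (faces D)) < b)%N.
    by apply: leq_trans aD; rewrite ltnS /area cardE ltnW // index_mem.
  by exists (Ordinal lt); rewrite /en /= nth_index.
have [j0 E0] := enS _ f0D; have [j1 E1] := enS _ f1D.
pose c := edge_cls e0; have cE : edge_cls e1 = c.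
  by rewrite /c (boundary_cls deg2 bd2 b0 b1 ne f1D i1).
have h0 : fedge c (en j0) = e0 by move: i0; rewrite -E0 incidentE => /eqP.
have h1 : fedge c (en j1) = e1 by move: i1; rewrite -E1 incidentE cE => /eqP.
pose s : pattern b := ([ffun p => fedge p.1 (en p.2.1) == fedge p.1 (en p.2.2)], (c, (j0, j1))).
have ds : disc_pattern s.
  exists D, e0, e1, en; split=> //; split=> // c' j j'; by rewrite ffunE.
pose im (f : tcX D * tcY D * tcZ D) : tcX K * tcY K * tcZ K := (homX h f.1.1, homY h f.1.2, homZ h f.2).
have imE c' f : tri_hom_edge h (fedge c' f) = fedge (D := subcomplex sFK) c' (im f) by case: c'.
have imF f : f \in faces D -> im f \in F.
  by case: f => [[x y] z] fD; exact: (hom_faces h fD).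
pose phi : {ffun 'I_b -> 'I_n * 'I_n * 'I_n} := [ffun j => label hK (im (en j))].
have cp : copy s FT (coord c (phi j0)) (coord c (phi j1)).
  apply/copyP; exists phi; split=> // [j|c' j j'].
    by rewrite ffunE; apply: FFT; exact: imF.
  rewrite ffunE /= => /eqP e; rewrite !ffunE.
  by case: c' e => /= -[e]; rewrite /label /im /= e.
have := hne _ _ b0 b1 ne; rewrite -h0 -h1 !imE => /negP[]; apply/eqP.
have := hF s ds _ _ cp; rewrite !ffunE => /coord_label.
by case: (c).
Qed.

Theorem theorem5p8 (R : realType) (b : nat) (hb : (0 < b)%N) (n : nat)
    (K : tricomplex) (hK : linear_tricomplex n K) (eps : R) (heps : 0 < eps)
    (hoct : eps * n%:R ^+ 5 <= (num_octahedra K)%:R) :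
  exists (F : {set tcX K * tcY K * tcZ K}) (sFK : F \subset faces K),
    eps ^+ (b ^ (25 * b)) * n%:R ^+ 2 <= (#|F|)%:R :> R /\
    ~ (exists (D : tricomplex) (h : tri_hom D (subcomplex sFK)),
         [/\ tripartite_disc R D,
             (area D < b)%N,
             #|boundary D| = 2%N
           & forall e e' : edge D, e \in boundary D -> e' \in boundary D ->
               e != e' -> tri_hom_edge h e != tri_hom_edge h e']).
Proof.
have lA := label_set_latin hK; set A := label_set hK in lA.
have hA : eps * n%:R ^+ 5 <= #|octs A|%:R.
  by apply: le_trans hoct _; rewrite ler_nat; exact: num_octahedra_le.
have cT : #|'I_n| = n := card_ord n.
have [n0|n0] := posnP n.
  exists set0, (sub0set _); split; first by rewrite n0 expr0n mulr0 cards0.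
  move=> [D [h [_ _ bd2 _]]]; have [e0 [_ [b0 _ _]]] := boundary_pair bd2.
  have [[[x y] z] fD _] := boundary_face b0.
  by have := hom_faces h fD; rewrite in_set0.
(* There are at most n^5 octahedra. *)
have e1 : eps <= 1.
  have p : 0 < n%:R ^+ 5 :> R by rewrite exprn_gt0 // ltr0n.
  rewrite -(ler_pM2r p) mul1r; apply: le_trans hA _.
  by rewrite -natrX ler_nat -[X in (_ <= X ^ _)%N]cT; exact: card_octs_max.
have T0 : (0 < #|'I_n|)%N by rewrite cT.
(* For b at most 2 no disc in question has fewer than b faces, so all faces are kept. *)
have [b2|b3] := leqP b 2.
  exists (faces K), (subxx (faces K)); split; last first.
    move=> [D [h [discD aD bd2 _]]]; have := two_sided_area (disc_two_sided discD bd2).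
    by rewrite leqNgt (leq_trans aD b2).
  rewrite -(card_imset _ (label_inj (hK := hK))) -/(label_set hK) -/A.
  have hA' : eps * #|'I_n|%:R ^+ 5 <= #|octs A|%:R by rewrite cT.
  have := card_octs_density T0 lA hA'; rewrite cT; apply: le_trans.
  apply: ler_wpM2r; first by rewrite exprn_ge0.
  rewrite -[X in _ <= X]expr1; apply: ler_wiXn2l => //; first exact: ltW.
  by rewrite expn_gt0 hb.
have hA' : eps * #|'I_n|%:R ^+ 5 <= #|octs A|%:R by rewrite cT.
pose k := (b.-1)./2; pose m := (64 * b)%N.
pose Q := ((193 * 64 * m ^ 2 * k ^ 2) ^ k)%N.
have [FT [sFT cFT hFT]] : exists F : {set 'I_n * 'I_n * 'I_n},
    [/\ F \subset A, eps ^+ (b ^ (25 * b)) * #|'I_n|%:R ^+ 2 <= #|F|%:R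
    & forall s : pattern b, disc_pattern s -> forall z z', copy s F z z' -> z = z'].
  have [h|h] := lerP (Q%:R * (1 - eps)) (1 / 2).
    exact: dense_case b3 T0 lA heps e1 hA' h.
  exact: sparse_case b3 T0 lA heps e1 hA' h.
pose F := [set t in faces K | label hK t \in FT].
have sFK : F \subset faces K by apply/subsetP => t; rewrite in_set => /andP[].
exists F, sFK; split; last by apply: no_copy hFT => t; rewrite in_set => /andP[].
rewrite cT in cFT; apply: le_trans cFT _; rewrite ler_nat.
rewrite -(card_imset _ (label_inj (hK := hK))); apply: subset_leq_card; apply/subsetP => t tF.
have /imsetP [t' tK e] := subsetP sFT _ tF.
by rewrite e; apply: imset_f; rewrite in_set tK -e.
Qed.
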